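(* (i) Assume that $T<\infty$ and that $$C_1(C_{\mathcal A}+1)<\frac{1}{4\sqrt2}.\qquad( * )$$ Set $$T_*=\min\left\{T,\ \frac12\log\left(1+\frac{1}{16\,C_2^2\,(C_{\mathcal A}+1)^2}\right)\right\}.$$ Then for each $v_0\in D(\mathcal A^{1/2})$ the system $$\frac{d}{dt}v+\mathcal L v=0,\qquad v|_{t=0}=v_0,$$ admits a unique strong solution $v$ in $Y_{T_*}$, satisfying $$\|v\|_{Y_{T_*}}\le2\|v_0\|_H+2\sqrt2\,\|\mathcal A^{1/2}v_0\|_H,$$ and for each $0<t<T_*$ $$v(t)=e^{-t\mathcal A}v_0-\int_0^te^{-(t-\tau)\mathcal A}\mathcal B(\tau)v(\tau)\,d\tau.\qquad( ** )$$ (ii) Assume that $T=\infty$ and $C_2=0$, and suppose that $( * )$ holds. Then for each $v_0\in D(\mathcal A^{1/2})$ the same system admits a unique strong solution $v$ in $Y_\infty$, satisfying $$\|v\|_{Y_\infty}\le2\|v_0\|_H+2\sqrt2\,\|\mathcal A^{1/2}v_0\|_H,$$ and $( ** )$ holds for each $0<t<\infty$.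
   Context: $H$ is a (complex) Hilbert space with norm $\|\cdot\|_H$, $T\in(0,\infty]$, $\mathcal A:D(\mathcal A)\subset H\to H$ is a linear operator, and for $0\le t<T$, $\mathcal B(t):D(\mathcal B(t))\to H$ is a linear operator on $H$ with $D(\mathcal A)\subset D(\mathcal B(t))$. Put $\mathcal L(t)f=\mathcal Af+\mathcal B(t)f$, $D(\mathcal L(t))=D(\mathcal A)$. Standing assumptions: (a) $-\mathcal A$ generates a bounded analytic semigroup on $H$; (b) $-\mathcal A$ generates a contraction $C_0$-semigroup on $H$; (c) $\mathcal A$ is a non-negative selfadjoint operator on $H$; (d) there are constants $C_1,C_2>0$ ($C_2=0$ where explicitly assumed) such that $\|\mathcal B(t)f\|_H\le C_1\|\mathcal Af\|_H+C_2\|f\|_H$ for all $f\in D(\mathcal A)$, $0\le t<T$; (e) there is $C>0$ such that for all $\varphi\in C((0,T);D(\mathcal A))$ and $0<s\le t<T$, $\|\mathcal B(t)\varphi(t)-\mathcal B(s)\varphi(s)\|_H\le C(t-s)(\|\mathcal A\varphi(t)\|_H+\|\varphi(t)\|_H)+C(\|\mathcal A\varphi(t)-\mathcal A\varphi(s)\|_H+\|\varphi(t)-\varphi(s)\|_H)$; (f) for each fixed $t_0\in[0,T)$, $-\mathcal L(t_0)$ generates an analytic semigroup on $H$. $C_{\mathcal A}>0$ is a constant (maximal $L^2$-regularity of $\mathcal A$) such that for every $S\in(0,\infty]$, $F\in L^2(0,S;H)$, $V_0\in D(\mathcal A^{1/2})$, the unique solution $V$ of $\frac{d}{dt}V+\mathcal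 AV=F$ on $(0,S)$, $V|_{t=0}=V_0$, satisfies $\|dV/dt\|_{L^2(0,S;H)}+\|\mathcal AV\|_{L^2(0,S;H)}\le\sqrt2\|\mathcal A^{1/2}V_0\|_H+C_{\mathcal A}\|F\|_{L^2(0,S;H)}$. For $S\in(0,\infty]$, $Y_S=\{\varphi\in C((0,S);H):\|\varphi\|_{Y_S}<\infty\}$ with $\|\varphi\|_{Y_S}=\sup_{0<t<S}\{e^{-t}\|\varphi(t)\|_H\}+\|d\varphi/dt\|_{L^2(0,S;H)}+\|\mathcal A\varphi\|_{L^2(0,S;H)}$. A function $v\in Y_S$ is a strong solution of the system (on $(0,S)$) with initial datum $v_0\in D(\mathcal A^{1/2})$ if $\|dv/dt+\mathcal Lv\|_{L^2(0,S;H)}=0$ and $\lim_{t\to0+}v(t)=v_0$ in $H$. *)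

(* Defs.v *)
From HB Require Import structures.
From mathcomp Require Import all_boot all_order all_algebra.
From mathcomp Require Import all_classical all_reals all_analysis.
From mathcomp Require Import complex.

Set Implicit Arguments.
Unset Strict Implicit.
Unset Printing Implicit Defensive.

Import Order.TTheory GRing.Theory Num.Theory.
Import numFieldNormedType.Exports.

Local Open Scope classical_set_scope.
Local Open Scope complex_scope.
Local Open Scope ring_scope.

(* A complex Hilbert space is a complete normed space over [R[i]] together with
   a dot product [ip] (linear in its first argument) such that
   [hilbert_norm ip] holds. *)
Definition hilbert_norm (R : realType) (H : completeNormedModType R[i])
    (ip : {dot H for Num.Def.conjC}) : Prop :=
  forall x : H, `|x| ^+ 2 = ip x x.

(* The norm of a normed space over [R[i]] is [R[i]]-valued, with real values. *)
Definition hnorm (R : realType) (H : normedModType R[i]) (x : H) : R :=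
  complex.Re `|x|.

Section Operators.
Context {R : realType} {H : completeNormedModType R[i]}.

(* The values of [op_app] outside [op_dom] are junk. *)
Record operator := Operator { op_dom : set H ; op_app :> H -> H }.

Definition linear_operator (N : operator) : Prop :=
  op_dom N 0 /\
  forall (a : R[i]) (x y : H), op_dom N x -> op_dom N y ->
    op_dom N (a *: x + y) /\ N (a *: x + y) = a *: N x + N y.

Definition opp_operator (N : operator) : operator :=
  Operator (op_dom N) (fun x => - N x).

(* [N + P] on the domain of [N]; meaningful when [op_dom N `<=` op_dom P]. *)
Definition perturb (N P : operator) : operator :=
  Operator (op_dom N) (fun x => N x + P x).

(* [A] is densely defined and the graph of [A] is the graph of its adjoint. *)
Definition selfadjoint (ip : {dot H for Num.Def.conjC}) (A : operator) : Prop :=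
  [/\ linear_operator A, closure (op_dom A) = [set: H] &
      forall x y : H, (op_dom A x /\ A x = y) <->
        (forall z : H, op_dom A z -> ip (A z) x = ip z y)].

(* In the order of [R[i]], [0 <= z] says that [z] is real and nonnegative. *)
Definition nonneg_selfadjoint (ip : {dot H for Num.Def.conjC}) (A : operator) : Prop :=
  selfadjoint ip A /\ forall x : H, op_dom A x -> 0 <= ip (A x) x.

Definition is_sqrt_operator (ip : {dot H for Num.Def.conjC}) (A Q : operator) : Prop :=
  nonneg_selfadjoint ip Q /\
  forall x y : H, (op_dom A x /\ A x = y) <->
    [/\ op_dom Q x, op_dom Q (Q x) & Q (Q x) = y].

(* Only the values [G t] with [0 <= t] are relevant. *)
Definition C0_semigroup (G : R -> H -> H) : Prop :=
  [/\ forall t, 0 <= t -> linear (G t) /\ continuous (G t),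
      forall x, G 0 x = x,
      forall s t x, 0 <= s -> 0 <= t -> G (s + t) x = G s (G t x) &
      forall x, G t x @[t --> 0^'+] --> x].

Definition contraction_C0_semigroup (G : R -> H -> H) : Prop :=
  C0_semigroup G /\ forall t x, 0 <= t -> hnorm (G t x) <= hnorm x.

Definition generates (N : operator) (G : R -> H -> H) : Prop :=
  forall x y : H, (op_dom N x /\ N x = y) <->
    (h^-1)%:C *: (G h x - x) @[h --> 0^'+] --> y.

Definition sector (theta : R) : set R[i] :=
  [set z | exists r a : R, [/\ 0 < r, `|a| < theta &
    z = (r * cos a) +i* (r * sin a)]].

Definition analytic_semigroup (theta : R) (G : R[i] -> H -> H) : Prop :=
  [/\ forall z, sector theta z -> linear (G z) /\ continuous (G z),
      forall x, G 0 x = x,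
      forall z w x, sector theta z -> sector theta w ->
        G (z + w) x = G z (G w x),
      forall z x, sector theta z ->
        derivable (fun w : R[i]^o => G w x : H) z 1 &
      forall theta', 0 < theta' < theta -> forall x,
        G z x @[z --> within (sector theta') (nbhs (0 : R[i]^o))] --> x].

Definition bounded_on_subsectors (theta : R) (G : R[i] -> H -> H) : Prop :=
  forall theta', 0 < theta' < theta -> exists M : R,
    forall z x, sector theta' z -> hnorm (G z x) <= M * hnorm x.

Definition generates_analytic_semigroup (N : operator) : Prop :=
  exists (theta : R) (G : R[i] -> H -> H),
    [/\ 0 < theta <= pi / 2, analytic_semigroup theta G &
        generates N (fun t => G t%:C)].

Definition generates_bounded_analytic_semigroup (N : operator) : Prop :=
  exists (theta : R) (G : R[i] -> H -> H),
    [/\ 0 < theta <= pi / 2, analytic_semigroup theta G,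
        bounded_on_subsectors theta G & generates N (fun t => G t%:C)].

End Operators.

Arguments operator {R} H.

Section Bochner.
Context {R : realType} {H : completeNormedModType R[i]}.
Local Notation mu := (@lebesgue_measure R).

Definition measurable_simple (s : {fimfun R >-> H}) : Prop :=
  forall x : H, measurable (s @^-1` [set x]).

Definition strongly_measurable (D : set R) (f : R -> H) : Prop :=
  exists s : nat -> {fimfun R >-> H},
    (forall n, measurable_simple (s n)) /\
    {ae mu, forall t, D t -> s n t @[n --> \oo] --> f t}.

(* The term for [x = 0], where the measure may be infinite, vanishes. *)
Definition simple_integral (D : set R) (s : {fimfun R >-> H}) : H :=
  \sum_(x \in range s) (fine (mu (D `&` s @^-1` [set x])))%:C *: x.

Definition is_bochner_integral (D : set R) (f : R -> H) (I : H) : Prop :=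
  exists s : nat -> {fimfun R >-> H},
    [/\ forall n, measurable_simple (s n),
        forall n x, x != 0 -> (mu (D `&` s n @^-1` [set x]) < +oo)%E,
        {ae mu, forall t, D t -> s n t @[n --> \oo] --> f t},
        (\int[mu]_(t in D) (hnorm (f t - s n t))%:E)%E @[n --> \oo] --> 0%E &
        simple_integral D (s n) @[n --> \oo] --> I].

End Bochner.

Section TimeFunctions.
Context {R : realType} {H : completeNormedModType R[i]}.
Local Notation mu := (@lebesgue_measure R).

Definition time_itv (S : \bar R) : set R := [set t | 0 < t /\ (t%:E < S)%E].

Definition L2norm (S : \bar R) (f : R -> H) : \bar R :=
  ((\int[mu]_(t in time_itv S) ((hnorm (f t)) ^+ 2)%:E) `^ 2^-1)%E.

Definition inL2 (S : \bar R) (f : R -> H) : Prop :=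
  strongly_measurable (time_itv S) f /\ (L2norm S f < +oo)%E.

(* [g] is the derivative of [phi] on [(0, S)] in the sense of locally absolutely
   continuous functions, i.e. [phi] is an indefinite Bochner integral of [g];
   [g] is unique up to a null set. *)
Definition is_time_derivative (S : \bar R) (phi g : R -> H) : Prop :=
  forall s t, 0 < s -> s < t -> (t%:E < S)%E ->
    is_bochner_integral [set` `]s, t[] g (phi t - phi s).

Definition time_derivative (S : \bar R) (phi : R -> H) : R -> H :=
  xget (fun=> 0) [set g | is_time_derivative S phi g].

Definition Ynorm (A : operator H) (S : \bar R) (phi : R -> H) : \bar R :=
  (ereal_sup [set (expR (- t) * hnorm (phi t))%:E | t in time_itv S]
   + L2norm S (time_derivative S phi)
   + L2norm S (fun t => A (phi t)))%E.

Definition inY (A : operator H) (S : \bar R) (phi : R -> H) : Prop :=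
  [/\ forall t, time_itv S t -> {for t, continuous phi},
      exists g, is_time_derivative S phi g,
      inL2 S (time_derivative S phi),
      {ae mu, forall t, time_itv S t -> op_dom A (phi t)} /\
        inL2 S (fun t => A (phi t)) &
      (Ynorm A S phi < +oo)%E].

(* Strong solutions in [Y_S] of [dv/dt + N(t) v = F], [v(0) = v0].  Membership
   of the residual in L2 is required separately because [L2norm] is a lower
   integral on functions that are not measurable. *)
Definition strong_solution (A : operator H) (S : \bar R) (N : R -> operator H)
    (F : R -> H) (v0 : H) (v : R -> H) : Prop :=
  let residual t := time_derivative S v t + N t (v t) - F t in
  [/\ inY A S v, inL2 S residual, L2norm S residual = 0%E &
      v t @[t --> 0^'+] --> v0].

(* [CA] is a constant of maximal L2-regularity for [A]: the inhomogeneous problem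
   has a unique solution, and that solution satisfies the estimate. *)
Definition maximal_L2_regularity (A sqrtA : operator H) (CA : R) : Prop :=
  forall (S : \bar R) (F : R -> H) (V0 : H),
    (0 < S)%E -> inL2 S F -> op_dom sqrtA V0 ->
    exists V : R -> H,
      [/\ strong_solution A S (fun=> A) F V0 V,
          forall W, strong_solution A S (fun=> A) F V0 W ->
            forall t, time_itv S t -> W t = V t &
          (L2norm S (time_derivative S V) + L2norm S (fun t => A (V t))
           <= (Num.sqrt 2 * hnorm (sqrtA V0))%:E + CA%:E * L2norm S F)%E].

Definition continuous_into_dom (A : operator H) (T : \bar R) (phi : R -> H) :
    Prop :=
  forall t, time_itv T t ->
    [/\ op_dom A (phi t), {for t, continuous phi} &
        {for t, continuous (fun s => A (phi s))}].

Definition time_lipschitz (A : operator H) (B : R -> operator H) (T : \bar R)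
    (C : R) : Prop :=
  forall phi : R -> H, continuous_into_dom A T phi ->
  forall s t : R, 0 < s -> s <= t -> (t%:E < T)%E ->
    hnorm (B t (phi t) - B s (phi s))
    <= C * (t - s) * (hnorm (A (phi t)) + hnorm (phi t))
       + C * (hnorm (A (phi t) - A (phi s)) + hnorm (phi t - phi s)).

(* [v(t) = G(t) v0 - int_0^t G(t - tau) B(tau) v(tau) dtau] *)
Definition mild_formula (G : R -> H -> H) (B : R -> operator H) (v0 : H)
    (v : R -> H) (t : R) : Prop :=
  exists I : H,
    is_bochner_integral [set` `]0, t[] (fun tau => G (t - tau) (B tau (v tau))) I
    /\ v t = G t v0 - I.

End TimeFunctions.

(* Main.v *)
Require Import Defs.
From HB Require Import structures.
From mathcomp Require Import all_boot all_order all_algebra.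
From mathcomp Require Import all_classical all_reals all_analysis.
From mathcomp Require Import measurable_realfun complex.
From mathcomp Require Import ring lra.

Import Order.TTheory GRing.Theory Num.Theory.
Import numFieldNormedType.Exports.

Local Open Scope classical_set_scope.
Local Open Scope complex_scope.
Local Open Scope ring_scope.

(** Maximal regularity turns the problem into a fixed-point equation for the
    right-hand side alone. For F in L2(0,S;H), let V_F solve V' + A V = F with
    V(0) = v0. The strong solutions of the perturbed problem are the V_F with
    F = - B V_F, so it suffices that F |-> - B V_F contracts L2(0,S;H)
    (perturbation_contraction). Completeness is then needed for L2 only
    (l2_complete), and the regularity of the solution comes from V_F.

    For the contraction, V_F - V_G solves the unperturbed problem with zero
    initial datum and right-hand side F - G. Maximal regularity bounds the
    L2-norm of A (V_F - V_G) by CA ||F - G||. The Duhamel formula, contractivity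
    of the semigroup and sqrt t <= exp t bound the supremum of
    exp(-t) |V_F - V_G| by ||F - G|| (solves_weighted_sup). Relative boundedness
    turns these into ||B (V_F - V_G)|| <= (C1 CA + kap) ||F - G||, where kap
    bounds the L2-norm of C2 exp t over the interval. The length Tstar allows
    kap = 1 / (4 sqrt 2 (CA + 1)), and kap = 0 serves when C2 = 0; with the smallness
    assumption on C1 the number (CA + 1) (C1 + kap) is below 1/2. The same
    bounds with initial datum v0 give the a priori estimate, whose constant 2 is
    1 / (1 - 1/2) (perturbed_estimate).

    The Duhamel formula holds for every strong solution of the unperturbed
    problem (duhamel). Such a V is an indefinite integral that lies in the domain
    of A only at almost every time, so it is paired with E (t - s) z for z in the
    domain, E being the semigroup: self-adjointness moves A to the smooth factor,
    and s |-> <V s, E (t - s) z> has derivative <F, E (t - s) z>. The semigroup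
    inherits self-adjointness from its generator (semigroup_selfadjoint).

    Two points of measure theory support this. Vector-valued integrals are
    reduced to real ones by pairing with vectors (bochnerP), which also gives the
    uniqueness of the time derivative needed to subtract solutions
    (time_derivative_unique). And t |-> B t (V t) is strongly measurable, because
    (V, A V) can be approximated by countably-valued functions with values in the
    graph of A, while t |-> B t z is continuous for fixed z in the domain
    (ae_vmeas_operator). *)

Set Implicit Arguments.
Unset Strict Implicit.
Unset Printing Implicit Defensive.

(** * The real-valued norm and the real inner product *)

Section Norm.
Context {R : realType} {H : normedModType R[i]}.
Implicit Types x y z : H.

Lemma normE x : `|x| = (hnorm x)%:C.
Proof.
have := normr_ge0 x; rewrite lecE /= => /andP[/eqP h _].
by rewrite /hnorm; case: (`|x|) h => a b /= ->.
Qed.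

Lemma hnorm_ge0 x : 0 <= hnorm x.
Proof. by have := normr_ge0 x; rewrite normE lecR. Qed.

Lemma hnorm0 : hnorm (0 : H) = 0.
Proof. by rewrite /hnorm normr0. Qed.

Lemma hnorm_eq0 x : hnorm x = 0 -> x = 0.
Proof. by move=> h; apply/eqP; rewrite -normr_eq0 normE h. Qed.

Lemma hnorm_opp x : hnorm (- x) = hnorm x.
Proof. by rewrite /hnorm normrN. Qed.

Lemma hdistC x y : hnorm (x - y) = hnorm (y - x).
Proof. by rewrite -hnorm_opp opprB. Qed.

Lemma hnorm_add x y : hnorm (x + y) <= hnorm x + hnorm y.
Proof. by have := ler_normD x y; rewrite !normE -rmorphD /= lecR. Qed.

Lemma hnorm_tri x y z : hnorm (x - z) <= hnorm (x - y) + hnorm (y - z).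
Proof. by have := hnorm_add (x - y) (y - z); rewrite addrA subrK. Qed.

Lemma hnorm_dist x y : `|hnorm x - hnorm y| <= hnorm (x - y).
Proof.
have := hnorm_add (x - y) y; have := hnorm_add (y - x) x.
rewrite !subrK -hdistC => h1 h2; rewrite ler_norml; apply/andP; split; lra.
Qed.

Lemma hnormZ (a : R) x : hnorm (a%:C *: x) = `|a| * hnorm x.
Proof.
have := normrZ a%:C x; rewrite !normE => /eqP.
by rewrite normc_def /= expr0n addr0 sqrtr_sqr -rmorphM /= => /eqP [].
Qed.

Lemma hcvgP {T : Type} (F : set_system T) {FF : Filter F} (f : T -> H) (l : H) :
  f @ F --> l <-> forall e : R, 0 < e -> \forall t \near F, hnorm (f t - l) < e.
Proof.
split=> [/cvgrPdist_lt h e e0|h].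
  have := h e%:C; rewrite ltcR => /(_ e0); apply: filterS => t.
  by rewrite normE ltcR hdistC.
apply/cvgrPdist_lt => e; rewrite ltcE /= => /andP[/eqP ei er].
have := h _ er; apply: filterS => t.
by rewrite normE hdistC ltcE /= -ei eqxx.
Qed.

Lemma hcvg0P {T : Type} (F : set_system T) {FF : Filter F} (f : T -> H) (l : H) :
  f @ F --> l <-> hnorm (f t - l) @[t --> F] --> (0 : R).
Proof.
rewrite hcvgP; split=> [h|/cvgrPdist_lt h e e0].
  apply/cvgrPdist_lt => e e0; have := h _ e0; apply: filterS => t.
  by rewrite sub0r normrN ger0_norm ?hnorm_ge0.
have := h _ e0; apply: filterS => t.
by rewrite sub0r normrN ger0_norm ?hnorm_ge0.
Qed.

Lemma hnorm_cvg {T : Type} (F : set_system T) {FF : Filter F} (f : T -> H) (l : H) :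
  f @ F --> l -> hnorm (f t) @[t --> F] --> hnorm l.
Proof.
move=> /hcvgP h; apply/cvgrPdist_lt => e /h; apply: filterS => t.
by apply: le_lt_trans; rewrite distrC hnorm_dist.
Qed.

End Norm.

Section InnerProduct.
Context {R : realType} {H : completeNormedModType R[i]}.
Variable ip : {dot H for Num.Def.conjC}.
Hypothesis ipH : hilbert_norm ip.
Implicit Types x y z : H.

(** The real part alone separates points and satisfies the Cauchy-Schwarz
    inequality, so every weak argument below can be run with real-valued
    integrals and inequalities. *)
Definition rip x y : R := complex.Re (ip x y).

Lemma ripC x y : rip x y = rip y x.
Proof.
by rewrite /rip (hermC ip) /= expr0 mul1r; case: (ip y x).
Qed.

Lemma ripDl x y z : rip (x + y) z = rip x z + rip y z.
Proof. by rewrite /rip linearDl /= raddfD. Qed.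

Lemma ripNl x z : rip (- x) z = - rip x z.
Proof. by rewrite /rip linearNl /= raddfN. Qed.

Lemma ripBl x y z : rip (x - y) z = rip x z - rip y z.
Proof. by rewrite ripDl ripNl. Qed.

Lemma ripZl (a : R) x z : rip (a%:C *: x) z = a * rip x z.
Proof.
rewrite /rip linearZl_LR /=; case: (ip x z) => b c.
by simpc.
Qed.

Lemma ripDr x y z : rip z (x + y) = rip z x + rip z y.
Proof. by rewrite ripC ripDl !(ripC z). Qed.
Lemma ripNr x z : rip z (- x) = - rip z x.
Proof. by rewrite ripC ripNl (ripC z). Qed.
Lemma ripBr x y z : rip z (x - y) = rip z x - rip z y.
Proof. by rewrite ripDr ripNr. Qed.
Lemma ripZr (a : R) x z : rip z (a%:C *: x) = a * rip z x.
Proof. by rewrite ripC ripZl (ripC z). Qed.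
Lemma rip0l z : rip 0 z = 0.
Proof. by rewrite -(subrr z) ripBl subrr. Qed.
Lemma rip0r z : rip z 0 = 0.
Proof. by rewrite ripC rip0l. Qed.

Lemma ripxx x : rip x x = hnorm x ^+ 2.
Proof.
by rewrite /rip -ipH normE -rmorphXn.
Qed.

(** Cauchy-Schwarz: expand the square of the norm of |y| x - |x| y, which is
    2 |x| |y| (|x| |y| - <x, y>). *)
Lemma rip_le x y : rip x y <= hnorm x * hnorm y.
Proof.
have := hnorm_ge0 x; rewrite le_eqVlt => /predU1P[/esym/hnorm_eq0 ->|x0].
  by rewrite rip0l hnorm0 mul0r.
have := hnorm_ge0 y; rewrite le_eqVlt => /predU1P[/esym/hnorm_eq0 ->|y0].
  by rewrite rip0r hnorm0 mulr0.
have := ripxx ((hnorm y)%:C *: x - (hnorm x)%:C *: y).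
rewrite ripBl !ripBr !ripZl !ripZr !ripxx (ripC y x) => h.
have : 0 <= hnorm ((hnorm y)%:C *: x - (hnorm x)%:C *: y) ^+ 2 by apply: sqr_ge0.
rewrite -h => h2.
have p : 0 < hnorm x * hnorm y by apply: mulr_gt0.
rewrite -(ler_pM2l p); nra.
Qed.

Lemma normr_rip x y : `|rip x y| <= hnorm x * hnorm y.
Proof. by rewrite ler_norml rip_le andbT lerNl -ripNl -(hnorm_opp x) rip_le. Qed.

Lemma rip_eq x y : (forall z, rip x z = rip y z) -> x = y.
Proof.
move=> h; apply/eqP; rewrite -subr_eq0; apply/eqP/hnorm_eq0/eqP.
by rewrite -sqrf_eq0 -ripxx ripBl h subrr.
Qed.

Lemma rip_cvg {T : Type} (F : set_system T) {FF : Filter F} (f : T -> H) (l z : H) :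
  f @ F --> l -> rip (f t) z @[t --> F] --> rip l z.
Proof.
move=> /hcvgP h; apply/cvgrPdist_lt => e e0.
have p : 0 < hnorm z + 1 by have := hnorm_ge0 z; lra.
have := h (e / (hnorm z + 1)); rewrite divr_gt0// => /(_ isT); apply: filterS => t ht.
rewrite -ripBl (le_lt_trans (normr_rip _ _))// hdistC.
move: ht; rewrite ltr_pdivlMr//; apply: le_lt_trans.
by rewrite ler_wpM2l ?hnorm_ge0// lerDl.
Qed.

Lemma closure_approx (D : set H) x (e : R) : closure D x -> 0 < e ->
  exists2 y, D y & hnorm (x - y) < e.
Proof.
move=> /(_ [set y | hnorm (x - y) < e]) h e0.
have [|y [Dy ?]] := h; last by exists y.
have /hcvgP/(_ e e0) := @cvg_id _ (nbhs x).
by apply: filterS => y /=; rewrite hdistC.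
Qed.

(** For w = x - y, a z in D with |w - z| < |w| would give
    |w|^2 = <w, w - z> < |w|^2. *)
Lemma rip_dense_eq (D : set H) x y : closure D = [set: H] ->
  (forall z, D z -> rip x z = rip y z) -> x = y.
Proof.
move=> cD h; apply/eqP; rewrite -subr_eq0; apply/eqP/hnorm_eq0.
set w := x - y; have := hnorm_ge0 w; rewrite le_eqVlt => /predU1P[//|w0].
have [z Dz hz] : exists2 z, D z & hnorm (w - z) < hnorm w.
  by apply: closure_approx => //; rewrite cD.
have : rip w w = rip w (w - z) by rewrite ripBr /w (ripBl _ _ z) h// subrr subr0.
rewrite ripxx => e; have := rip_le w (w - z); rewrite -e expr2 => h3.
have : hnorm w <= hnorm (w - z) by rewrite -(ler_pM2l w0).
by rewrite leNgt hz.
Qed.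

End InnerProduct.

(** * Strongly measurable vector-valued functions *)

Section AlmostEverywhere.
Context {R : realType}.
Local Notation mu := (@lebesgue_measure R).

Lemma ae_imp (P Q : R -> Prop) : {ae mu, forall t, P t} ->
  (forall t, P t -> Q t) -> {ae mu, forall t, Q t}.
Proof.
move=> p h.
exact: (@filterS _ _ (ae_filter_ringOfSetsType mu) _ _ h p).
Qed.

Lemma ae_imp2 (P1 P2 Q : R -> Prop) :
  {ae mu, forall t, P1 t} -> {ae mu, forall t, P2 t} ->
  (forall t, P1 t -> P2 t -> Q t) -> {ae mu, forall t, Q t}.
Proof.
move=> p1 p2 h.
exact: (@filterS2 _ _ (ae_filter_ringOfSetsType mu) _ _ _ h p1 p2).
Qed.

Lemma ae_imp3 (P1 P2 P3 Q : R -> Prop) :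
  {ae mu, forall t, P1 t} -> {ae mu, forall t, P2 t} -> {ae mu, forall t, P3 t} ->
  (forall t, P1 t -> P2 t -> P3 t -> Q t) -> {ae mu, forall t, Q t}.
Proof.
move=> p1 p2 p3 h.
exact: (@filterS3 _ _ (ae_filter_ringOfSetsType mu) _ _ _ _ h p1 p2 p3).
Qed.

End AlmostEverywhere.

Section VectorMeasurability.
Context {R : realType} {H : completeNormedModType R[i]}.
Implicit Types f g : R -> H.

(** A countable partition of the line into Borel sets, given by the index of
    the cell that contains each point. *)
Definition index_measurable (k : R -> nat) : Prop :=
  forall n, measurable (k @^-1` [set n]).

(** Uniform approximation by countably-valued Borel functions. This is
    equivalent to strong measurability (pointwise limits of simple functions),
    but closure under sums, limits and moving operators reduces to glueing
    along countable partitions. *)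
Definition vmeas f : Prop := forall e : R, 0 < e ->
  exists (c : nat -> H) (k : R -> nat),
    index_measurable k /\ forall t, hnorm (f t - c (k t)) < e.

Lemma index_measurable_preimage k (Y : set nat) :
  index_measurable k -> measurable (k @^-1` Y).
Proof.
move=> mk; rewrite (_ : _ @^-1` _ = \bigcup_(n in Y) (k @^-1` [set n])).
  by apply: bigcup_measurable => n _; exact: mk.
apply/seteqP; split => [t /= Yt|t [n /= Yn ->//]].
by exists (k t).
Qed.

Lemma index_measurable_fun d (U : measurableType d) (phi : nat -> U) k :
  index_measurable k -> measurable_fun [set: R] (phi \o k).
Proof.
move=> mk _ Y mY; rewrite setTI comp_preimage.
exact: index_measurable_preimage.
Qed.

Lemma index_measurable_pair k (l : nat -> R -> nat) :
  index_measurable k -> (forall n, index_measurable (l n)) ->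
  index_measurable (fun t => pickle (k t, l (k t) t)).
Proof.
move=> mk ml n.
case E : (unpickle n : option (nat * nat)) => [[a b]|]; last first.
  rewrite (_ : _ @^-1` _ = set0) //; apply/seteqP; split=> // t /= Et.
  by move: E; rewrite -Et pickleK.
have [En|En] := eqVneq (pickle (a, b)) n.
  rewrite (_ : _ @^-1` _ = (k @^-1` [set a]) `&` (l a @^-1` [set b])).
    by apply: measurableI; [exact: mk|exact: ml].
  apply/seteqP; split => t /=.
    by move=> h; move: E; rewrite -h pickleK => -[/= -> ->].
  by move=> [-> ->].
rewrite (_ : _ @^-1` _ = set0) //; apply/seteqP; split=> // t /= Et.
by move: E En; rewrite -Et pickleK => -[<- <-]; rewrite eqxx.
Qed.

Lemma index_measurable_least (P : R -> nat -> bool) (exP : forall t, exists n, P t n) :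
  (forall n, measurable [set t | P t n]) ->
  index_measurable (fun t => ex_minn (exP t)).
Proof.
move=> mP n.
rewrite (_ : _ @^-1` _ = [set t | P t n] `&`
  \bigcap_(m in [set m | (m < n)%N]) ~` [set t | P t m]).
  apply: measurableI; first exact: mP.
  by apply: bigcap_measurableType => m _; apply: measurableC; apply: mP.
apply/seteqP; split => t /=; case: ex_minnP => m Pm mmin.
  move=> <-; split=> // j /= jm /mmin.
  by rewrite leqNgt jm.
move=> [Pn hn]; apply/eqP; rewrite eqn_leq mmin//= leqNgt; apply/negP => mn.
by have := hn m mn.
Qed.

Lemma vmeas_cst (x : H) : vmeas (fun=> x).
Proof.
move=> e e0; exists (fun=> x), (fun=> 0%N); split=> [n|t].
  by rewrite preimage_cst; case: ifP.
by rewrite subrr hnorm0.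
Qed.

(** Refine the partition k by the partitions that approximate each piece; the
    pairs of indices are again countable. *)
Lemma vmeas_glue k (g : nat -> R -> H) :
  index_measurable k -> (forall n, vmeas (g n)) -> vmeas (fun t => g (k t) t).
Proof.
move=> mk mg e e0.
have /choice[c hc] : forall n, exists ck : (nat -> H) * (R -> nat),
    index_measurable ck.2 /\ forall t, hnorm (g n t - ck.1 (ck.2 t)) < e.
  by move=> n; have [c [l h]] := mg n e e0; exists (c, l).
exists (fun m => if unpickle m is Some (a, b) then (c a).1 b else 0).
exists (fun t => pickle (k t, (c (k t)).2 t)); split.
  apply: (index_measurable_pair (l := fun n => (c n).2)) => // n.
  by case: (hc n).
by move=> t; rewrite pickleK; case: (hc (k t)).
Qed.

Lemma vmeas_index k (c : nat -> H) : index_measurable k -> vmeas (c \o k).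
Proof. by move=> mk; apply: (vmeas_glue (g := fun n _ => c n)) => // n; exact: vmeas_cst. Qed.

Lemma vmeas_unif f :
  (forall e : R, 0 < e -> exists2 g, vmeas g & forall t, hnorm (f t - g t) < e) ->
  vmeas f.
Proof.
move=> h e e0; have e2 : 0 < e / 2 by lra.
have [g mg fg] := h _ e2; have [c [k [mk gc]]] := mg _ e2.
exists c, k; split=> // t; have := hnorm_tri (f t) (g t) (c (k t)).
have := fg t; have := gc t; lra.
Qed.

Lemma vmeasD f g : vmeas f -> vmeas g -> vmeas (fun t => f t + g t).
Proof.
move=> mf mg; apply: vmeas_unif => e e0; have [c [k [mk gc]]] := mg _ e0.
exists (fun t => f t + c (k t)); last first.
  by move=> t; rewrite opprD addrACA subrr add0r.
apply: (vmeas_glue (g := fun n t => f t + c n)) => // n e' e0'.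
have [c' [k' [mk' fc]]] := mf _ e0'.
exists (fun m => c' m + c n), k'; split=> // t.
by rewrite opprD addrACA subrr addr0.
Qed.

Lemma vmeas_ext f g : f =1 g -> vmeas f -> vmeas g.
Proof. by move=> /funext->. Qed.

Lemma vmeasZ (a : R) f : vmeas f -> vmeas (fun t => a%:C *: f t).
Proof.
move=> mf e e0; have p : 0 < `|a| + 1 by have := normr_ge0 a; lra.
have [|c [k [mk fc]]] := mf (e / (`|a| + 1)); first by rewrite divr_gt0.
exists (fun n => a%:C *: c n), k; split=> // t.
rewrite -scalerBr hnormZ; have := fc t; rewrite ltr_pdivlMr// => h.
by have := hnorm_ge0 (f t - c (k t)); nra.
Qed.

Lemma vmeasN f : vmeas f -> vmeas (fun t => - f t).
Proof.
move=> /(vmeasZ (-1)); apply: vmeas_ext => t.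
by rewrite raddfN /= scaleN1r.
Qed.

Lemma vmeasB f g : vmeas f -> vmeas g -> vmeas (fun t => f t - g t).
Proof. by move=> mf /vmeasN; exact: vmeasD. Qed.

Lemma vmeas_hnorm f : vmeas f -> measurable_fun [set: R] (fun t => hnorm (f t)).
Proof.
move=> mf.
have /choice[c hc] : forall n : nat, exists ck : (nat -> H) * (R -> nat),
    index_measurable ck.2 /\ forall t, hnorm (f t - ck.1 (ck.2 t)) < n.+1%:R^-1.
  move=> n; have [|c [l h]] := mf n.+1%:R^-1; last by exists (c, l).
  by rewrite invr_gt0.
apply: (measurable_fun_cvg (h := fun n t => hnorm ((c n).1 ((c n).2 t)))).
  move=> n; apply: (index_measurable_fun (fun m => hnorm ((c n).1 m))).
  by case: (hc n).
move=> t _; apply: hnorm_cvg; apply/hcvgP => e e0.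
have := near_infty_natSinv_lt (PosNum e0); apply: filterS => n /= hn.
by case: (hc n) => _ /(_ t); rewrite hdistC => /lt_trans; apply.
Qed.

(** The sets where f_ n is e-close to f are measurable, because the distance to
    f is the limit of the distances to f_ m. Using at each t the first n with
    this property gives a uniform approximation of f, glued from the f_ n. *)
Lemma vmeas_cvg (f_ : nat -> R -> H) f : (forall n, vmeas (f_ n)) ->
  (forall t, f_ n t @[n --> \oo] --> f t) -> vmeas f.
Proof.
move=> mf cf; apply: vmeas_unif => e e0.
have mfn n : measurable_fun [set: R] (fun t => hnorm (f_ n t - f t)).
  apply: (measurable_fun_cvg (h := fun m t => hnorm (f_ n t - f_ m t))).
    by move=> m; apply: vmeas_hnorm; exact: vmeasB.
  move=> t _; apply: hnorm_cvg; apply/hcvgP => e' e0'.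
  have /hcvgP/(_ _ e0') := cf t; apply: filterS => m.
  by rewrite hdistC (_ : _ - _ - _ = f t - f_ m t) ?(hdistC (f t))// opprB addrC subrKA.
have exP t : exists n, hnorm (f_ n t - f t) < e.
  by have /hcvgP/(_ _ e0)[N _ /(_ N (leqnn _))] := cf t; exists N.
(* The first index at which the sequence is e-close to its limit. *)
exists (fun t => f_ (ex_minn (exP t)) t); last first.
  by move=> t; case: ex_minnP => m + _; rewrite hdistC.
apply: vmeas_glue => //; apply: index_measurable_least => n.
have := measurable_fun_ltr (mfn n) (@measurable_cst _ _ _ _ [set: R] e).
move=> /(_ measurableT [set true] I); rewrite setTI; congr measurable.
Qed.

Lemma vmeas_if (b : R -> bool) f g : measurable [set t | b t] ->
  vmeas f -> vmeas g -> vmeas (fun t => if b t then f t else g t).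
Proof.
move=> mb mf mg.
have mk : index_measurable (fun t => nat_of_bool (b t)).
  case=> [|[|n]].
  - rewrite (_ : _ @^-1` _ = ~` [set t | b t]); first exact: measurableC.
    by apply/seteqP; split => t /=; case: (b t).
  - rewrite (_ : _ @^-1` _ = [set t | b t]) //.
    by apply/seteqP; split => t /=; case: (b t).
  - rewrite (_ : _ @^-1` _ = set0) //.
    by apply/seteqP; split => t /=; case: (b t).
have /(vmeas_glue mk) : forall n, vmeas ((fun n => if n is 1%N then f else g) n).
  by case=> [|[|]].
by apply: vmeas_ext => t; case: (b t).
Qed.

Lemma vmeas_restrict (D : set R) f : measurable D -> vmeas f ->
  vmeas (fun t => if t \in D then f t else 0).
Proof.
move=> mD mf; apply: vmeas_if => //; last exact: vmeas_cst.
by rewrite (_ : [set _ | _] = D) //; apply/seteqP; split => t /=; rewrite inE.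
Qed.

Lemma vmeas_apply (K : R -> H -> H) f : (forall t, continuous (K t)) ->
  (forall x, vmeas (K ^~ x)) -> vmeas f -> vmeas (fun t => K t (f t)).
Proof.
move=> cK mK mf.
have /choice[c hc] : forall n : nat, exists ck : (nat -> H) * (R -> nat),
    index_measurable ck.2 /\ forall t, hnorm (f t - ck.1 (ck.2 t)) < n.+1%:R^-1.
  move=> n; have [|c [l h]] := mf n.+1%:R^-1; last by exists (c, l).
  by rewrite invr_gt0.
apply: (@vmeas_cvg (fun n t => K t ((c n).1 ((c n).2 t)))).
  move=> n; apply: (@vmeas_glue (c n).2 (fun m t => K t ((c n).1 m))) => //.
  by case: (hc n).
move=> t; apply: (cvg_comp _ (K t) _ (cK t (f t))).
apply/hcvgP => e e0.
have := near_infty_natSinv_lt (PosNum e0); apply: filterS => n /= hn.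
by case: (hc n) => _ /(_ t); rewrite hdistC => /lt_trans; apply.
Qed.

Lemma floor_grid_cvg (t : R) :
  (Num.floor (t * n.+1%:R))%:~R / n.+1%:R @[n --> \oo] --> t.
Proof.
apply/cvgrPdist_lt => e e0.
have := near_infty_natSinv_lt (PosNum e0); apply: filterS => n /= hn.
have p : 0 < (n.+1%:R : R) by [].
set z : R := (Num.floor _)%:~R; set r : R := n.+1%:R in hn p *.
have /andP[h1 h2] : z <= t * r < z + 1.
  by have := floor_itv (t * r); rewrite intrD.
apply: lt_trans hn; rewrite ger0_norm; last by rewrite subr_ge0 ler_pdivrMr.
by rewrite ltrBlDr -[X in X + _]mul1r -mulrDl addrC ltr_pdivlMr.
Qed.

Lemma index_measurable_floor (r : R) : 0 < r ->
  index_measurable (fun t => pickle (Num.floor (t * r))).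
Proof.
move=> r0 m.
case E : (unpickle m : option int) => [z|]; last first.
  rewrite (_ : _ @^-1` _ = set0) //; apply/seteqP; split=> // t /= Et.
  by move: E; rewrite -Et pickleK.
have [Em|Em] := eqVneq (pickle z) m.
  rewrite (_ : _ @^-1` _ = `[z%:~R / r, (z + 1)%:~R / r[%classic).
    exact: measurable_itv.
  apply/seteqP; split => t /=; rewrite in_itv /= ler_pdivrMr// ltr_pdivlMr//.
    by move=> h; rewrite -floor_eq; move: E; rewrite -h pickleK => -[->].
  by rewrite -floor_eq => /eqP ->.
rewrite (_ : _ @^-1` _ = set0) //; apply/seteqP; split=> // t /= Et.
by move: E Em; rewrite -Et pickleK => -[<-]; rewrite eqxx.
Qed.

(** Evaluate f on the grid of mesh 1/(n+1) to the left of t: this is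
    countably-valued, and converges by continuity. *)
Lemma vmeas_continuous (D : set R) f : open D ->
  (forall t, D t -> {for t, continuous f}) ->
  vmeas (fun t => if t \in D then f t else 0).
Proof.
move=> oD cf; have mD : measurable D by exact: open_measurable.
pose g (n : nat) (t : R) := f ((Num.floor (t * n.+1%:R))%:~R / n.+1%:R).
have := @vmeas_cvg (fun n (t : R) => if t \in D then g n t else 0)
  (fun t => if t \in D then f t else 0); apply.
  move=> n; apply: vmeas_restrict => //.
  pose c (m : nat) := f ((odflt 0 (unpickle m : option int))%:~R / n.+1%:R).
  have := @vmeas_index (fun t => pickle (Num.floor (t * n.+1%:R))) c.
  have p : 0 < (n.+1%:R : R) by [].
  move=> /(_ (index_measurable_floor p)); apply: vmeas_ext => t.
  by rewrite /c /= pickleK.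
move=> t; case: ifPn => [|_]; last exact: cvg_cst.
rewrite inE => Dt; apply: (cvg_comp _ f _ (cf t Dt)).
exact: floor_grid_cvg.
Qed.

(** Polarization reduces this to the measurability of norms. *)
Lemma vmeas_rip (ip : {dot H for Num.Def.conjC}) f g : hilbert_norm ip ->
  vmeas f -> vmeas g -> measurable_fun [set: R] (fun t => rip ip (f t) (g t)).
Proof.
move=> ipH mf mg.
rewrite (_ : (fun _ => _) = fun t => 4^-1 * (hnorm (f t + g t) ^+ 2 - hnorm (f t - g t) ^+ 2)).
  apply: measurable_funM => //; apply: measurable_funB.
    by apply: measurable_funX; apply: vmeas_hnorm; exact: vmeasD.
  by apply: measurable_funX; apply: vmeas_hnorm; exact: vmeasB.
apply/funext => t; rewrite -!(ripxx ipH) ripBl !ripBr ripDl !ripDr.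
rewrite (ripC ip (g t) (f t)); lra.
Qed.

Local Notation mu := (@lebesgue_measure R).

(** The time derivative of a solution and A applied to it are known up to null
    sets only, so measurability is expressed through a representative that is
    measurable on the whole line. *)
Definition ae_vmeas (D : set R) f := exists2 g, vmeas g &
  {ae mu, forall t, D t -> f t = g t}.

Definition simple f : Prop :=
  finite_set (range f) /\ forall x : H, measurable (f @^-1` [set x]).

Lemma simple_fimfun f : simple f ->
  exists2 s : {fimfun R >-> H}, measurable_simple s & f = s.
Proof.
move=> [ff mf].
pose m := @FiniteImage.Build R H f ff.
pose F : {fimfun R >-> H} := HB.pack f m.
by exists F.
Qed.

Lemma fimfun_simple (s : {fimfun R >-> H}) : measurable_simple s -> simple s.
Proof. by move=> ms; split=> //; exact: fimfunP. Qed.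

Lemma simple_vmeas f : simple f -> vmeas f.
Proof.
move=> [/finite_seqP[l fl] mf].
have lf t : f t \in l by have : range f (f t) by []; rewrite fl.
have -> : f = nth 0 l \o (fun t => index (f t) l).
  by apply/funext => t /=; rewrite nth_index.
apply: vmeas_index => n.
have [h|h] := pselect (exists2 t, index (f t) l = n & True).
  case: h => t0 <- _.
  rewrite (_ : _ @^-1` _ = f @^-1` [set f t0]); first exact: mf.
  apply/seteqP; split => t /= => [e|->//].
  by rewrite -(nth_index 0 (lf t)) e nth_index.
rewrite (_ : _ @^-1` _ = set0) //; apply/seteqP; split=> // t /= Et.
by apply: h; exists t.
Qed.

Lemma simple_if (b : R -> bool) f g : measurable [set t | b t] ->
  simple f -> simple g -> simple (fun t => if b t then f t else g t).
Proof.
move=> mb [ff mf] [fg mg]; split.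
  apply: (sub_finite_set (B := range f `|` range g)); last by rewrite finite_setU.
  by move=> _ [t _ <-]; case: ifP => _; [left|right]; exists t.
move=> x; rewrite (_ : _ @^-1` _ = ([set t | b t] `&` f @^-1` [set x]) `|`
   (~` [set t | b t] `&` g @^-1` [set x])).
  by apply: measurableU; apply: measurableI => //; exact: measurableC.
apply/seteqP; split => t /=; first by case: ifP => h ->; [left|right].
by move=> [[-> //]|[/negP/negbTE ->]].
Qed.

Lemma simple_index k (c : nat -> H) n : index_measurable k ->
  simple (fun t => c (minn (k t) n)).
Proof.
move=> mk; split.
  apply: (@sub_finite_set _ _ (c @` `I_n.+1)); last exact/finite_image/finite_II.
  by move=> _ [t _ <-]; exists (minn (k t) n) => //=; rewrite ltnS geq_minr.
move=> x; apply: (@index_measurable_preimage k [set m | c (minn m n) = x]).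
exact: mk.
Qed.

Lemma simple_cst (x : H) : simple (fun=> x).
Proof.
split; first by apply: (@sub_finite_set _ _ [set x]) => // _ [t _ <-].
by move=> y; rewrite preimage_cst; case: ifP.
Qed.

(** A countably-valued approximation may take infinitely many values. At stage n,
    use among the first n approximations the finest one whose index at t is at
    most n: finitely many values are involved, and for each t every given
    accuracy is eventually available. *)
Lemma vmeas_simple_cvg f : vmeas f -> exists s : nat -> R -> H,
  (forall n, simple (s n)) /\ forall t, s n t @[n --> \oo] --> f t.
Proof.
move=> mf.
have /choice[c hc] : forall n : nat, exists ck : (nat -> H) * (R -> nat),
    index_measurable ck.2 /\ forall t, hnorm (f t - ck.1 (ck.2 t)) < n.+1%:R^-1.
  move=> n; have [|c [l h]] := mf n.+1%:R^-1; last by exists (c, l).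
  by rewrite invr_gt0.
pose F := fix F (n i : nat) (t : R) : H := if i is j.+1 then
  if ((c j).2 t <= n)%N then (c j).1 (minn ((c j).2 t) n) else F n j t else 0.
exists (fun n => F n n); split.
  move=> n; suff: forall i, simple (F n i) by apply.
  elim=> [|i IH] /=; first exact: simple_cst.
  case: (hc i) => mi _.
  apply: simple_if => //; last exact: simple_index.
  exact: (@index_measurable_preimage _ [set m | (m <= n)%N] mi).
move=> t; apply/hcvgP => e e0.
have [i _ /(_ i (leqnn _)) /= hi] := near_infty_natSinv_lt (PosNum e0).
exists (maxn i.+1 ((c i).2 t)) => // n /=; rewrite geq_max => /andP[ilt kn].
suff h m : (i < m)%N -> hnorm (f t - F n m t) < i.+1%:R^-1.
  by rewrite hdistC (lt_trans (h _ ilt)).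
elim: m => // m IH; rewrite ltnS leq_eqVlt => /predU1P[<-|im] /=.
  by rewrite kn (minn_idPl kn); case: (hc i).
case: ifPn => [km|_]; last exact: IH.
rewrite (minn_idPl km); case: (hc m) => _ /(_ t) /lt_le_trans; apply.
by rewrite lef_pV2 ?posrE// ler_nat ltnS ltnW.
Qed.

Lemma strongly_measurableP (D : set R) f : measurable D ->
  strongly_measurable D f <-> ae_vmeas D f.
Proof.
move=> mD; split=> [[s [ms [N [mN N0 sN]]]]|[g mg fg]].
  exists (fun t => if t \in D `\` N then f t else 0); last first.
    exists N; split=> // t /= ht; apply: contrapT => Nt; apply: ht => Dt.
    by rewrite mem_set.
  have := @vmeas_cvg (fun n (t : R) => if t \in D `\` N then s n t else 0)
    (fun t => if t \in D `\` N then f t else 0); apply.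
    move=> n; apply: vmeas_restrict; first exact: measurableD.
    exact/simple_vmeas/fimfun_simple.
  move=> t; case: ifPn => [|_]; last exact: cvg_cst.
  rewrite inE => -[Dt Nt]; apply: contrapT => h; apply: Nt; apply: sN => /=.
  by move=> h'; apply: h; exact: h'.
have [s [ss cs]] := vmeas_simple_cvg mg.
have /choice[S hS] : forall n, exists S : {fimfun R >-> H}, measurable_simple S /\ s n = S.
  by move=> n; have [S mS e] := simple_fimfun (ss n); exists S.
exists S; split=> [n|]; first by case: (hS n).
apply: (ae_imp fg) => t h Dt; rewrite h//.
by rewrite (_ : (fun n => S n t) = fun n => s n t) //; apply/funext => n; case: (hS n) => _ ->.
Qed.

End VectorMeasurability.

(** * Integrals of real functions determined almost everywhere *)

Section AeIntegral.
Context {R : realType}.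
Local Notation mu := (@lebesgue_measure R).
Implicit Types (D : set R).

Import HBNNSimple.

(** The integral of a nonnegative function is a supremum over the simple
    functions below it, also when the function is not measurable. Cutting such
    a simple function off on a null set does not change its integral, so
    neither side has to be measurable. *)
Lemma ge0_le_integral_ae D (f g : R -> \bar R) : measurable D ->
  (forall x, D x -> 0 <= f x)%E -> (forall x, D x -> 0 <= g x)%E ->
  {ae mu, forall t, D t -> f t = g t} ->
  (\int[mu]_(x in D) f x <= \int[mu]_(x in D) g x)%E.
Proof.
move=> mD f0 g0 [N [mN N0 fgN]].
rewrite !ge0_integralE//; apply: ub_ereal_sup => _ [h hf <-].
have mNC : measurable (~` N) by exact: measurableC.
pose h' : {nnsfun _ >-> R} := proj_nnsfun h mNC.
apply: (@le_trans _ _ (sintegral mu h')); last first.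
  apply: ereal_sup_ubound; exists h' => // x.
  rewrite /h' /= mindicE; case: (boolP (x \in ~` N)) => [|_].
    rewrite inE mulr1 => Nx; apply: le_trans (hf x) _.
    rewrite !patchE; case: ifPn => // /set_mem Dx.
    rewrite le_eqVlt; apply/orP; left; apply/eqP.
    by apply: contrapT => h1; apply: Nx; apply: fgN => /= /(_ Dx).
  by rewrite mulr0 patchE; case: ifPn => // /set_mem /g0.
rewrite -!integralT_nnsfun.
rewrite le_eqVlt; apply/orP; left; apply/eqP; apply: ae_eq_integral => //.
- by apply/measurable_EFinP.
- by apply/measurable_EFinP.
- exists N; split=> // x /= hx; apply: contrapT => Nx; apply: hx => _.
  by rewrite /h' /= mindicE mem_set// mulr1.
Qed.

Lemma ge0_integral_ae D (f g : R -> \bar R) : measurable D ->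
  (forall x, D x -> 0 <= f x)%E -> (forall x, D x -> 0 <= g x)%E ->
  {ae mu, forall t, D t -> f t = g t} ->
  (\int[mu]_(x in D) f x = \int[mu]_(x in D) g x)%E.
Proof.
move=> mD f0 g0 fg; apply/eqP; rewrite eq_le !ge0_le_integral_ae//.
by apply: (ae_imp fg) => t h /h.
Qed.

Lemma integral_ae D (f g : R -> \bar R) : measurable D ->
  {ae mu, forall t, D t -> f t = g t} ->
  (\int[mu]_(x in D) f x = \int[mu]_(x in D) g x)%E.
Proof.
move=> mD fg; rewrite [LHS]integralE [RHS]integralE; congr (_ - _)%E.
- apply: ge0_integral_ae => //; apply: (ae_imp fg) => t h /h e.
  by rewrite !funeposE e.
- apply: ge0_integral_ae => //; apply: (ae_imp fg) => t h /h e.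
  by rewrite !funenegE e.
Qed.

Lemma Rintegral_ae D (f g : R -> R) : measurable D ->
  {ae mu, forall t, D t -> f t = g t} ->
  \int[mu]_(x in D) f x = \int[mu]_(x in D) g x.
Proof.
move=> mD fg; rewrite /Rintegral; congr fine; apply: integral_ae => //.
by apply: (ae_imp fg) => t h /h ->.
Qed.

(** A function that agrees on D with a Borel function up to a null set may fail
    to be Borel, since Lebesgue measure is taken on the Borel sets; hence this
    notion, and ae_integrable, which make the calculus of integrals below
    insensitive to the choice of representatives. *)
Definition ae_meas D (f : R -> R) := exists2 g, measurable_fun [set: R] g &
  {ae mu, forall t, D t -> f t = g t}.

Definition ae_integrable D (f : R -> R) := exists2 g, mu.-integrable D (EFin \o g) &
  {ae mu, forall t, D t -> f t = g t}.

Lemma ae_integrableP D f : measurable D -> ae_integrable D f <->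
  ae_meas D f /\ (\int[mu]_(x in D) (`|f x|)%:E < +oo)%E.
Proof.
move=> mD; split=> [[g ig fg]|[[g mg fg] fi]].
  split; last first.
    have /integrableP[_] := ig; congr (_ < _)%E; apply: integral_ae => //.
    by apply: (ae_imp fg) => t h /h ->.
  exists (g \_ D).
    by apply/(measurable_restrictT _ _).1 => //; apply/measurable_EFinP; case/integrableP: ig.
  by apply: (ae_imp fg) => t h Dt; rewrite patchE mem_set// h.
exists g => //; apply/integrableP; split.
  by apply: measurable_funTS; apply/measurable_EFinP.
move: fi; congr (_ < _)%E; apply: integral_ae => //.
by apply: (ae_imp fg) => t h /h ->.
Qed.

Lemma ae_integrable_ext D f g : {ae mu, forall t, D t -> f t = g t} ->
  ae_integrable D f -> ae_integrable D g.
Proof.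
by move=> fg [h ih fh]; exists h => //; apply: (ae_imp2 fg fh) => t a b Dt; rewrite -a// b.
Qed.

Lemma ae_integrableD D f g : measurable D -> ae_integrable D f -> ae_integrable D g ->
  ae_integrable D (fun t => f t + g t).
Proof.
move=> mD [f' if' ff] [g' ig gg]; exists (fun t => f' t + g' t).
  have := @integrableD _ _ _ mu D mD _ _ if' ig; apply: eq_integrable => // t _; rewrite /= EFinD.
by apply: (ae_imp2 ff gg) => t a b Dt; rewrite a// b.
Qed.

Lemma ae_integrableZ D (k : R) f : measurable D -> ae_integrable D f ->
  ae_integrable D (fun t => k * f t).
Proof.
move=> mD [f' if' ff]; exists (fun t => k * f' t).
  have := @integrableZl _ _ _ mu D mD k _ if'; apply: eq_integrable => // t _; rewrite /= EFinM.
by apply: (ae_imp ff) => t a Dt; rewrite a.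
Qed.

Lemma ae_integrableB D f g : measurable D -> ae_integrable D f -> ae_integrable D g ->
  ae_integrable D (fun t => f t - g t).
Proof.
move=> mD fi /(ae_integrableZ (-1) mD) /(ae_integrableD mD fi).
by apply: ae_integrable_ext; apply: aeW => t _; rewrite mulN1r.
Qed.

Lemma ae_integrable_le D f g : measurable D -> ae_meas D f -> ae_integrable D g ->
  {ae mu, forall t, D t -> `|f t| <= g t} -> ae_integrable D f.
Proof.
move=> mD [f' mf ff] [g' ig gg] fg; exists f' => //.
have [mg gi] := integrableP _ _ _ ig; apply/integrableP; split.
  by apply: measurable_funTS; apply/measurable_EFinP.
apply: le_lt_trans gi; apply: ae_ge0_le_integral => //.
- by apply: measurableT_comp => //; apply: measurable_funTS; apply/measurable_EFinP.
- by apply: measurableT_comp.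
apply: (ae_imp3 ff gg fg) => t a b c Dt; rewrite /= lee_fin -a// -b//.
by apply: le_trans (ler_norm _); exact: c.
Qed.

Lemma ae_integrable_norm D f : measurable D -> ae_integrable D f ->
  ae_integrable D (fun t => `|f t|).
Proof.
move=> mD [f' if' ff]; exists (fun t => `|f' t|); first exact: (integrable_norm if').
by apply: (ae_imp ff) => t a /a ->.
Qed.

Lemma ae_integrableS D E f : measurable D -> measurable E -> E `<=` D ->
  ae_integrable D f -> ae_integrable E f.
Proof.
move=> mD mE ED [f' if' ff]; exists f'; first exact: (@integrableS _ _ _ mu D E).
by apply: (ae_imp ff) => t a /ED; exact: a.
Qed.

Lemma Rint_D D f g : measurable D -> ae_integrable D f -> ae_integrable D g ->
  \int[mu]_(t in D) (f t + g t) = \int[mu]_(t in D) f t + \int[mu]_(t in D) g t.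
Proof.
move=> mD [f' if' ff] [g' ig gg].
rewrite (Rintegral_ae mD ff) (Rintegral_ae mD gg) -RintegralD//.
by apply: Rintegral_ae => //; apply: (ae_imp2 ff gg) => t a b Dt; rewrite a// b.
Qed.

Lemma Rint_Z D (k : R) f : measurable D -> ae_integrable D f ->
  \int[mu]_(t in D) (k * f t) = k * \int[mu]_(t in D) f t.
Proof.
move=> mD [f' if' ff]; rewrite (Rintegral_ae mD ff) -RintegralZl//.
by apply: Rintegral_ae => //; apply: (ae_imp ff) => t a Dt; rewrite a.
Qed.

Lemma Rint_B D f g : measurable D -> ae_integrable D f -> ae_integrable D g ->
  \int[mu]_(t in D) (f t - g t) = \int[mu]_(t in D) f t - \int[mu]_(t in D) g t.
Proof.
move=> mD if' ig; rewrite -(mulN1r (\int[mu]_(t in D) g t)) -Rint_Z// -Rint_D//.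
  by apply: eq_Rintegral => t _; rewrite mulN1r.
exact: ae_integrableZ.
Qed.

Lemma Rint_le D f g : measurable D -> ae_integrable D f -> ae_integrable D g ->
  {ae mu, forall t, D t -> f t <= g t} ->
  \int[mu]_(t in D) f t <= \int[mu]_(t in D) g t.
Proof.
move=> mD [f' if' ff] [g' ig gg] fg.
rewrite (Rintegral_ae mD ff) (Rintegral_ae mD gg) -subr_ge0 -RintegralB//.
rewrite (_ : \int[mu]_(t in D) _ = \int[mu]_(t in D) `|g' t - f' t|).
  by apply: Rintegral_ge0.
apply: Rintegral_ae => //; apply: (ae_imp3 ff gg fg) => t a b c Dt.
by rewrite ger0_norm// subr_ge0 -a// -b// c.
Qed.

Lemma Rint_norm D f : measurable D -> ae_integrable D f ->
  `|\int[mu]_(t in D) f t| <= \int[mu]_(t in D) `|f t|.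
Proof.
move=> mD [f' if' ff]; rewrite (Rintegral_ae mD ff).
rewrite (@Rintegral_ae D (fun t => `|f t|) (fun t => `|f' t|))//.
  exact: le_normr_Rintegral.
by apply: (ae_imp ff) => t a Dt; rewrite a.
Qed.

Lemma Rint_setU D E f : measurable D -> measurable E -> [disjoint D & E] ->
  ae_integrable (D `|` E) f ->
  \int[mu]_(t in D `|` E) f t = \int[mu]_(t in D) f t + \int[mu]_(t in E) f t.
Proof.
move=> mD mE DE [f' if' ff]; have mU : measurable (D `|` E) by exact: measurableU.
rewrite (Rintegral_ae mU ff) Rintegral_setU//; congr (_ + _); apply: Rintegral_ae => //.
  by apply: (ae_imp ff) => t a Dt; rewrite a//; left.
by apply: (ae_imp ff) => t a Dt; rewrite a//; right.
Qed.

Lemma ge0_Rint_EFin D f : measurable D -> ae_integrable D f ->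
  (forall t, D t -> 0 <= f t) ->
  (\int[mu]_(t in D) (f t)%:E = (\int[mu]_(t in D) f t)%:E)%E.
Proof.
move=> mD /(ae_integrableP _ mD)[_ fi] f0; rewrite /Rintegral fineK//.
rewrite ge0_fin_numE; last by apply: integral_ge0 => t Dt; rewrite lee_fin f0.
move: fi; congr (_ < _)%E; apply: eq_integral => t /set_mem Dt.
by rewrite ger0_norm// f0.
Qed.

End AeIntegral.

(** * Bochner integrals through scalar integrals *)

Section VectorIntegrability.
Context {R : realType} {H : completeNormedModType R[i]}.
Local Notation mu := (@lebesgue_measure R).
Implicit Types (D : set R) (f g : R -> H).

Lemma ae_vmeas_ext D f g : {ae mu, forall t, D t -> f t = g t} ->
  ae_vmeas D f -> ae_vmeas D g.
Proof.
move=> fg [h mh fh]; exists h => //; apply: (ae_imp2 fg fh) => t a b Dt.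
by rewrite -a// b.
Qed.

Lemma ae_vmeasS D E f : E `<=` D -> ae_vmeas D f -> ae_vmeas E f.
Proof. by move=> ED [g mg fg]; exists g => //; apply: (ae_imp fg) => t h /ED. Qed.

Lemma ae_vmeasD D f g : ae_vmeas D f -> ae_vmeas D g -> ae_vmeas D (fun t => f t + g t).
Proof.
move=> [f' mf ff] [g' mg gg]; exists (fun t => f' t + g' t); first exact: vmeasD.
by apply: (ae_imp2 ff gg) => t a b Dt; rewrite a// b.
Qed.

Lemma ae_vmeasN D f : ae_vmeas D f -> ae_vmeas D (fun t => - f t).
Proof.
move=> [f' mf ff]; exists (fun t => - f' t); first exact: vmeasN.
by apply: (ae_imp ff) => t a Dt; rewrite a.
Qed.

Lemma ae_vmeasB D f g : ae_vmeas D f -> ae_vmeas D g -> ae_vmeas D (fun t => f t - g t).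
Proof. by move=> mf /ae_vmeasN; exact: ae_vmeasD. Qed.

Lemma ae_vmeas_cst D (x : H) : ae_vmeas D (fun=> x).
Proof. by exists (fun=> x); [exact: vmeas_cst|exact: aeW]. Qed.

Lemma ae_vmeas_hnorm D f : ae_vmeas D f -> ae_meas D (fun t => hnorm (f t)).
Proof.
move=> [f' mf ff]; exists (fun t => hnorm (f' t)); first exact: vmeas_hnorm.
by apply: (ae_imp ff) => t a Dt; rewrite a.
Qed.

Lemma ae_meas_comp D (f : R -> R) (k : R -> R) : measurable_fun [set: R] k ->
  ae_meas D f -> ae_meas D (fun t => k (f t)).
Proof.
move=> mk [f' mf ff]; exists (fun t => k (f' t)).
  exact: measurableT_comp.
by apply: (ae_imp ff) => t a Dt; rewrite a.
Qed.

Lemma ae_meas_mul D (f g : R -> R) : ae_meas D f -> ae_meas D g ->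
  ae_meas D (fun t => f t * g t).
Proof.
move=> [f' mf ff] [g' mg gg]; exists (fun t => f' t * g' t); first exact: measurable_funM.
by apply: (ae_imp2 ff gg) => t a b Dt; rewrite a// b.
Qed.

Lemma ae_meas_rip (ip : {dot H for Num.Def.conjC}) D f g : hilbert_norm ip ->
  ae_vmeas D f -> ae_vmeas D g -> ae_meas D (fun t => rip ip (f t) (g t)).
Proof.
move=> ipH [f' mf ff] [g' mg gg]; exists (fun t => rip ip (f' t) (g' t)).
  exact: vmeas_rip.
by apply: (ae_imp2 ff gg) => t a b Dt; rewrite a// b.
Qed.

Definition vintegrable D f : Prop :=
  ae_vmeas D f /\ ae_integrable D (fun t => hnorm (f t)).

Lemma vintegrable_ext D f g : {ae mu, forall t, D t -> f t = g t} ->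
  vintegrable D f -> vintegrable D g.
Proof.
move=> fg [mf fi]; split; first exact: ae_vmeas_ext mf.
by apply: ae_integrable_ext fi; apply: (ae_imp fg) => t h /h ->.
Qed.

Lemma vintegrable_le D f (k : R -> R) : measurable D -> ae_vmeas D f ->
  ae_integrable D k -> {ae mu, forall t, D t -> hnorm (f t) <= k t} ->
  vintegrable D f.
Proof.
move=> mD mf ki fk; split=> //; apply: ae_integrable_le ki _ => //.
  exact: ae_vmeas_hnorm.
by apply: (ae_imp fk) => t h /h; rewrite ger0_norm ?hnorm_ge0.
Qed.

Lemma vintegrableD D f g : measurable D -> vintegrable D f -> vintegrable D g ->
  vintegrable D (fun t => f t + g t).
Proof.
move=> mD [mf fi] [mg gi]; apply: (vintegrable_le mD (ae_vmeasD mf mg)).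
  exact: (ae_integrableD mD fi gi).
by apply: aeW => t _; exact: hnorm_add.
Qed.

Lemma vintegrableN D f : vintegrable D f -> vintegrable D (fun t => - f t).
Proof.
move=> [mf fi]; split; first exact: ae_vmeasN.
by under [X in ae_integrable _ X]eq_fun do rewrite hnorm_opp.
Qed.

Lemma vintegrableB D f g : measurable D -> vintegrable D f -> vintegrable D g ->
  vintegrable D (fun t => f t - g t).
Proof. by move=> mD fi /vintegrableN; exact: vintegrableD. Qed.

Lemma vintegrableS D E f : measurable D -> measurable E -> E `<=` D ->
  vintegrable D f -> vintegrable E f.
Proof.
move=> mD mE ED [mf fi]; split; first exact: ae_vmeasS mf.
exact: ae_integrableS fi.
Qed.

Lemma ae_integrable_rip (ip : {dot H for Num.Def.conjC}) D f z : hilbert_norm ip ->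
  measurable D -> vintegrable D f -> ae_integrable D (fun t => rip ip (f t) z).
Proof.
move=> ipH mD [mf fi]; apply: (ae_integrable_le mD _ (ae_integrableZ (hnorm z) mD fi)).
  by apply: ae_meas_rip => //; exact: ae_vmeas_cst.
by apply: aeW => t _; rewrite mulrC normr_rip.
Qed.

Lemma Rint_rip_le (ip : {dot H for Num.Def.conjC}) D f z : hilbert_norm ip ->
  measurable D -> vintegrable D f ->
  `|\int[mu]_(t in D) rip ip (f t) z| <= hnorm z * \int[mu]_(t in D) hnorm (f t).
Proof.
move=> ipH mD fi; have ri := ae_integrable_rip z ipH mD fi.
apply: le_trans (Rint_norm mD ri) _; have [_ ni] := fi.
rewrite -Rint_Z//; apply: Rint_le => //.
- exact: ae_integrable_norm.
- exact: ae_integrableZ.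
by apply: aeW => t _; rewrite mulrC normr_rip.
Qed.

(** Completeness of H, with real tolerances and a fixed reference index N. *)
Lemma hcauchy (u : nat -> H) :
  (forall e : R, 0 < e -> exists N, forall n, (N <= n)%N -> hnorm (u N - u n) < e) ->
  exists l : H, u n @[n --> \oo] --> l.
Proof.
move=> h; apply/cvg_ex; apply/cauchy_cvgP; apply: cauchy_exP => e.
rewrite ltcE /= => /andP[/eqP ei er].
have [N hN] := h _ er; exists (u N); exists N => // n /= Nn.
by rewrite -ball_normE /= normE ltcE /= -ei eqxx hN.
Qed.

Lemma ae_integrable_sum D (I : Type) (r : seq I) (F : I -> R -> R) : measurable D ->
  (forall i, ae_integrable D (F i)) ->
  ae_integrable D (fun t => \sum_(i <- r) F i t) /\
  \int[mu]_(t in D) (\sum_(i <- r) F i t) = \sum_(i <- r) \int[mu]_(t in D) F i t.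
Proof.
move=> mD Fi; elim: r => [|i r [IH1 IH2]].
  split; last by rewrite big_nil; under eq_Rintegral do rewrite big_nil; rewrite Rintegral_cst ?mul0r.
  by under [X in ae_integrable _ X]eq_fun do rewrite big_nil; exists (fun=> 0); [exact: integrable0|exact: aeW].
split; first by under [X in ae_integrable _ X]eq_fun do rewrite big_cons; exact: ae_integrableD.
by rewrite big_cons -IH2 -Rint_D//; apply: eq_Rintegral => t _; rewrite big_cons.
Qed.

Lemma Rint_indic D E (k : R) : measurable D -> measurable E ->
  (mu (D `&` E) < +oo)%E ->
  ae_integrable D (fun t => k * \1_E t) /\
  \int[mu]_(t in D) (k * \1_E t) = k * fine (mu (D `&` E)).
Proof.
move=> mD mE fE.
have mi : measurable_fun D (EFin \o (\1_E : R -> R)).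
  by apply/measurable_EFinP; apply: measurable_indic.
have i1 : ae_integrable D (\1_E : R -> R).
  exists \1_E; last exact: aeW.
  apply/integrableP; split => //.
  rewrite (_ : (\int[mu]_(x in D) _)%E = (\int[mu]_(x in D) (\1_E x)%:E)%E).
    by rewrite integral_indic// setIC.
  by apply: eq_integral => t _; rewrite /= ger0_norm// indicE.
split; first exact: ae_integrableZ.
by rewrite Rint_Z// /Rintegral integral_indic// setIC.
Qed.

Section Weak.
Variable ip : {dot H for Num.Def.conjC}.

Lemma rip_suml (I : Type) (r : seq I) (F : I -> H) z :
  rip ip (\sum_(i <- r) F i) z = \sum_(i <- r) rip ip (F i) z.
Proof.
by apply: (big_morph (rip ip ^~ z)) => [x y|]; rewrite ?ripDl ?rip0l.
Qed.

(** Both sides are sums over the finitely many values of s. The value 0, whose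
    level set may have infinite measure, contributes nothing to either. *)
Lemma simple_integral_weak D (s : {fimfun R >-> H}) : measurable D ->
  measurable_simple s ->
  (forall x, x != 0 -> (mu (D `&` s @^-1` [set x]) < +oo)%E) ->
  vintegrable D s /\
  forall z, rip ip (simple_integral D s) z = \int[mu]_(t in D) rip ip (s t) z.
Proof.
move=> mD ms fs; have fr : finite_set (range s) by exact: fimfunP.
pose r := finmap.enum_fset (fset_set (range s)).
have sr t : s t \in r by rewrite in_fset_set// inE; exists t.
have ur : uniq r by exact: finmap.fset_uniq.
have key (phi : H -> R) t : phi (s t) = \sum_(x <- r) phi x * \1_(s @^-1` [set x]) t.
  rewrite (bigD1_seq (s t))//= indicE mem_set// mulr1 big1 ?addr0// => x xs.
  rewrite indicE memNset ?mulr0// => /= e; by rewrite e eqxx in xs.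
have term (phi : H -> R) x : phi 0 = 0 ->
    ae_integrable D (fun t => phi x * \1_(s @^-1` [set x]) t) /\
    \int[mu]_(t in D) (phi x * \1_(s @^-1` [set x]) t) =
      phi x * fine (mu (D `&` s @^-1` [set x])).
  move=> p0; have [->|x0] := eqVneq x 0; last by apply: Rint_indic => //; exact: fs.
  rewrite p0 mul0r; under eq_Rintegral do rewrite mul0r.
  under [X in ae_integrable _ X]eq_fun do rewrite mul0r.
  by split; [exists (fun=> 0); [exact: integrable0|exact: aeW]|rewrite Rintegral_cst ?mul0r].
split.
  split; first by exists s; [exact/simple_vmeas/fimfun_simple|exact: aeW].
  under [X in ae_integrable _ X]eq_fun do rewrite (key (@hnorm _ _)).
  by apply: (ae_integrable_sum _ mD _).1 => x; case: (term (@hnorm _ _) x (hnorm0)).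
move=> z; rewrite /simple_integral fsbig_finite// rip_suml.
under [RHS]eq_Rintegral do rewrite (key (rip ip ^~ z)).
have term' := fun x => term (rip ip ^~ z) x (rip0l ip z).
rewrite (ae_integrable_sum _ mD (fun x => (term' x).1)).2.
by apply: eq_bigr => x _; rewrite (term' x).2 ripZl mulrC.
Qed.

(** Take simple functions s n that converge to a representative g of f, and
    discard the values where |s n| > 2 |g|. The truncated functions still
    converge, they are dominated by 2 |g|, and their level sets off 0 have
    finite measure by Chebyshev's inequality. *)
Lemma vintegrable_simple_approx D f : measurable D -> vintegrable D f ->
  exists s : nat -> {fimfun R >-> H},
    [/\ forall n, measurable_simple (s n),
        forall n x, x != 0 -> (mu (D `&` s n @^-1` [set x]) < +oo)%E,
        {ae mu, forall t, D t -> s n t @[n --> \oo] --> f t} &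
        (\int[mu]_(t in D) (hnorm (f t - s n t))%:E)%E @[n --> \oo] --> 0%E].
Proof.
move=> mD [[g mg fg] fi].
have gi : ae_integrable D (fun t => hnorm (g t)).
  by apply: ae_integrable_ext fi; apply: (ae_imp fg) => t h /h ->.
have [s [ss cs]] := vmeas_simple_cvg mg.
pose s' n t := if hnorm (s n t) <= 2 * hnorm (g t) then s n t else 0.
have ss' n : simple (s' n).
  apply: simple_if => //; last exact: simple_cst.
  have := measurable_fun_ler (vmeas_hnorm (simple_vmeas (ss n)))
    (measurable_funM (@measurable_cst _ _ _ _ [set: R] (2 : R)) (vmeas_hnorm mg)).
  by move=> /(_ measurableT [set true] I); rewrite setTI.
have bs' n t : hnorm (s' n t) <= 2 * hnorm (g t).
  rewrite /s'; case: ifP => // _; rewrite hnorm0 mulr_ge0//; exact: hnorm_ge0.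
have cs' t : s' n t @[n --> \oo] --> g t.
  have [g0|g0] := eqVneq (g t) 0.
    rewrite g0 (_ : (fun _ => _) = fun=> 0); first exact: cvg_cst.
    apply/funext => n; apply: hnorm_eq0; apply/eqP.
    by rewrite eq_le hnorm_ge0 andbT (le_trans (bs' n t))// g0 hnorm0 mulr0.
  apply/hcvgP => e e0; have /hcvgP h := cs t.
  have p : 0 < hnorm (g t).
    rewrite lt_neqAle hnorm_ge0 andbT eq_sym; apply: contra g0 => /eqP/hnorm_eq0 ->.
    exact: eqxx.
  have h1 := h _ e0; have h2 := h _ p; near=> n.
  rewrite /s' ifT; first by near: n.
  have : hnorm (s n t - g t) < hnorm (g t) by near: n.
  have := hnorm_add (s n t - g t) (g t); rewrite subrK; lra.
have /choice[S hS] : forall n, exists S : {fimfun R >-> H}, measurable_simple S /\ s' n = S.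
  by move=> n; have [S mS e] := simple_fimfun (ss' n); exists S.
have SE n t : S n t = s' n t by case: (hS n) => _ ->.
have [gm gfin] := (ae_integrableP _ mD).1 gi.
have mhg : measurable_fun [set: R] (fun t => hnorm (g t)) by exact: vmeas_hnorm.
exists S; split.
- by move=> n; case: (hS n).
- move=> n x x0; set E := _ `&` _.
  have mE : measurable E by apply: measurableI => //; case: (hS n) => + _; apply.
  have xp : 0 < hnorm x / 2.
    rewrite divr_gt0// lt_neqAle hnorm_ge0 andbT eq_sym.
    by apply: contra x0 => /eqP/hnorm_eq0 ->.
  have : ((hnorm x / 2)%:E * mu E <= \int[mu]_(t in D) (`|hnorm (g t)|)%:E)%E.
    rewrite -integral_cst//; apply: (@le_trans _ _ (\int[mu]_(t in E) (`|hnorm (g t)|)%:E)%E).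
      apply: ge0_le_integral => //.
      - by move=> t _; rewrite lee_fin ltW.
      - by apply/measurable_EFinP; apply: measurableT_comp => //; exact: measurable_funTS.
      - move=> t [_ /= e]; rewrite lee_fin ger0_norm ?hnorm_ge0//.
        by have := bs' n t; rewrite -SE e; lra.
    apply: ge0_subset_integral => //.
    - by apply/measurable_EFinP; apply: measurableT_comp => //; exact: measurable_funTS.
    - by move=> t [].
  move=> /le_lt_trans /(_ gfin) h; rewrite ltNge leye_eq; apply/negP => /eqP e.
  by move: h; rewrite e gt0_muley ?lte_fin// ltxx.
- apply: (ae_imp fg) => t h Dt; rewrite h// (_ : (fun n => S n t) = s' ^~ t)//.
  by apply/funext => n; rewrite SE.
rewrite (_ : (fun n => _) = fun n => (\int[mu]_(t in D) (hnorm (g t - s' n t))%:E)%E).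
  have c0 t : (hnorm (g t - s' n t))%:E @[n --> \oo] --> 0%E.
    apply: cvg_EFin; first exact: nearW.
    rewrite (_ : _ \o _ = fun n => hnorm (s' n t - g t)); first exact/hcvg0P.
    by apply/funext => n /=; rewrite hdistC.
  have i3 : mu.-integrable D (fun t => (3 * hnorm (g t))%:E).
    apply/integrableP; split.
      by apply/measurable_EFinP; apply: measurable_funM => //; exact: measurable_funTS.
    by have [] := (ae_integrableP _ mD).1 (ae_integrableZ 3 mD gi).
  have mn n : measurable_fun D (fun t => (hnorm (g t - s' n t))%:E).
    apply/measurable_EFinP; apply: measurable_funTS; apply: vmeas_hnorm.
    by apply: vmeasB => //; exact: simple_vmeas.
  have [|_ _] := @dominated_convergence _ _ R mu D mD _ (cst 0%E) _ mn
    (measurable_cst _) (aeW mu (fun t _ => c0 t)) i3.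
    apply: aeW => t n _; rewrite /= lee_fin ger0_norm ?hnorm_ge0//.
    have := hnorm_add (g t) (- s' n t); rewrite hnorm_opp.
    by have := bs' n t; lra.
  by rewrite integral0.
apply/funext => n; apply: ge0_integral_ae => //.
- by move=> t _; rewrite lee_fin hnorm_ge0.
- by move=> t _; rewrite lee_fin hnorm_ge0.
by apply: (ae_imp fg) => t h Dt; rewrite h// SE.
Unshelve. all: by end_near. Qed.

End Weak.

End VectorIntegrability.

Section BochnerIntegral.
Context {R : realType} {H : completeNormedModType R[i]}.
Local Notation mu := (@lebesgue_measure R).
Implicit Types (D : set R) (f g : R -> H).
Variable ip : {dot H for Num.Def.conjC}.
Hypothesis ipH : hilbert_norm ip.

Lemma hnorm_weak_le (x : H) (k : R) : 0 <= k ->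
  (forall z, rip ip x z <= hnorm z * k) -> hnorm x <= k.
Proof.
move=> k0 /(_ x); rewrite (ripxx ipH) expr2 => h.
have := hnorm_ge0 x; rewrite le_eqVlt => /predU1P[<-//|x0].
by rewrite -(ler_pM2l x0).
Qed.

Lemma Rint_dist_cvg D f (s : nat -> {fimfun R >-> H}) : measurable D ->
  vintegrable D f -> (forall n, vintegrable D (s n)) ->
  (\int[mu]_(t in D) (hnorm (f t - s n t))%:E)%E @[n --> \oo] --> 0%E ->
  \int[mu]_(t in D) hnorm (f t - s n t) @[n --> \oo] --> (0 : R).
Proof.
move=> mD fi si h; apply: fine_cvg.
rewrite (_ : (fun n => _) = fun n => (\int[mu]_(t in D) (hnorm (f t - s n t))%:E)%E) //.
Qed.

(** Paired with z, the difference of two simple integrals is an integral of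
    <s N - s n, z>, at most |z| times the L1-distance of s N and s n; so the
    simple integrals form a Cauchy sequence. *)
Lemma vintegrable_bochner D f : measurable D -> vintegrable D f ->
  exists I, is_bochner_integral D f I.
Proof.
move=> mD fi; have [s [ms fs cs ds]] := vintegrable_simple_approx mD fi.
have si n := (simple_integral_weak ip mD (ms n) (fs n)).1.
have sw n := (simple_integral_weak ip mD (ms n) (fs n)).2.
have d0 := Rint_dist_cvg mD fi si ds.
have [|I hI] := @hcauchy _ _ (fun n => simple_integral D (s n)).
  move=> e e0; move/cvgrPdist_lt: d0 => /(_ (e / 2)); rewrite divr_gt0// => /(_ isT)[N _ hN].
  exists N => n Nn; have [h1 h2] := (hN _ (leqnn N), hN _ Nn).
  move: h1 h2; rewrite !sub0r !normrN.
  set a := \int[mu]_(t in D) _; set b := \int[mu]_(t in D) _ => h1 h2.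
  have a0 : 0 <= a by apply: Rintegral_ge0 => t _; exact: hnorm_ge0.
  have b0 : 0 <= b by apply: Rintegral_ge0 => t _; exact: hnorm_ge0.
  rewrite ger0_norm// in h1; rewrite ger0_norm// in h2.
  suff : hnorm (simple_integral D (s N) - simple_integral D (s n)) <= a + b by lra.
  apply: hnorm_weak_le => [|z]; first lra.
  rewrite ripBl !sw -Rint_B//; [|exact: ae_integrable_rip..].
  under eq_Rintegral do rewrite -ripBl.
  apply: le_trans (ler_norm _) _.
  apply: le_trans (Rint_rip_le z ipH mD (vintegrableB mD (si N) (si n))) _.
  apply: ler_wpM2l; first exact: hnorm_ge0.
  rewrite -Rint_D//; last first.
  - by case: (vintegrableB mD fi (si n)).
  - by case: (vintegrableB mD fi (si N)).
  apply: Rint_le => //.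
  - by case: (vintegrableB mD (si N) (si n)).
  - apply: ae_integrableD => //; last by case: (vintegrableB mD fi (si n)).
    by case: (vintegrableB mD fi (si N)).
  apply: aeW => t _; have := hnorm_tri (s N t) (f t) (s n t).
  by rewrite (hdistC (s N t) (f t)).
by exists I, s; split.
Qed.

Lemma bochner_weak D f I : measurable D -> is_bochner_integral D f I ->
  vintegrable D f /\ forall z, rip ip I z = \int[mu]_(t in D) rip ip (f t) z.
Proof.
move=> mD [s [ms fs cs ds hI]].
have si n := (simple_integral_weak ip mD (ms n) (fs n)).1.
have sw n := (simple_integral_weak ip mD (ms n) (fs n)).2.
have mf : ae_vmeas D f by apply/strongly_measurableP => //; exists s.
have fi : vintegrable D f.
  have [N _ /(_ N (leqnn N))] : \forall n \near \oo,
      ((\int[mu]_(t in D) (hnorm (f t - s n t))%:E) < 1)%E.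
    move/fine_cvgP: (ds) => [fn /cvgrPdist_lt/(_ 1 ltr01) h]; near=> n.
    have : (\int[mu]_(t in D) (hnorm (f t - s n t))%:E)%E \is a fin_num by near: n.
    move/fineK <-; rewrite lte_fin.
    have : `|0 - fine (\int[mu]_(t in D) (hnorm (f t - s n t))%:E)%E| < 1 by near: n.
    by rewrite sub0r normrN => /(le_lt_trans (ler_norm _)).
  move=> lt1; have dN : vintegrable D (fun t => f t - s N t).
    have mfs : ae_vmeas D (fun t => f t - s N t) by apply: ae_vmeasB => //; case: (si N).
    split=> //; apply/ae_integrableP => //; split; first exact: ae_vmeas_hnorm.
    apply: (@le_lt_trans _ _ 1%E); last exact: ltry.
    apply: le_trans (ltW lt1); rewrite le_eqVlt; apply/orP; left; apply/eqP.
    by apply: eq_integral => t _; rewrite ger0_norm// hnorm_ge0.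
  apply: vintegrable_ext (vintegrableD mD dN (si N)).
  by apply: aeW => t _; rewrite subrK.
split=> // z; have d0 := Rint_dist_cvg mD fi si ds.
have h1 : rip ip (simple_integral D (s n)) z @[n --> \oo] --> rip ip I z.
  exact: rip_cvg.
suff h2 : rip ip (simple_integral D (s n)) z @[n --> \oo] -->
    \int[mu]_(t in D) rip ip (f t) z by rewrite -(cvg_lim _ h1)// -(cvg_lim _ h2).
apply/cvgrPdist_lt => e e0; have p : 0 < hnorm z + 1 by have := hnorm_ge0 z; lra.
move/cvgrPdist_lt: d0 => /(_ (e / (hnorm z + 1))); rewrite divr_gt0// => /(_ isT).
apply: filterS => n; rewrite sub0r normrN ltr_pdivlMr// => h.
rewrite sw -Rint_B//; [|exact: ae_integrable_rip..].
under eq_Rintegral do rewrite -ripBl.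
apply: le_lt_trans (Rint_rip_le z ipH mD (vintegrableB mD fi (si n))) _.
apply: le_lt_trans h; rewrite mulrC.
apply: le_trans (ler_wpM2r _ (ler_norm _)) _; first exact: hnorm_ge0.
by apply: ler_wpM2l; rewrite ?lerDl.
Unshelve. all: by end_near. Qed.

(** In a Hilbert space the Bochner integral is determined by its pairings with
    vectors. Linearity, norm bounds and almost-everywhere invariance are
    inherited from real integrals through this equivalence. *)
Lemma bochnerP D f I : measurable D -> is_bochner_integral D f I <->
  vintegrable D f /\ forall z, rip ip I z = \int[mu]_(t in D) rip ip (f t) z.
Proof.
move=> mD; split; first exact: bochner_weak.
move=> [fi fw]; have [J hJ] := vintegrable_bochner mD fi.
suff -> : I = J by [].
by apply: (rip_eq ipH) => z; rewrite fw (bochner_weak mD hJ).2.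
Qed.

Lemma bochner_norm D f I : measurable D -> is_bochner_integral D f I ->
  hnorm I <= \int[mu]_(t in D) hnorm (f t).
Proof.
move=> mD /(bochner_weak mD) [fi fw]; apply: hnorm_weak_le => [|z].
  by apply: Rintegral_ge0 => t _; exact: hnorm_ge0.
rewrite fw; apply: le_trans (ler_norm _) _; exact: Rint_rip_le.
Qed.

Lemma bochnerB D f g I J : measurable D -> is_bochner_integral D f I ->
  is_bochner_integral D g J -> is_bochner_integral D (fun t => f t - g t) (I - J).
Proof.
move=> mD /(bochner_weak mD) [fi fw] /(bochner_weak mD) [gi gw].
apply/bochnerP => //; split; first exact: vintegrableB.
move=> z; rewrite ripBl fw gw -Rint_B//; [|exact: ae_integrable_rip..].
by apply: eq_Rintegral => t _; rewrite ripBl.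
Qed.

Lemma bochnerN (I : set R) (f : R -> H) x : measurable I -> is_bochner_integral I f x ->
  is_bochner_integral I (fun t => - f t) (- x).
Proof.
move=> mI /(bochner_weak mI)[fi fw]; apply/bochnerP => //.
split; first exact: vintegrableN.
move=> z; rewrite ripNl fw -mulN1r -Rint_Z//; last exact: ae_integrable_rip.
by apply: eq_Rintegral => t _; rewrite ripNl mulN1r.
Qed.

Lemma bochner_ext D f g I : measurable D -> {ae mu, forall t, D t -> f t = g t} ->
  is_bochner_integral D f I -> is_bochner_integral D g I.
Proof.
move=> mD fg /(bochner_weak mD) [fi fw]; apply/bochnerP => //; split.
  exact: vintegrable_ext fi.
by move=> z; rewrite fw; apply: Rintegral_ae => //; apply: (ae_imp fg) => t h /h ->.
Qed.

End BochnerIntegral.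

(** * The space of square-integrable vector-valued functions *)

Section SquareIntegrable.
Context {R : realType} {H : completeNormedModType R[i]}.
Local Notation mu := (@lebesgue_measure R).
Implicit Types (D : set R) (f g : R -> H).

Definition sq_integrable D f : Prop :=
  ae_vmeas D f /\ ae_integrable D (fun t => hnorm (f t) ^+ 2).

(** The real value of the L2-norm; it carries information on square-integrable
    functions only. *)
Definition l2 D f : R := Num.sqrt (\int[mu]_(t in D) hnorm (f t) ^+ 2).

Lemma l2_ge0 D f : 0 <= l2 D f.
Proof. exact: sqrtr_ge0. Qed.

Lemma sqr_l2 D f : l2 D f ^+ 2 = \int[mu]_(t in D) hnorm (f t) ^+ 2.
Proof. by rewrite sqr_sqrtr//; apply: Rintegral_ge0 => t _; exact: sqr_ge0. Qed.

Lemma sq_integrable_ext D f g : {ae mu, forall t, D t -> f t = g t} ->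
  sq_integrable D f -> sq_integrable D g.
Proof.
move=> fg [mf fi]; split; first exact: ae_vmeas_ext mf.
by apply: ae_integrable_ext fi; apply: (ae_imp fg) => t h /h ->.
Qed.

Lemma l2_ext D f g : measurable D -> {ae mu, forall t, D t -> f t = g t} ->
  l2 D f = l2 D g.
Proof.
move=> mD fg; rewrite /l2; congr Num.sqrt; apply: Rintegral_ae => //.
by apply: (ae_imp fg) => t h /h ->.
Qed.

Lemma sq_integrable_le D f (k : R -> R) : measurable D -> ae_vmeas D f ->
  ae_integrable D k -> {ae mu, forall t, D t -> hnorm (f t) ^+ 2 <= k t} ->
  sq_integrable D f.
Proof.
move=> mD mf ki fk; split=> //; apply: ae_integrable_le ki _ => //.
  by apply: (@ae_meas_comp _ _ _ (fun x => x ^+ 2)); [exact: exprn_measurable|exact: ae_vmeas_hnorm].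
by apply: (ae_imp fk) => t h /h; rewrite ger0_norm ?sqr_ge0.
Qed.

Lemma sq_integrableN D f : sq_integrable D f -> sq_integrable D (fun t => - f t).
Proof.
move=> [mf fi]; split; first exact: ae_vmeasN.
by under [X in ae_integrable _ X]eq_fun do rewrite hnorm_opp.
Qed.

Lemma l2N D f : l2 D (fun t => - f t) = l2 D f.
Proof. by rewrite /l2; under eq_Rintegral do rewrite hnorm_opp. Qed.

Lemma sq_integrable_mul D f g : measurable D -> sq_integrable D f -> sq_integrable D g ->
  ae_integrable D (fun t => hnorm (f t) * hnorm (g t)).
Proof.
move=> mD [mf fi] [mg gi].
apply: (ae_integrable_le mD _ (ae_integrableD mD fi gi)).
  by apply: ae_meas_mul; exact: ae_vmeas_hnorm.
apply: aeW => t _; rewrite ger0_norm ?mulr_ge0 ?hnorm_ge0//.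
by have := sqr_ge0 (hnorm (f t) - hnorm (g t)); have := sqr_ge0 (hnorm (f t) + hnorm (g t)); nra.
Qed.

(** The infimum of the right-hand side over s is 2 a b. *)
Lemma young_le (x a b : R) : 0 <= a -> 0 <= b ->
  (forall s, 0 < s -> 2 * x <= s * a ^+ 2 + s^-1 * b ^+ 2) -> x <= a * b.
Proof.
move=> a0 b0 h; apply/ler_addgt0Pr => e e0.
(* The optimal s = b / a is perturbed by d, which covers the cases a = 0, b = 0. *)
pose d := e / (a + b + 1).
have p : 0 < a + b + 1 by lra.
have d0 : 0 < d by rewrite divr_gt0.
have ed : e = d * (a + b + 1) by rewrite /d divfK// gt_eqF.
have pa : 0 < a + d by lra. have pb : 0 < b + d by lra.
have := h ((b + d) / (a + d)); rewrite divr_gt0// invf_div => /(_ isT).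
have h1 : (b + d) / (a + d) * a ^+ 2 <= (b + d) * a.
  rewrite mulrAC ler_pdivrMr// expr2.
  have : 0 <= (b + d) * a * d by apply: mulr_ge0; [apply: mulr_ge0|]; lra.
  by lra.
have h2 : (a + d) / (b + d) * b ^+ 2 <= (a + d) * b.
  rewrite mulrAC ler_pdivrMr// expr2.
  have : 0 <= (a + d) * b * d by apply: mulr_ge0; [apply: mulr_ge0|]; lra.
  by lra.
rewrite ed; lra.
Qed.

(** Integrate 2 |f| |g| <= s |f|^2 + |g|^2 / s and optimize over s. *)
Lemma cauchy_schwarz_l2 D f g : measurable D -> sq_integrable D f -> sq_integrable D g ->
  \int[mu]_(t in D) (hnorm (f t) * hnorm (g t)) <= l2 D f * l2 D g.
Proof.
move=> mD fi gi; apply: young_le => [||s s0]; [exact: l2_ge0..|].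
have mi := sq_integrable_mul mD fi gi; case: fi gi => [mf fi] [mg gi].
rewrite !sqr_l2 -!Rint_Z// -Rint_D//; [|exact: ae_integrableZ..].
apply: Rint_le => //; [exact: ae_integrableZ|by apply: ae_integrableD => //; exact: ae_integrableZ|].
apply: aeW => t _; set a := hnorm (f t); set b := hnorm (g t).
rewrite -(ler_pM2l s0) mulrDr (mulrA s s^-1) mulfV ?gt_eqF// mul1r.
have := sqr_ge0 (s * a - b); nra.
Qed.

Lemma sq_integrableD D f g : measurable D -> sq_integrable D f -> sq_integrable D g ->
  sq_integrable D (fun t => f t + g t).
Proof.
move=> mD [mf fi] [mg gi].
apply: (sq_integrable_le mD (ae_vmeasD mf mg) (ae_integrableZ 2 mD (ae_integrableD mD fi gi))).
apply: aeW => t _; have := hnorm_add (f t) (g t); have := hnorm_ge0 (f t + g t).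
have := sqr_ge0 (hnorm (f t) - hnorm (g t)); have := hnorm_ge0 (f t); have := hnorm_ge0 (g t).
nra.
Qed.

Lemma sq_integrableB D f g : measurable D -> sq_integrable D f -> sq_integrable D g ->
  sq_integrable D (fun t => f t - g t).
Proof. by move=> mD fi /sq_integrableN; exact: sq_integrableD. Qed.

Lemma l2_le_sum D f (u v : R -> H) : measurable D -> ae_vmeas D f ->
  sq_integrable D u -> sq_integrable D v ->
  {ae mu, forall t, D t -> hnorm (f t) <= hnorm (u t) + hnorm (v t)} ->
  sq_integrable D f /\ l2 D f <= l2 D u + l2 D v.
Proof.
move=> mD mf ui vi fuv; have uvi := sq_integrable_mul mD ui vi.
have [[mu' ui'] [mv vi']] := (ui, vi).
have ki : ae_integrable D (fun t => hnorm (u t) ^+ 2 + 2 * (hnorm (u t) * hnorm (v t)) + hnorm (v t) ^+ 2).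
  by apply: ae_integrableD => //; apply: ae_integrableD => //; exact: ae_integrableZ.
have fk : {ae mu, forall t, D t -> hnorm (f t) ^+ 2 <=
    hnorm (u t) ^+ 2 + 2 * (hnorm (u t) * hnorm (v t)) + hnorm (v t) ^+ 2}.
  apply: (ae_imp fuv) => t h /h; have := hnorm_ge0 (f t).
  by have := hnorm_ge0 (u t); have := hnorm_ge0 (v t); nra.
have fi := sq_integrable_le mD mf ki fk; split=> //.
have uv0 : 0 <= l2 D u + l2 D v by rewrite addr_ge0// l2_ge0.
rewrite -(ler_pXn2r (ltn0Sn 1)) ?nnegrE ?l2_ge0// sqr_l2.
have := cauchy_schwarz_l2 mD ui vi; rewrite sqrrD !sqr_l2 => cs.
apply: le_trans (Rint_le mD fi.2 ki fk) _.
rewrite Rint_D//; last by apply: ae_integrableD => //; exact: ae_integrableZ.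
rewrite Rint_D ?Rint_Z//; last exact: ae_integrableZ.
rewrite -mulr_natl; lra.
Qed.

Lemma l2_triangle D f g : measurable D -> sq_integrable D f -> sq_integrable D g ->
  l2 D (fun t => f t + g t) <= l2 D f + l2 D g.
Proof.
move=> mD fi gi; apply: (l2_le_sum mD (sq_integrableD mD fi gi).1 fi gi _).2.
by apply: aeW => t _; exact: hnorm_add.
Qed.

Lemma l2Z D (a : R) f : measurable D -> sq_integrable D f ->
  sq_integrable D (fun t => a%:C *: f t) /\ l2 D (fun t => a%:C *: f t) = `|a| * l2 D f.
Proof.
move=> mD [mf fi].
have e t : hnorm (a%:C *: f t) ^+ 2 = a ^+ 2 * hnorm (f t) ^+ 2.
  by rewrite hnormZ exprMn real_normK// num_real.
split.
  split; last by under [X in ae_integrable _ X]eq_fun do rewrite e; exact: ae_integrableZ.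
  have [g mg fg] := mf; exists (fun t => a%:C *: g t); first exact: vmeasZ.
  by apply: (ae_imp fg) => t h Dt; rewrite h.
rewrite /l2; under eq_Rintegral do rewrite e.
by rewrite Rint_Z// sqrtrM ?sqr_ge0// sqrtr_sqr.
Qed.

Lemma l2_eq0 D f : measurable D -> sq_integrable D f -> l2 D f = 0 ->
  {ae mu, forall t, D t -> f t = 0}.
Proof.
move=> mD [mf fi] f0; have := sqr_l2 D f; rewrite f0 expr0n /= => e.
have [g ig fg] := fi.
have : (\int[mu]_(t in D) `|(g t)%:E| = 0)%E.
  suff -> : (\int[mu]_(t in D) `|(g t)%:E| =
      (\int[mu]_(t in D) hnorm (f t) ^+ 2)%:E)%E by rewrite -e.
  rewrite -ge0_Rint_EFin//; last by move=> t _; exact: sqr_ge0.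
  apply: integral_ae => //; apply: (ae_imp fg) => t h Dt.
  by rewrite -h//= ger0_norm// sqr_ge0.
move/(@ae_eq_integral_abs _ _ _ mu D mD) => /(_ (measurable_int _ ig)) g0.
apply: (ae_imp2 fg g0) => t a b Dt.
have := b Dt; rewrite -a// => -[] /eqP; rewrite sqrf_eq0 => /eqP; exact: hnorm_eq0.
Qed.

Lemma time_itv_fin (r : R) : time_itv r%:E = `]0, r[%classic.
Proof.
apply/seteqP; split => t /=; rewrite in_itv /=; last by move=> /andP[].
by move=> [t0]; rewrite lte_fin t0 => ->.
Qed.

Lemma open_time_itv (S : \bar R) : open (time_itv S).
Proof.
case: S => [r| |]; first by rewrite time_itv_fin; exact: interval_open.
- rewrite (_ : time_itv _ = `]0, +oo[%classic); first exact: interval_open.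
  apply/seteqP; split => t /=; rewrite in_itv /= ?andbT; first by case.
  by move=> t0; split=> //; rewrite ltry.
- by rewrite (_ : time_itv _ = set0); [exact: open0|apply/seteqP; split => t //= []].
Qed.

Lemma measurable_time_itv (S : \bar R) : measurable (time_itv S).
Proof. by apply: open_measurable; exact: open_time_itv. Qed.

Lemma inL2P (S : \bar R) f : inL2 S f <-> sq_integrable (time_itv S) f.
Proof.
have mD := measurable_time_itv S.
have E : (\int[mu]_(t in time_itv S) (`|hnorm (f t) ^+ 2|)%:E =
    \int[mu]_(t in time_itv S) (hnorm (f t) ^+ 2)%:E)%E.
  by apply: eq_integral => t _; rewrite ger0_norm// sqr_ge0.
have I0 : (0 <= \int[mu]_(t in time_itv S) (hnorm (f t) ^+ 2)%:E)%E.
  by apply: integral_ge0 => t _; rewrite lee_fin sqr_ge0.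
have p : (2^-1 : R) != 0 by rewrite invr_neq0.
split=> -[].
  move/(strongly_measurableP _ mD) => mf fl; split=> //; apply/ae_integrableP => //; split.
    by apply: (@ae_meas_comp _ _ _ (fun x => x ^+ 2)); [exact: exprn_measurable|exact: ae_vmeas_hnorm].
  rewrite E; move: fl; rewrite /L2norm; case: (integral _ _ _) I0 => [r||]// _.
    by move=> _; exact: ltry.
  by rewrite poweRyr.
move=> mf /(ae_integrableP _ mD)[_]; rewrite E => fi; split; first exact/strongly_measurableP.
rewrite /L2norm; case: (integral _ _ _) I0 fi => [r||]// _ _.
by rewrite poweR_EFin ltry.
Qed.

Lemma L2normE (S : \bar R) f : sq_integrable (time_itv S) f ->
  L2norm S f = (l2 (time_itv S) f)%:E.
Proof.
have mD := measurable_time_itv S.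
move=> [mf fi]; rewrite /L2norm ge0_Rint_EFin//; last by move=> t _; exact: sqr_ge0.
rewrite poweR_EFin powR12_sqrt//; apply: Rintegral_ge0 => t _; exact: sqr_ge0.
Qed.

End SquareIntegrable.

(** * Uniqueness of the time derivative *)

Section DerivativeUnique.
Context {R : realType}.
Local Notation mu := (@lebesgue_measure R).

Lemma ae_forall_nat (P : nat -> R -> Prop) :
  (forall n, {ae mu, forall t, P n t}) -> {ae mu, forall t, forall n, P n t}.
Proof. by move=> h; apply: ae_foralln. Qed.

(** The primitive of f is constant on the interval, and it has derivative f
    almost everywhere by the Lebesgue differentiation theorem. *)
Lemma ae_eq0_of_Rintegral0 (a b : R) (f : R -> R) :
  ae_integrable `]a, b[%classic f ->
  (forall s t, a < s -> s < t -> t < b -> \int[mu]_(x in `]s, t[) f x = 0) ->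
  {ae mu, forall t, `]a, b[%classic t -> f t = 0}.
Proof.
move=> [g ig fg] f0; set D := `]a, b[%classic.
have mD : measurable D by exact: measurable_itv.
pose h := g \_ D.
have ih : mu.-integrable [set: R] (EFin \o h).
  have := (@integrable_mkcond _ _ _ mu D (EFin \o g) mD).1 ig.
  by rewrite /h restrict_EFin.
have lh : locally_integrable [set: R] h by exact: integrable_locally.
have ihy y : mu.-integrable `]-oo, y] (EFin \o h).
  by apply: (@integrableS _ _ _ mu [set: R]) => //; exact: measurable_itv.
have := FTC1Ny ihy lh; set F := fun x => \int[mu]_(t in _) _ => hF.
have aih E : measurable E -> ae_integrable E h.
  move=> mE; exists h; last exact: aeW.
  exact: (@integrableS _ _ _ mu [set: R]).
have FE s t : a < s -> s < t -> t < b -> F t = F s.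
  move=> sa st tb; rewrite /F (_ : `]-oo, t]%classic = `]-oo, s]%classic `|` `]s, t]%classic); last first.
    apply/seteqP; split=> x /=; rewrite !in_itv /=.
      by case: (leP x s) => xs xt; [left|right].
    by move=> [xs|/andP[]//]; apply: le_trans xs (ltW st).
  rewrite Rint_setU; [|exact: measurable_itv|exact: measurable_itv| |].
  - rewrite -[RHS]addr0; congr (_ + _).
    rewrite -Rintegral_itv_bndo_bndc; last first.
      by apply: (@integrableS _ _ _ mu [set: R]) => //; exact: measurable_itv.
    rewrite -(f0 s t)//; apply: Rintegral_ae; first exact: measurable_itv.
    apply: (ae_imp fg) => x e /=; rewrite in_itv /= => /andP[sx xt].
    have Dx : D x by rewrite /D /= in_itv /= (lt_trans sa sx) (lt_trans xt tb).
    by rewrite /h patchE mem_set// e.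
  - apply/disj_setPS => x /= []; rewrite !in_itv /= => xs /andP[sx _].
    by move: (lt_le_trans sx xs); rewrite ltxx.
  - by apply: aih; apply: measurableU; exact: measurable_itv.
apply: (ae_imp2 fg hF) => x e [dF Fx] Dx.
have hx : h x = g x by rewrite /h patchE mem_set.
rewrite e// -hx -Fx derive1E.
move: Dx; rewrite /D /= in_itv /= => /andP[ax xb].
have Fc : \forall y \near x, F y = F x.
  near=> y; have ay : a < y by near: y; exact: lt_nbhsr.
  have yb : y < b by near: y; exact: lt_nbhsl.
  by case: (ltgtP x y) => [xy|yx|-> //]; [exact: FE|exact/esym/FE].
by rewrite (@near_eq_derive _ _ _ F (cst (F x)) x 1)// derive_cst.
Unshelve. all: by end_near. Qed.

Context {H : completeNormedModType R[i]}.
Variable ip : {dot H for Num.Def.conjC}.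
Hypothesis ipH : hilbert_norm ip.

(** The exceptional null set depends on z. Since the values of f lie
    essentially in the closure of a countable set, countably many z suffice, and
    testing f t against approximations of itself gives f t = 0. *)
Lemma ae_eq0_of_weak (D : set R) (f : R -> H) : ae_vmeas D f ->
  (forall z, {ae mu, forall t, D t -> rip ip (f t) z = 0}) ->
  {ae mu, forall t, D t -> f t = 0}.
Proof.
move=> [g mg fg] fz.
have /choice[c hc] : forall n : nat, exists ck : (nat -> H) * (R -> nat),
    index_measurable ck.2 /\ forall t, hnorm (g t - ck.1 (ck.2 t)) < n.+1%:R^-1.
  move=> n; have [|c [l h]] := mg n.+1%:R^-1; last by exists (c, l).
  by rewrite invr_gt0.
have zc : {ae mu, forall t, forall n m, D t -> rip ip (f t) ((c n).1 m) = 0}.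
  by apply: ae_forall_nat => n; apply: ae_forall_nat => m; exact: fz.
apply: (ae_imp2 fg zc) => t gt zt Dt; apply: hnorm_eq0.
apply/eqP; rewrite eq_le hnorm_ge0 andbT; apply/ler_addgt0Pr => e e0; rewrite add0r.
have [n _ /(_ n (leqnn n)) /= ne] := near_infty_natSinv_lt (PosNum e0).
apply: ltW; apply: le_lt_trans ne; rewrite leNgt; apply/negP => h.
have : rip ip (f t) (f t) = rip ip (f t) (f t - (c n).1 ((c n).2 t)).
  by rewrite ripBr zt// subr0.
rewrite (ripxx ipH) => E; have := rip_le ipH (f t) (f t - (c n).1 ((c n).2 t)).
have f0 : 0 < hnorm (f t) by apply: lt_trans h; rewrite invr_gt0.
rewrite -E expr2 (ler_pM2l f0) gt// => h2.
case: (hc n) => _ /(_ t) h3; have := lt_trans (le_lt_trans h2 h3) h.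
by rewrite gt// ltxx.
Qed.

Lemma time_itv_rat (S : \bar R) (t : R) : time_itv S t ->
  exists p q : rat, [/\ 0 < ratr p :> R, ratr p < t, t < ratr q & ((ratr q : R)%:E < S)%E].
Proof.
move=> [t0 tS].
have [r tr rS] : exists2 r : R, t < r & (r%:E <= S)%E.
  case: S tS => [r||]; rewrite ?lte_fin => h //.
    by exists r.
  by exists (t + 1); rewrite ?ltrDl// leey.
have [p] := rat_in_itvoo t0; rewrite in_itv /= => /andP[p0 pt].
have [q'] := rat_in_itvoo tr; rewrite in_itv /= => /andP[tq qr].
by exists p, q'; split=> //; apply: lt_le_trans rS; rewrite lte_fin.
Qed.

(** The difference g - h has zero integral over every compact subinterval, hence
    vanishes almost everywhere on each interval with rational endpoints. *)
Lemma time_derivative_unique (S : \bar R) (phi g h : R -> H) :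
  is_time_derivative S phi g -> is_time_derivative S phi h ->
  {ae mu, forall t, time_itv S t -> g t = h t}.
Proof.
move=> dg dh.
have key (p q : R) : 0 < p -> (q%:E < S)%E ->
    {ae mu, forall t, `]p, q[%classic t -> g t - h t = 0}.
  move=> p0 qS.
  have [pq|pq] := ltP p q; last first.
    apply: aeW => t /=; rewrite in_itv /= => /andP[pt tq].
    by move: (lt_trans pt tq); rewrite ltNge pq.
  have mD : measurable (`]p, q[%classic : set R) by exact: measurable_itv.
  have bw s t : p <= s -> s < t -> t <= q ->
      vintegrable `]s, t[%classic (fun t => g t - h t) /\
      forall z, \int[mu]_(x in `]s, t[) rip ip (g x - h x) z = 0.
    move=> ps st tq; have s0 := lt_le_trans p0 ps.
    have tS : (t%:E < S)%E by apply: le_lt_trans qS; rewrite lee_fin.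
    have mst : measurable (`]s, t[%classic : set R) by exact: measurable_itv.
    have := bochnerB ipH mst (dg s t s0 st tS) (dh s t s0 st tS).
    rewrite subrr => /(bochner_weak ipH mst)[vi w]; split=> // z.
    by rewrite -w rip0l.
  have [vi _] := bw p q (lexx _) pq (lexx _).
  apply: ae_eq0_of_weak; first by case: vi.
  move=> z; apply: ae_eq0_of_Rintegral0; first exact: ae_integrable_rip.
  by move=> s t ps st tq; have [_ ->] := bw s t (ltW ps) st (ltW tq).
have all : {ae mu, forall t, forall n m : nat,
   let p : R := ratr (odflt 0 (unpickle n)) in let q : R := ratr (odflt 0 (unpickle m)) in
   0 < p -> (q%:E < S)%E -> `]p, q[%classic t -> g t - h t = 0}.
  apply: ae_forall_nat => n; apply: ae_forall_nat => m /=.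
  set p : R := ratr _; set q : R := ratr _.
  have [p0|p0] := pselect (0 < p); last by apply: aeW.
  have [qS|qS] := pselect (q%:E < S)%E; last by apply: aeW.
  by apply: (ae_imp (key _ _ p0 qS)).
apply: (ae_imp all) => t ht /time_itv_rat[p [q [p0 pt tq qS]]].
apply/eqP; rewrite -subr_eq0; apply/eqP.
have := ht (pickle p) (pickle q); rewrite !pickleK /=; apply => //.
by rewrite /= in_itv /= pt.
Qed.

End DerivativeUnique.

(** * Self-adjointness of the contraction semigroup *)

(** Summing the hypothesis over n + 1 equal steps of length k gives at most
    e (b - a) + k (m b - m a), which is arbitrarily small. This serves as a
    product rule: psi will pair a function that is only an indefinite integral
    with one that is differentiable, where no pointwise derivative of psi
    is at hand, and m is then the primitive of an integrable function. *)
Lemma quadratic_modulus_const {R : realType} (psi m : R -> R) (a b : R) : a <= b ->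
  (forall e, 0 < e -> exists2 d, 0 < d & forall s t, a <= s -> s < t -> t <= b ->
     t - s < d -> `|psi t - psi s| <= e * (t - s) + (t - s) * (m t - m s)) ->
  psi b = psi a.
Proof.
rewrite le_eqVlt => /predU1P[->//|ab] h; apply/eqP; rewrite -subr_eq0 -normr_le0.
apply/ler_addgt0Pr => e e0; rewrite add0r.
have l0 : 0 < b - a by lra.
pose M := `|m b - m a| + 1.
have M0 : 0 < M by rewrite /M; have := normr_ge0 (m b - m a); lra.
have [d d0 hd] := h (e / 2 / (b - a)) ltac:(rewrite !divr_gt0//).
pose d' := Num.min d (e / 2 / M).
have d'0 : 0 < d' by rewrite lt_min d0 !divr_gt0.
have [n _ /(_ n (leqnn n)) /= hn] := near_infty_natSinv_lt (PosNum (divr_gt0 d'0 l0)).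
pose k := (b - a) / n.+1%:R.
have n0 : 0 < (n.+1%:R : R) by [].
have k0 : 0 < k by rewrite divr_gt0.
have kd : k < d' by move: hn; rewrite ltr_pdivlMr// mulrC.
pose p j := a + k * j%:R.
have p0 : p 0%N = a by rewrite /p mulr0 addr0.
have pn : p n.+1 = b by rewrite /p /k divfK ?gt_eqF// addrC subrK.
have pS j : p j.+1 - p j = k by rewrite /p -natr1; ring.
suff : forall j, (j <= n.+1)%N ->
    `|psi (p j) - psi a| <= e / 2 / (b - a) * (k * j%:R) + k * (m (p j) - m a).
  move=> /(_ n.+1 (leqnn _)); rewrite pn /k divfK ?gt_eqF//.
  rewrite -/k divfK ?gt_eqF// => /le_trans; apply.
  have h1 : k * (m b - m a) <= k * M by rewrite ler_pM2l// /M; have := ler_norm (m b - m a); lra.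
  have h2 : k * M < e / 2 by rewrite -ltr_pdivlMr//; move: kd; rewrite lt_min => /andP[].
  lra.
elim=> [_|j IH jn].
  by rewrite p0 !subrr normr0 !mulr0 addr0.
have := IH (ltnW jn) => {}IH.
have aj : a <= p j by rewrite /p lerDl mulr_ge0// ltW.
have jb : p j.+1 <= b.
  by rewrite -pn /p lerD2l ler_pM2l// ler_nat.
have := hd (p j) (p j.+1) aj; rewrite pS -subr_gt0 pS k0 => /(_ isT jb).
move: kd; rewrite lt_min => /andP[kd _] /(_ kd) hj.
have := ler_normD (psi (p j.+1) - psi (p j)) (psi (p j) - psi a); rewrite addrA subrK.
move=> /le_trans; apply; apply: le_trans (lerD hj IH) _.
by rewrite -natr1; lra.
Qed.

Section Dense.
Context {R : realType} {H : completeNormedModType R[i]}.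

Lemma dense_vanish (D : set H) (f : H -> R) (K : R) : closure D = [set: H] ->
  (forall x y, `|f x - f y| <= K * hnorm (x - y)) ->
  (forall z, D z -> f z = 0) -> forall x, f x = 0.
Proof.
move=> cD fK f0 x; apply/eqP; rewrite -normr_le0; apply/ler_addgt0Pr => e e0; rewrite add0r.
have p : 0 < `|K| + 1 by have := normr_ge0 K; lra.
have [y Dy xy] : exists2 y, D y & hnorm (x - y) < e / (`|K| + 1).
  by apply: closure_approx; rewrite ?cD ?divr_gt0.
have := fK x y; rewrite (f0 y)// subr0 => /le_trans; apply.
move: xy; rewrite ltr_pdivlMr// => /ltW; apply: le_trans; rewrite mulrC.
by apply: ler_wpM2l; [exact: hnorm_ge0|have := ler_norm K; lra].
Qed.

End Dense.

Section Semigroup.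
Context {R : realType} {H : completeNormedModType R[i]}.
Variables (ip : {dot H for Num.Def.conjC}) (A : operator H) (E : R -> H -> H).
Hypothesis ipH : hilbert_norm ip.
Hypothesis cE : contraction_C0_semigroup E.
Hypothesis gE : generates (opp_operator A) E.
Hypothesis saA : selfadjoint ip A.

Lemma semigroup_contr t x : 0 <= t -> hnorm (E t x) <= hnorm x.
Proof. by case: cE => _; apply. Qed.

Lemma semigroup_lin t (a : R[i]) x y : 0 <= t -> E t (a *: x + y) = a *: E t x + E t y.
Proof. by move=> t0; case: cE => -[h _ _ _] _; case: (h t t0) => ->. Qed.

Lemma semigroupB t x y : 0 <= t -> E t (x - y) = E t x - E t y.
Proof.
by move=> t0; rewrite -scaleN1r addrC semigroup_lin// scaleN1r addrC.
Qed.

Lemma semigroup0 t : 0 <= t -> E t 0 = 0.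
Proof. by move=> t0; rewrite -{1}(subrr (0 : H)) semigroupB// subrr. Qed.

Lemma semigroupZ t (a : R[i]) x : 0 <= t -> E t (a *: x) = a *: E t x.
Proof. by move=> t0; rewrite -[a *: x]addr0 semigroup_lin// semigroup0// addr0. Qed.

Lemma semigroupD t x y : 0 <= t -> E t (x + y) = E t x + E t y.
Proof. by move=> t0; rewrite -[x]scale1r semigroup_lin// !scale1r. Qed.

Lemma semigroup_id x : E 0 x = x.
Proof. by case: cE => -[]. Qed.

Lemma semigroup_add s t x : 0 <= s -> 0 <= t -> E (s + t) x = E s (E t x).
Proof. by case: cE => -[_ _ + _] _; apply. Qed.

Lemma semigroup_cont t : 0 <= t -> continuous (E t).
Proof. by move=> t0; case: cE => -[h _ _ _] _; case: (h t t0). Qed.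

(** E t commutes with the difference quotients that define - A. *)
Lemma semigroup_dom t x : 0 <= t -> op_dom A x ->
  op_dom A (E t x) /\ A (E t x) = E t (A x).
Proof.
move=> t0 Dx.
have [+ _] := gE x (- A x); move=> /(_ (conj Dx erefl)) hx.
have hEt : (h^-1)%:C *: (E h (E t x) - E t x) @[h --> 0^'+] --> - E t (A x).
  rewrite -[- E t (A x)]sub0r -(semigroup0 t0) -semigroupB// sub0r.
  have h2 := cvg_comp _ (E t) hx (semigroup_cont t0 (x := - A x)).
  apply: cvg_trans h2; apply: near_eq_cvg; near=> h.
  have h0 : 0 <= h by rewrite ltW//; near: h; exact: nbhs_right_gt.
  rewrite /= semigroupZ// semigroupB//; congr (_ *: (_ - _)).
  by rewrite -!semigroup_add// addrC.
have [_ /(_ hEt)[/= D e]] := gE (E t x) (- E t (A x)).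
by split=> //; apply: oppr_inj.
Unshelve. all: by end_near. Qed.

Lemma semigroup_diff x (e : R) : op_dom A x -> 0 < e ->
  exists2 d, 0 < d & forall h, 0 < h -> h < d ->
    hnorm (E h x - x + h%:C *: A x) <= e * h.
Proof.
move=> Dx e0; have [+ _] := gE x (- A x); move=> /(_ (conj Dx erefl)).
move/hcvgP => /(_ _ e0) [d /= d0 hd]; exists d => // h h0 hlt.
have := hd h; rewrite /= sub0r normrN gtr0_norm// => /(_ hlt h0) /ltW.
rewrite opprK => /(ler_wpM2l (ltW h0)).
rewrite -{1}(gtr0_norm h0) -hnormZ scalerDr scalerA -rmorphM mulfV ?gt_eqF//.
by rewrite scale1r mulrC.
Qed.

Lemma selfadjoint_rip x y : op_dom A x -> op_dom A y -> rip ip (A x) y = rip ip x (A y).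
Proof.
move=> Dx Dy; case: saA => _ _ h.
by have [+ _] := h y (A y) => /(_ (conj Dy erefl)) /(_ x Dx); rewrite /rip => ->.
Qed.

(** The function s |-> <E s x, E (t - s) y> is constant. For a step of length h,
    the first-order terms - h <A u, w> + h <u, A w>, with u = E s x and
    w = E (t - s - h) y in the domain, cancel by symmetry of A; contractivity
    makes the remainder o(h) uniformly in s. *)
Lemma semigroup_selfadjoint_dom t x y : 0 <= t -> op_dom A x -> op_dom A y ->
  rip ip (E t x) y = rip ip x (E t y).
Proof.
move=> t0 Dx Dy; pose phi s := rip ip (E s x) (E (t - s) y).
suff : phi t = phi 0 by rewrite /phi subrr subr0 !semigroup_id.
apply: (@quadratic_modulus_const _ _ (fun=> 0)) => // e e0.
have := hnorm_ge0 x; have := hnorm_ge0 y => y0 x0.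
pose e' := e / (hnorm x + hnorm y + 1).
have p : 0 < hnorm x + hnorm y + 1 by lra.
have e'0 : 0 < e' by rewrite divr_gt0.
have [d1 d10 hx] := semigroup_diff Dx e'0.
have [d2 d20 hy] := semigroup_diff Dy e'0.
exists (Num.min d1 d2); first by rewrite lt_min d10.
move=> s r s0 sr rt; set h := r - s => hd.
have h0 : 0 < h by rewrite /h subr_gt0.
move: hd; rewrite lt_min => /andP[/(hx _ h0) {}hx /(hy _ h0) {}hy].
have tr0 : 0 <= t - r by rewrite subr_ge0.
rewrite /phi (_ : E r x = E s (E h x)); last first.
  by rewrite -semigroup_add// ?ltW// /h addrC subrK.
rewrite (_ : E (t - s) y = E (t - r) (E h y)); last first.
  by rewrite -semigroup_add// ?ltW// /h addrA subrK.
set r1 := _ + _ in hx; set r2 := _ + _ in hy.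
have e1 : E h x = x + (r1 - h%:C *: A x) by rewrite /r1 addrK addrC subrK.
have e2 : E h y = y + (r2 - h%:C *: A y) by rewrite /r2 addrK addrC subrK.
have [Du uA] := semigroup_dom s0 Dx; have [Dw wA] := semigroup_dom tr0 Dy.
have := selfadjoint_rip Du Dw; rewrite uA wA => sym.
rewrite e1 e2 (semigroupD x (r1 - _) s0) (semigroupD y (r2 - _) tr0) !semigroupB// !semigroupZ//.
rewrite ripDl ripDr ripBl ripBr ripZl ripZr sym.
set u := E s x; set w := E (t - r) y.
have b1 := le_trans (normr_rip ipH (E s r1) w) (ler_pM (hnorm_ge0 _) (hnorm_ge0 _)
  (semigroup_contr r1 s0) (semigroup_contr y tr0)).
have b2 := le_trans (normr_rip ipH u (E (t - r) r2)) (ler_pM (hnorm_ge0 _) (hnorm_ge0 _)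
  (semigroup_contr x s0) (semigroup_contr r2 tr0)).
rewrite (_ : _ - _ = rip ip (E s r1) w - rip ip u (E (t - r) r2)); last by ring.
apply: le_trans (ler_normB _ _) _; apply: le_trans (lerD b1 b2) _.
rewrite subrr mulr0 addr0.
have b3 : hnorm r1 * hnorm y <= e' * h * hnorm y by apply: ler_wpM2r.
have b4 : hnorm x * hnorm r2 <= hnorm x * (e' * h) by apply: ler_wpM2l.
have ee : e = e' * (hnorm x + hnorm y + 1) by rewrite /e' divfK// gt_eqF.
have eh : 0 <= e' * h by rewrite mulr_ge0// ltW.
rewrite ee; apply: le_trans (lerD b3 b4) _; lra.
Qed.

Lemma semigroup_selfadjoint t x y : 0 <= t -> rip ip (E t x) y = rip ip x (E t y).
Proof.
move=> t0; have [_ cD _] := saA.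
apply/eqP; rewrite -subr_eq0; apply/eqP.
pose f u v := rip ip (E t u) v - rip ip u (E t v); rewrite -/(f x y).
have lip1 v u u' : `|f u v - f u' v| <= 2 * hnorm v * hnorm (u - u').
  rewrite (_ : f u v - f u' v = rip ip (E t (u - u')) v - rip ip (u - u') (E t v)).
    apply: le_trans (ler_normB _ _) _.
    have b1 := le_trans (normr_rip ipH (E t (u - u')) v)
      (ler_wpM2r (hnorm_ge0 _) (semigroup_contr _ t0)).
    have b2 := le_trans (normr_rip ipH (u - u') (E t v))
      (ler_wpM2l (hnorm_ge0 _) (semigroup_contr _ t0)).
    apply: le_trans (lerD b1 b2) _; lra.
  by rewrite semigroupB// !ripBl /f; ring.
have lip2 u v v' : `|f u v - f u v'| <= 2 * hnorm u * hnorm (v - v').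
  have anti a b : f a b = - f b a by rewrite /f ripC (ripC _ a); ring.
  by rewrite !(anti u) -opprD normrN lip1.
apply: (dense_vanish cD (lip1 y)) => u Du.
apply: (dense_vanish cD (lip2 u)) => v Dv.
by rewrite /f semigroup_selfadjoint_dom// subrr.
Qed.

Lemma semigroup_right_modulus x (e : R) : 0 < e -> exists2 d, 0 < d &
  forall h, 0 <= h -> h < d -> hnorm (E h x - x) < e.
Proof.
move=> e0; case: cE => -[_ _ _ /(_ x)/hcvgP/(_ _ e0) [d /= d0 hd]] _.
exists d => // h; rewrite le_eqVlt => /predU1P[<- _|h0 hlt].
  by rewrite semigroup_id subrr hnorm0.
by apply: hd => //=; rewrite sub0r normrN gtr0_norm.
Qed.

Lemma semigroup_shift_le s h x : 0 <= s -> 0 <= h ->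
  hnorm (E (s + h) x - E s x) <= hnorm (E h x - x).
Proof.
by move=> s0 h0; rewrite semigroup_add// -semigroupB//; exact: semigroup_contr.
Qed.

Lemma semigroup_path_continuous (t s : R) (x : H) : s < t ->
  {for s, continuous (fun r : R => E (t - r) x)}.
Proof.
move=> st; apply/hcvgP => e e0; have [d d0 hd] := semigroup_right_modulus x e0.
have ts0 : 0 < t - s by rewrite subr_gt0.
near=> r; have rt : r < t by near: r; exact: lt_nbhsl.
have rs : `|r - s| < d.
  by near: r; apply/nbhs_ballP; exists d => //= r; rewrite /ball /= distrC.
have tr0 : 0 <= t - r by rewrite subr_ge0 ltW.
case: (leP r s) => h.
  rewrite (_ : t - r = (t - s) + (s - r)); last by ring.
  apply: le_lt_trans (semigroup_shift_le _ _ _) _; [exact: ltW|by rewrite subr_ge0|].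
  by apply: hd; rewrite ?subr_ge0// -(ger0_norm (_ : 0 <= s - r)) ?subr_ge0// distrC.
rewrite hdistC (_ : t - s = (t - r) + (r - s)); last by ring.
apply: le_lt_trans (semigroup_shift_le _ _ _) _ => //; first by rewrite subr_ge0 ltW.
by apply: hd; rewrite ?subr_ge0 ?(ltW h)// (le_lt_trans (ler_norm _)).
Unshelve. all: by end_near. Qed.

End Semigroup.

(** * The Duhamel formula *)

Section IntervalIntegral.
Context {R : realType}.
Local Notation mu := (@lebesgue_measure R).

Lemma Rint_itv_split (a b c : R) (f : R -> R) : a <= b -> b < c ->
  ae_integrable `]a, c[%classic f ->
  \int[mu]_(t in `]a, c[) f t = \int[mu]_(t in `]a, b[) f t + \int[mu]_(t in `]b, c[) f t.
Proof.
move=> ab bc fi; have mab : measurable (`]a, b]%classic : set R) by exact: measurable_itv.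
have mbc : measurable (`]b, c[%classic : set R) by exact: measurable_itv.
have U : `]a, c[%classic = `]a, b]%classic `|` `]b, c[%classic.
  apply/seteqP; split=> x /=; rewrite !in_itv /=.
    by move=> /andP[ax xc]; case: (leP x b) => xb; [left; rewrite ax|right; rewrite xc].
  move=> [/andP[-> xb]|/andP[bx ->]]; first exact: le_lt_trans bc.
  by rewrite (le_lt_trans ab).
rewrite U Rint_setU// -?U//; last first.
  apply/disj_setPS => x /= []; rewrite !in_itv /= => /andP[_ xb] /andP[bx _].
  by move: (lt_le_trans bx xb); rewrite ltxx.
congr (_ + _); have [g ig fg] := fi.
have ab' : `]a, b]%classic `<=` `]a, c[%classic by rewrite U; exact: subsetUl.
have sub : `]a, b[%classic `<=` `]a, b]%classic.
  by move=> x /=; rewrite !in_itv /= => /andP[-> /ltW].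
have i1 : mu.-integrable `]a, b[ (EFin \o g).
  apply: (@integrableS _ _ _ mu `]a, c[%classic _ _ _ _ _ ig).
  - exact: measurable_itv.
  - exact: measurable_itv.
  - exact: subset_trans ab'.
rewrite (@Rintegral_ae _ _ f g)//; last first.
  by apply: (ae_imp fg) => t h /ab'.
rewrite (@Rintegral_ae _ `]a, b[%classic f g)//; last first.
  by apply: (ae_imp fg) => t h /sub /ab'.
by rewrite Rintegral_itv_bndo_bndc.
Qed.

Lemma mu_itv_oo (a b : R) : a <= b -> mu `]a, b[%classic = (b - a)%:E.
Proof.
rewrite le_eqVlt => /predU1P[->|ab].
  by rewrite set_itvoo0 measure0 subrr.
rewrite lebesgue_measure_itv /= lte_fin ab.
by rewrite EFinB.
Qed.

Lemma ae_integrable_cst (a b k : R) : ae_integrable `]a, b[%classic (fun=> k).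
Proof.
have mI : measurable (`]a, b[%classic : set R) by exact: measurable_itv.
have [|h _] := Rint_indic k mI measurableT.
  rewrite setIT; have [ab|ab] := leP a b; first by rewrite mu_itv_oo// ltry.
  by rewrite set_itv_ge ?measure0// bnd_simp -leNgt ltW.
by apply: ae_integrable_ext h; apply: aeW => t _; rewrite indicT mulr1.
Qed.

Lemma Rint_itv_cst (a b k : R) : a <= b -> \int[mu]_(t in `]a, b[) k = (b - a) * k.
Proof.
move=> ab; transitivity (k * fine (mu `]a, b[%classic)).
  by apply: Rintegral_cst; exact: measurable_itv.
by rewrite mu_itv_oo//= mulrC.
Qed.

Context {H : completeNormedModType R[i]}.

(** Cauchy-Schwarz against the constant 1, which is a real function: H may be
    trivial and contain no unit vector. *)
Lemma sq_vintegrable_itv (D : set R) (a b : R) (f : R -> H) : measurable D ->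
  a <= b -> `]a, b[%classic `<=` D -> sq_integrable D f ->
  vintegrable `]a, b[%classic f /\
  \int[mu]_(t in `]a, b[) hnorm (f t) <= Num.sqrt (b - a) * l2 D f.
Proof.
move=> mD ab abD [mf fi]; have mI : measurable (`]a, b[%classic : set R) by exact: measurable_itv.
have fi' : ae_integrable `]a, b[%classic (fun t => hnorm (f t) ^+ 2).
  exact: ae_integrableS fi.
have vi : vintegrable `]a, b[%classic f.
  apply: (vintegrable_le mI (ae_vmeasS abD mf) (ae_integrableD mI (ae_integrable_cst a b 1) fi')).
  by apply: aeW => t _; have := sqr_ge0 (hnorm (f t) - 1); nra.
split=> //; apply: young_le => [||s s0]; [exact: sqrtr_ge0|exact: l2_ge0|].
rewrite sqr_l2 sqr_sqrtr ?subr_ge0// -Rint_Z//; last by case: vi.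
apply: (@le_trans _ _ (\int[mu]_(t in `]a, b[) (s + s^-1 * hnorm (f t) ^+ 2))).
  apply: Rint_le => //.
  - by apply: ae_integrableZ => //; case: vi.
  - apply: ae_integrableD => //; first exact: ae_integrable_cst.
    exact: ae_integrableZ.
  apply: aeW => t _; rewrite -(ler_pM2l s0) mulrDr (mulrA s s^-1) mulfV ?gt_eqF// mul1r.
  by have := sqr_ge0 (hnorm (f t) - s); nra.
rewrite Rint_D//; [|exact: ae_integrable_cst|exact: ae_integrableZ].
rewrite Rint_itv_cst// mulrC lerD2l Rint_Z// ler_pM2l ?invr_gt0//.
have [k ik fk] := fi.
rewrite -lee_fin -!ge0_Rint_EFin//; try (by move=> t _; exact: sqr_ge0).
rewrite (@integral_ae _ D _ (fun t => `|k t|%:E))//; last first.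
  by apply: (ae_imp fk) => t h /h <-; rewrite ger0_norm// sqr_ge0.
rewrite (@integral_ae _ `]a, b[%classic _ (fun t => `|k t|%:E))//; last first.
  by apply: (ae_imp fk) => t h /abD /h <-; rewrite ger0_norm// sqr_ge0.
apply: ge0_subset_integral => //.
by apply: (measurable_int mu); exact: (integrable_norm ik).
Qed.

End IntervalIntegral.

Section Mild.
Context {R : realType} {H : completeNormedModType R[i]}.
Local Notation mu := (@lebesgue_measure R).
Variables (ip : {dot H for Num.Def.conjC}) (A : operator H) (E : R -> H -> H).
Hypothesis ipH : hilbert_norm ip.
Hypothesis cE : contraction_C0_semigroup E.
Hypothesis gE : generates (opp_operator A) E.
Hypothesis saA : selfadjoint ip A.

Lemma ae_vmeas_semigroup (t : R) (F : R -> H) : ae_vmeas `]0, t[%classic F ->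
  ae_vmeas `]0, t[%classic (fun r => E (t - r) (F r)).
Proof.
move=> [f mf Ff].
pose K (r : R) x : H := if r \in `]-oo, t[%classic then E (t - r) x else 0.
exists (fun r => K r (f r)).
  apply: vmeas_apply => //.
    move=> r; rewrite /K; case: (boolP (r \in `]-oo, t[%classic)) => [|_]; last by move=> x; exact: cvg_cst.
    rewrite inE /= in_itv /= => rt; apply: (semigroup_cont cE).
    by rewrite subr_ge0 ltW.
  move=> x; apply: vmeas_continuous; first exact: lray_open.
  by move=> r /=; rewrite in_itv /= => rt; exact: semigroup_path_continuous.
apply: (ae_imp Ff) => r h Dr; rewrite h// /K ifT// inE /=.
by move: Dr; rewrite /= !in_itv /= => /andP[].
Qed.

Lemma vintegrable_semigroup (t : R) (F : R -> H) : vintegrable `]0, t[%classic F ->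
  vintegrable `]0, t[%classic (fun r => E (t - r) (F r)).
Proof.
move=> [mF Fi]; apply: (vintegrable_le _ (ae_vmeas_semigroup mF) Fi).
  exact: measurable_itv.
apply: aeW => r /=; rewrite in_itv /= => /andP[_ rt].
by apply: (semigroup_contr cE); rewrite subr_ge0 ltW.
Qed.

Lemma semigroup_lip z : op_dom A z -> exists2 d, 0 < d & forall h, 0 <= h -> h < d ->
  hnorm (E h z - z) <= h * (hnorm (A z) + 1).
Proof.
move=> Dz; have [d d0 hd] := semigroup_diff gE Dz ltr01; exists d => // h.
rewrite le_eqVlt => /predU1P[<- _|h0 hlt].
  by rewrite (semigroup_id cE) subrr hnorm0 mul0r.
have := hd h h0 hlt; have := hnorm_add (E h z - z + h%:C *: A z) (- (h%:C *: A z)).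
rewrite addrK hnorm_opp hnormZ gtr0_norm//; lra.
Qed.

Variables (S : \bar R) (V g F : R -> H) (V0 : H).
Hypothesis dV : is_time_derivative S V g.
Hypothesis g2 : sq_integrable (time_itv S) g.
Hypothesis F2 : sq_integrable (time_itv S) F.
Hypothesis eqV : {ae mu, forall t, time_itv S t -> op_dom A (V t) /\ g t + A (V t) = F t}.
Hypothesis V0lim : V t @[t --> 0^'+] --> V0.

Lemma sub_time_itv a b : 0 <= a -> (b%:E <= S)%E -> `]a, b[%classic `<=` time_itv S.
Proof.
move=> a0 bS x /=; rewrite in_itv /= => /andP[ax xb]; split.
  exact: le_lt_trans ax.
by apply: lt_le_trans bS; rewrite lte_fin.
Qed.

Lemma dist_le_Rint s t : 0 < s -> s <= t -> (t%:E < S)%E ->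
  hnorm (V t - V s) <= \int[mu]_(r in `]s, t[) hnorm (g r).
Proof.
move=> s0; rewrite le_eqVlt => /predU1P[->|st] tS.
  by rewrite subrr hnorm0; apply: Rintegral_ge0 => r _; exact: hnorm_ge0.
by apply: (bochner_norm ipH _ (dV s0 st tS)); exact: measurable_itv.
Qed.

(** Pairing with z in the domain of A moves A from V, which lies in the domain
    only almost everywhere, to the smooth path E (t - s) z. The derivative of
    s |-> <V s, E (t - s) z> is <V' + A V, E (t - s) z> = <F, E (t - s) z>, and
    the error over a step of length h is at most h times the integral of
    |F| + |V'| over the step, up to a constant, plus o(h). *)
Lemma weak_duhamel_increment (t : R) (z : H) : (t%:E < S)%E -> op_dom A z ->
  forall a, 0 < a -> a <= t ->
  rip ip (V t) z - \int[mu]_(r in `]0, t[) rip ip (E (t - r) (F r)) z =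
  rip ip (V a) (E (t - a) z) - \int[mu]_(r in `]0, a[) rip ip (E (t - r) (F r)) z.
Proof.
move=> tS Dz a a0 at_; have t0 : 0 < t := lt_le_trans a0 at_.
have mD := measurable_time_itv S.
have mI c b : measurable (`]c, b[%classic : set R) by exact: measurable_itv.
pose fr r := rip ip (E (t - r) (F r)) z.
pose psi s := rip ip (V s) (E (t - s) z) - \int[mu]_(r in `]0, s[) fr r.
have tD : `]0, t[%classic `<=` time_itv S by apply: sub_time_itv => //; exact: ltW.
have Fv : vintegrable `]0, t[%classic F := (sq_vintegrable_itv mD (ltW t0) tD F2).1.
have gv : vintegrable `]0, t[%classic g := (sq_vintegrable_itv mD (ltW t0) tD g2).1.
have fri : ae_integrable `]0, t[%classic fr.
  by apply: ae_integrable_rip => //; exact: vintegrable_semigroup.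
pose w r := hnorm (F r) + hnorm (g r).
have wi : ae_integrable `]0, t[%classic w.
  by apply: ae_integrableD => //; [case: Fv|case: gv].
have sub c b : 0 <= c -> b <= t -> `]c, b[%classic `<=` `]0, t[%classic.
  move=> c0 bt x /=; rewrite !in_itv /= => /andP[cx xb].
  by rewrite (le_lt_trans c0 cx) (lt_le_trans xb bt).
have := hnorm_ge0 (A z); set k := hnorm (A z) => k0.
pose m s := (k + 1) * \int[mu]_(r in `]0, s[) w r.
(* M bounds V on [a, t], and m carries the part of the error that is an integral. *)
pose M := hnorm (V t) + \int[mu]_(r in `]0, t[) hnorm (g r).
have VM s : a <= s -> s <= t -> hnorm (V s) <= M.
  move=> as_ st; have s0 := lt_le_trans a0 as_.
  have := dist_le_Rint s0 st tS; have := hnorm_add (V s - V t) (V t).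
  rewrite subrK hdistC => h1 h2; rewrite /M.
  apply: le_trans h1 _; rewrite addrC lerD2l; apply: le_trans h2 _.
  have [->|st'] := eqVneq s t.
    rewrite set_itvoo0 Rintegral_set0; apply: Rintegral_ge0 => r _; exact: hnorm_ge0.
  have {}st : s < t by rewrite lt_neqAle st'.
  rewrite (@Rint_itv_split _ 0 s t)//; [|exact: ltW|by case: gv].
  by rewrite lerDr; apply: Rintegral_ge0 => r _; exact: hnorm_ge0.
have M0 : 0 <= M by apply: le_trans (VM _ at_ (lexx _)) => //; exact: hnorm_ge0.
suff : psi t = psi a by rewrite /psi subrr (semigroup_id cE).
apply: (@quadratic_modulus_const _ _ m) => // e e0.
have e1 : 0 < e / (M + 1) by rewrite divr_gt0//; lra.
have [d1 d10 hd1] := semigroup_diff gE Dz e1.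
have [d2 d20 hd2] := semigroup_lip Dz.
exists (Num.min d1 d2); first by rewrite lt_min d10.
move=> s r as_ sr rt; set h := r - s; rewrite lt_min => /andP[hd1' hd2'].
have h0 : 0 < h by rewrite /h subr_gt0.
have s0 := lt_le_trans a0 as_.
have tr0 : 0 <= t - r by rewrite subr_ge0.
have r0 : 0 <= r by rewrite ltW// (lt_trans s0).
have rS : (r%:E < S)%E by apply: le_lt_trans tS; rewrite lee_fin.
pose zr := E (t - r) z.
have [Dzr Azr] := semigroup_dom cE gE tr0 Dz; rewrite -/zr in Dzr Azr.
pose r1 := E h z - z + h%:C *: A z.
have r1b : hnorm r1 <= e / (M + 1) * h by apply: hd1.
have zs : E (t - s) z = zr - h%:C *: A zr + E (t - r) r1.
  rewrite /zr Azr -(semigroupZ cE _ _ tr0) -(semigroupB cE _ _ tr0) -(semigroupD cE _ _ tr0).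
  have -> : z - h%:C *: A z + r1 = E h z by rewrite addrC /r1 addrACA subrK subrr addr0.
  by rewrite -(semigroup_add cE)// ?ltW// /h addrA subrK.
have Irs : `]s, r[%classic `<=` `]0, t[%classic by apply: sub => //; exact: ltW.
have gI := vintegrableS (mI _ _) (mI _ _) Irs gv.
have FI := vintegrableS (mI _ _) (mI _ _) Irs Fv.
have frI := ae_integrableS (mI _ _) (mI _ _) Irs fri.
have wI := ae_integrableS (mI _ _) (mI _ _) Irs wi.
have gzI : ae_integrable `]s, r[%classic (fun x => rip ip (g x) zr) by exact: ae_integrable_rip.
pose c := rip ip (V s) (A zr).
pose G x := rip ip (g x) zr + c - fr x.
have cI := @ae_integrable_cst R s r c.
have gcI := ae_integrableD (mI _ _) gzI cI.
have GI : ae_integrable `]s, r[%classic G by exact: ae_integrableB.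
have sub0r_ : `]0, r[%classic `<=` `]0, t[%classic by exact: sub.
have incr : psi r - psi s =
    \int[mu]_(x in `]s, r[) G x - rip ip (V s) (E (t - r) r1).
  rewrite /psi zs -/zr ripDr ripBr ripZr -/c /G Rint_B// Rint_D// Rint_itv_cst ?ltW// -/h.
  rewrite (@Rint_itv_split _ 0 s r)//; [|exact: ltW|exact: ae_integrableS fri].
  have [_ /(_ zr) <-] := bochner_weak ipH (mI _ _) (dV s0 sr rS).
  rewrite ripBl; ring.
pose kw := (k + 1) * h.
have Gb : `|\int[mu]_(x in `]s, r[) G x| <= kw * \int[mu]_(x in `]s, r[) w x.
  apply: le_trans (Rint_norm (mI _ _) GI) _.
  pose W := \int[mu]_(x in `]s, r[) hnorm (g x).
  have W0 : 0 <= W by apply: Rintegral_ge0 => x _; exact: hnorm_ge0.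
  have FnI : ae_integrable `]s, r[%classic (fun x => kw * hnorm (F x)).
    by apply: ae_integrableZ => //; case: FI.
  have kI := @ae_integrable_cst R s r (k * W).
  apply: (@le_trans _ _ (\int[mu]_(x in `]s, r[) (kw * hnorm (F x) + k * W))).
    apply: Rint_le => //; [exact: ae_integrable_norm|exact: ae_integrableD|].
    apply: (ae_imp eqV) => x hx; rewrite /= in_itv /= => /andP[sx xr].
    have Dx : time_itv S x.
      split; first exact: lt_trans sx.
      by apply: lt_trans rS; rewrite lte_fin.
    have [DVx eVx] := hx Dx.
    have gx : g x = F x - A (V x) by rewrite -eVx addrK.
    have tx0 : 0 <= t - x by rewrite subr_ge0 ltW// (lt_le_trans xr).
    have Gx : G x = rip ip (F x) (zr - E (t - x) z) + rip ip (V s - V x) (A zr).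
      rewrite /G gx /fr (semigroup_selfadjoint ipH cE gE saA)// ripBl ripBr ripBl -/c.
      by rewrite (selfadjoint_rip saA DVx Dzr); ring.
    rewrite Gx; apply: le_trans (ler_normD _ _) _; apply: lerD.
      apply: le_trans (normr_rip ipH _ _) _; rewrite mulrC; apply: ler_wpM2r.
        exact: hnorm_ge0.
      have rx0 : 0 <= r - x by rewrite subr_ge0 ltW.
      rewrite hdistC (_ : t - x = (t - r) + (r - x)); last by ring.
      apply: le_trans (semigroup_shift_le cE _ tr0 rx0) _.
      have rxh : r - x <= h by rewrite /h lerD2l lerN2 ltW.
      apply: le_trans (hd2 _ rx0 (le_lt_trans rxh hd2')) _.
      by rewrite /kw mulrC; apply: ler_wpM2l => //; lra.
    apply: le_trans (normr_rip ipH _ _) _; rewrite mulrC.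
    apply: ler_pM; rewrite ?hnorm_ge0//.
      by rewrite Azr; exact: (semigroup_contr cE).
    have xS : (x%:E < S)%E by case: Dx.
    rewrite hdistC; apply: le_trans (dist_le_Rint s0 (ltW sx) xS) _.
    rewrite /W (@Rint_itv_split _ s x r)//; [|exact: ltW|by case: gI].
    by rewrite lerDl; apply: Rintegral_ge0 => y _; exact: hnorm_ge0.
  rewrite Rint_D// Rint_Z//; last by case: FI.
  rewrite (Rint_itv_cst _ (ltW sr)) /w Rint_D//; [|by case: FI|by case: gI].
  rewrite -/W -/h mulrDr lerD2l /kw.
  rewrite (_ : (k + 1) * h * W = h * (k * W) + h * W); last by ring.
  by rewrite lerDl mulr_ge0// ltW.
have mrs : m r - m s = (k + 1) * \int[mu]_(x in `]s, r[) w x.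
  rewrite /m (@Rint_itv_split _ 0 s r)//; [|exact: ltW|exact: ae_integrableS wi].
  by ring.
have Rb : `|rip ip (V s) (E (t - r) r1)| <= e * h.
  apply: le_trans (normr_rip ipH _ _) _.
  have b1 : hnorm (V s) <= M by apply: VM; rewrite // (le_trans (ltW sr)).
  have b2 := le_trans (semigroup_contr cE r1 tr0) r1b.
  apply: le_trans (ler_pM (hnorm_ge0 _) (hnorm_ge0 _) b1 b2) _.
  have M1 : M + 1 != 0 by rewrite gt_eqF// ltr_wpDl.
  have -> : e * h = e / (M + 1) * h * (M + 1) by rewrite mulrAC divfK.
  rewrite mulrC; apply: ler_wpM2l; first by rewrite mulr_ge0// ltW.
  by rewrite lerDl.
rewrite incr mrs; apply: le_trans (ler_normB _ _) _.
rewrite addrC; apply: lerD; first exact: Rb.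
by rewrite mulrA (mulrC h).
Qed.

(** Let a tend to 0 in the preceding identity. *)
Lemma weak_duhamel (t : R) (z : H) : 0 < t -> (t%:E < S)%E -> op_dom A z ->
  rip ip (V t) z - \int[mu]_(r in `]0, t[) rip ip (E (t - r) (F r)) z =
  rip ip (E t V0) z.
Proof.
move=> t0 tS Dz; have mD := measurable_time_itv S.
apply/eqP; rewrite -subr_eq0 -normr_le0; apply/ler_addgt0Pr => e e0; rewrite add0r.
pose K := hnorm z + hnorm V0 + hnorm z * l2 (time_itv S) F + 1.
have [z0 v0] := (hnorm_ge0 z, hnorm_ge0 V0).
have f0 := l2_ge0 (time_itv S) F.
have zf : 0 <= hnorm z * l2 (time_itv S) F by rewrite mulr_ge0.
have K0 : 0 < K by rewrite /K; lra.
pose d := e / K; have d0 : 0 < d by rewrite divr_gt0.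
have [d1 d10 hd1] := semigroup_right_modulus cE z d0.
move/hcvgP: V0lim => /(_ _ d0)[d2 /= d20 hd2].
pose a := Num.min (Num.min t (d ^+ 2)) (Num.min d1 d2) / 2.
have mn0 : 0 < Num.min (Num.min t (d ^+ 2)) (Num.min d1 d2).
  by rewrite !lt_min t0 d10 d20 exprn_gt0.
have a0 : 0 < a by rewrite divr_gt0.
have : a < Num.min (Num.min t (d ^+ 2)) (Num.min d1 d2) by rewrite /a; lra.
rewrite !lt_min => /andP[/andP[at_ ad] /andP[ad1 ad2]].
rewrite (weak_duhamel_increment tS Dz a0 (ltW at_)).
have Va : hnorm (V a - V0) < d.
  by apply: hd2 => //=; rewrite sub0r normrN gtr0_norm.
have Ea : hnorm (E a z - z) < d by apply: hd1 => //; exact: ltW.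
have ta0 : 0 <= t - a by rewrite subr_ge0 ltW.
have aD : `]0, a[%classic `<=` time_itv S.
  by apply: sub_time_itv => //; apply: ltW; apply: lt_trans tS; rewrite lte_fin.
have tD : `]0, t[%classic `<=` time_itv S by apply: sub_time_itv => //; exact: ltW.
have [Fv Fb] := sq_vintegrable_itv mD (ltW a0) aD F2; rewrite subr0 in Fb.
have [Ft _] := sq_vintegrable_itv mD (ltW t0) tD F2.
have mI c b : measurable (`]c, b[%classic : set R) by exact: measurable_itv.
have sub : `]0, a[%classic `<=` `]0, t[%classic.
  by move=> x /=; rewrite !in_itv /= => /andP[-> /lt_trans]; apply.
have vE := vintegrableS (mI _ _) (mI _ _) sub (vintegrable_semigroup Ft).
have dd : Num.sqrt (d ^+ 2) = d by rewrite sqrtr_sqr ger0_norm// ltW.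
have sa : Num.sqrt a <= d by rewrite -[leRHS]dd ler_wsqrtr// ltW.
have Ib : `|\int[mu]_(r in `]0, a[) rip ip (E (t - r) (F r)) z| <=
    d * (hnorm z * l2 (time_itv S) F).
  apply: le_trans (Rint_rip_le z ipH (mI _ _) vE) _; rewrite mulrCA ler_wpM2l//.
  apply: le_trans (ler_wpM2r f0 sa); apply: le_trans Fb.
  apply: Rint_le => //; [by case: vE|by case: Fv|].
  apply: aeW => r /sub /=; rewrite in_itv /= => /andP[_ rt].
  by apply: (semigroup_contr cE); rewrite subr_ge0 ltW.
have Ab : `|rip ip (V a) (E (t - a) z) - rip ip (E t V0) z| <= d * (hnorm z + hnorm V0).
  rewrite (semigroup_selfadjoint ipH cE gE saA V0 z (ltW t0)).
  rewrite (_ : _ - _ = rip ip (V a - V0) (E (t - a) z) + rip ip V0 (E (t - a) z - E t z)); last first.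
    by rewrite ripBl ripBr; ring.
  apply: le_trans (ler_normD _ _) _; rewrite mulrDr; apply: lerD.
    apply: le_trans (normr_rip ipH _ _) _; apply: ler_pM.
    - exact: hnorm_ge0.
    - exact: hnorm_ge0.
    - exact: ltW.
    - exact: (semigroup_contr cE).
  apply: le_trans (normr_rip ipH _ _) _; rewrite mulrC ler_wpM2r//.
  have := semigroup_shift_le cE z ta0 (ltW a0); rewrite subrK hdistC => h.
  exact: le_trans h (ltW Ea).
have -> : e = d * K by rewrite /d divfK// gt_eqF.
set I := Rintegral _ _ _ in Ib *; set b := rip ip (E t V0) z in Ab *.
rewrite (_ : _ - I - b = (rip ip (V a) (E (t - a) z) - b) - I); last by ring.
apply: le_trans (ler_normB _ _) _; rewrite /K; apply: le_trans (lerD Ab Ib) _.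
lra.
Qed.

(** The weak identity tested on the dense domain of A; the bound follows from
    contractivity and Cauchy-Schwarz. *)
Lemma duhamel (t : R) : time_itv S t -> exists I : H,
  [/\ is_bochner_integral `]0, t[%classic (fun r => E (t - r) (F r)) I,
      V t = E t V0 + I &
      hnorm (V t) <= hnorm V0 + Num.sqrt t * l2 (time_itv S) F].
Proof.
move=> [t0 tS]; have mD := measurable_time_itv S.
have mI : measurable (`]0, t[%classic : set R) by exact: measurable_itv.
have tD : `]0, t[%classic `<=` time_itv S by apply: sub_time_itv => //; exact: ltW.
have [Fv Fb] := sq_vintegrable_itv mD (ltW t0) tD F2; rewrite subr0 in Fb.
have Ev := vintegrable_semigroup Fv.
have [I hI] := vintegrable_bochner ipH mI Ev; exists I.
have VE : V t = E t V0 + I.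
  have [_ cD _] := saA.
  apply: (rip_dense_eq ipH cD) => z Dz; rewrite ripDl -(weak_duhamel t0 tS Dz).
  by rewrite (bochner_weak ipH mI hI).2 subrK.
split=> //; rewrite VE; apply: le_trans (hnorm_add _ _) _; apply: lerD.
  exact: (semigroup_contr cE _ (ltW t0)).
apply: le_trans Fb; apply: le_trans (bochner_norm ipH mI hI) _.
apply: Rint_le => //; [by case: Ev|by case: Fv|].
apply: aeW => r /=; rewrite in_itv /= => /andP[_ rt].
by apply: (semigroup_contr cE); rewrite subr_ge0 ltW.
Qed.

End Mild.

(** * Completeness of the space of square-integrable functions *)

Section RieszFischer.
Context {R : realType} {H : completeNormedModType R[i]}.
Local Notation mu := (@lebesgue_measure R).

(** The sum of the h n is integrable, and dominates each of them. *)
Lemma series_dominated (D : set R) (h : nat -> R -> R) (c : R) : measurable D ->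
  (forall n, measurable_fun [set: R] (h n)) -> (forall n t, 0 <= h n t) ->
  (forall n, ae_integrable D (h n)) ->
  (forall n, \int[mu]_(t in D) h n t <= c * (2^-1) ^+ n) ->
  exists2 w, ae_integrable D w & {ae mu, forall t, D t -> forall n, h n t <= w t}.
Proof.
move=> mD mh h0 hi hc.
pose W (t : R) : \bar R := (\sum_(0 <= n <oo) (h n t)%:E)%E.
have hE0 n t : (0 <= (h n t)%:E)%E by rewrite lee_fin.
have mhE n : measurable_fun D (fun t => (h n t)%:E).
  by apply/measurable_EFinP; exact: measurable_funTS.
have mW : measurable_fun D W.
  by apply: (@ge0_emeasurable_sum _ _ _ _ (fun n t => (h n t)%:E) xpredT) => // n t _ _; exact: hE0.
have c0 : 0 <= c.
  have := hc 0%N; rewrite expr0 mulr1; apply: le_trans.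
  by apply: Rintegral_ge0 => t _.
have WI : (\int[mu]_(t in D) W t < +oo)%E.
  rewrite integral_nneseries//.
  apply: (@le_lt_trans _ _ (\sum_(0 <= n <oo) (c * (2^-1) ^+ n)%:E)%E).
    apply: lee_nneseries => [n *|n *]; first by apply: integral_ge0 => t _; exact: hE0.
    by rewrite ge0_Rint_EFin// lee_fin.
  have hg : `|2^-1 : R| < 1 by rewrite ger0_norm ?invr_ge0//; lra.
  have := cvg_geometric_series (a := c) hg.
  set l := c * _ => cl.
  rewrite (_ : (\sum_(0 <= n <oo) _)%E = l%:E) ?ltry//.
  apply/cvg_lim => //.
  rewrite (_ : (fun n => _) = EFin \o series (geometric c (2^-1))).
    by apply: cvg_EFin => //; exact: nearW.
  by apply/funext => n /=; rewrite /series /= -sumEFin.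
have W0 t : (0 <= W t)%E by apply: nneseries_ge0 => n _ _; exact: hE0.
have iW : mu.-integrable D W.
  apply/integrableP; split=> //.
  apply: le_lt_trans WI; rewrite le_eqVlt; apply/orP; left; apply/eqP.
  by apply: eq_integral => t _; rewrite gee0_abs.
have Wfin := @integrable_ae _ _ _ mu D mD _ iW.
exists (fun t => fine (W t)).
  exists (fun t => fine (W t)); last exact: aeW.
  apply/integrableP; split.
    by apply/measurable_EFinP; apply: measurableT_comp => //; exact: measurable_fine.
  apply: le_lt_trans WI; rewrite le_eqVlt; apply/orP; left; apply/eqP.
  apply: integral_ae => //; apply: (ae_imp Wfin) => t Wt Dt /=.
  by rewrite ger0_norm ?fine_ge0// fineK// Wt.
apply: (ae_imp Wfin) => t Wt Dt n; rewrite -lee_fin fineK ?Wt//.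
apply: le_trans (nneseries_lim_ge n.+1 _) => //.
by rewrite big_nat_recr//= leeDr// sume_ge0.
Qed.

Lemma geometric_cauchy (u : nat -> H) (K r : R) : 0 <= K -> 0 < r < 1 ->
  (forall n, hnorm (u n.+1 - u n) <= K * r ^+ n) ->
  exists2 l : H, u n @[n --> \oo] --> l &
    forall n, hnorm (l - u n) <= K * r ^+ n / (1 - r).
Proof.
move=> K0 /andP[r0 r1] hu; have p : 0 < 1 - r by lra.
have dist n k : hnorm (u (n + k)%N - u n) <= K * r ^+ n * (1 - r ^+ k) / (1 - r).
  elim: k => [|k IH]; first by rewrite addn0 subrr hnorm0 expr0 subrr mulr0 mul0r.
  apply: le_trans (hnorm_tri _ (u (n + k)%N) _) _; rewrite addnS.
  apply: le_trans (lerD (hu _) IH) _.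
  rewrite exprD exprS -[X in X + _](mulfK (lt0r_neq0 p)) -mulrDl.
  by apply: ler_wpM2r; [rewrite invr_ge0 ltW|lra].
have distn n m : (n <= m)%N -> hnorm (u m - u n) <= K * r ^+ n / (1 - r).
  move=> /subnKC <-; apply: le_trans (dist _ _) _; apply: ler_wpM2r.
    by rewrite invr_ge0 ltW.
  rewrite -[leRHS]mulr1; apply: ler_wpM2l; first by rewrite mulr_ge0// exprn_ge0// ltW.
  by rewrite gerBl exprn_ge0// ltW.
have tend : K * r ^+ n / (1 - r) @[n --> \oo] --> (0 : R).
  rewrite (_ : (fun n => _) = geometric (K / (1 - r)) r).
    by apply: cvg_geometric; rewrite ger0_norm// ltW.
  by apply/funext => n /=; rewrite mulrAC.
have [|l ul] := @hcauchy _ _ u.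
  move=> e e0; move/cvgrPdist_lt: tend => /(_ _ e0)[N _ /(_ N (leqnn N))].
  rewrite /= sub0r normrN => /(le_lt_trans (ler_norm _)) hN; exists N => n Nn.
  by rewrite hdistC; apply: le_lt_trans (distn _ _ Nn) hN.
exists l => // n; apply/ler_addgt0Pr => e e0; move/hcvgP: ul => /(_ _ e0)[N _ hN].
have := hN _ (leq_maxl N n); have := distn _ _ (leq_maxr N n).
set m := maxn N n => h1; rewrite /= hdistC => h2.
by have := hnorm_tri l (u m) (u n); lra.
Qed.

(** The integrals of 2^n |F (n+1) - F n|^2 are summable, so these functions have
    a common integrable bound w. At almost every t the increments are then at
    most sqrt(w t) rho^n with rho^2 = 1/2, which gives pointwise convergence,
    and the tails are controlled by w, which gives convergence in norm. *)
Lemma l2_complete (D : set R) (F : nat -> R -> H) (a : R) : measurable D ->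
  (forall n, sq_integrable D (F n)) ->
  (forall n, l2 D (fun t => F n.+1 t - F n t) <= a * (2^-1) ^+ n) ->
  exists2 G, sq_integrable D G & l2 D (fun t => G t - F n t) @[n --> \oo] --> (0 : R).
Proof.
move=> mD Fi Fa.
have /choice[f hf] : forall n, exists f, vmeas f /\ {ae mu, forall t, D t -> F n t = f t}.
  by move=> n; case: (Fi n) => -[f mf Ff] _; exists f.
have mf n : vmeas (f n) by case: (hf n).
have Ff : {ae mu, forall t, forall n, D t -> F n t = f n t}.
  by apply: ae_forall_nat => n; case: (hf n).
have di n := sq_integrableB mD (Fi n.+1) (Fi n).
pose h n t := 2 ^+ n * hnorm (f n.+1 t - f n t) ^+ 2.
have FfB n : {ae mu, forall t, D t -> 2 ^+ n * hnorm (F n.+1 t - F n t) ^+ 2 = h n t}.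
  by apply: (ae_imp Ff) => t e Dt; rewrite /h !e.
have [||||w wi hw] := @series_dominated D h (a ^+ 2) mD.
- move=> n; apply: measurable_funM => //; apply: measurable_funX; apply: vmeas_hnorm.
  exact: vmeasB.
- by move=> n t; rewrite mulr_ge0// ?sqr_ge0// exprn_ge0.
- move=> n; apply: ae_integrable_ext (FfB n) _; apply: ae_integrableZ => //.
  by case: (di n).
- move=> n; rewrite -(Rintegral_ae mD (FfB n)) Rint_Z//; last by case: (di n).
  rewrite -sqr_l2; have := Fa n; have := l2_ge0 D (fun t => F n.+1 t - F n t).
  set x := l2 _ _ => x0 xa.
  have : x ^+ 2 <= (a * 2^-1 ^+ n) ^+ 2 by rewrite ler_sqr ?nnegrE//; apply: le_trans xa.
  have p : 0 < (2 : R) ^+ n by exact: exprn_gt0.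
  rewrite -(ler_pM2l p) => /le_trans; apply.
  have : (2 : R) ^+ n * 2^-1 ^+ n = 1 by rewrite -exprMn mulfV ?expr1n.
  set y := 2^-1 ^+ n; set z := 2 ^+ n => yz.
  have -> : z * (a * y) ^+ 2 = a ^+ 2 * y * (z * y) by ring.
  by rewrite yz mulr1.
pose rho : R := Num.sqrt 2^-1.
have rho2 : rho ^+ 2 = 2^-1 by rewrite sqr_sqrtr// invr_ge0.
have rho0 : 0 < rho by rewrite sqrtr_gt0 invr_gt0.
have rho1 : rho < 1 by rewrite -[ltRHS]sqrtr1 ltr_sqrt//; lra.
have p1 : 0 < 1 - rho by lra.
have {hw} [N [mN N0 hwN]] := hw.
have hw t : (D `\` N) t -> forall n, h n t <= w t.
  move=> [Dt Nt]; apply: contrapT => h1; apply: Nt; apply: hwN => /= h2.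
  by apply: h1; exact: h2.
have lim t : (D `\` N) t -> exists2 l : H, f n t @[n --> \oo] --> l &
    forall n, hnorm (l - f n t) <= Num.sqrt (w t) * rho ^+ n / (1 - rho).
  move=> Dt; apply: (@geometric_cauchy (f ^~ t)); first exact: sqrtr_ge0.
    by rewrite rho0.
  move=> n; have w0 : 0 <= w t.
    by apply: le_trans (hw t Dt 0%N); rewrite /h mulr_ge0// ?sqr_ge0.
  rewrite -(ler_sqr (hnorm_ge0 _)) ?nnegrE ?mulr_ge0 ?sqrtr_ge0 ?exprn_ge0 ?(ltW rho0)//.
  rewrite exprMn sqr_sqrtr// -exprM mulnC exprM rho2 exprVn ler_pdivlMr ?exprn_gt0// mulrC.
  exact: hw.
have /choice[G hG] : forall t, exists l : H, (if t \in D `\` N then f n t else 0) @[n --> \oo] --> l /\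
    ((D `\` N) t -> forall n, hnorm (l - f n t) <= Num.sqrt (w t) * rho ^+ n / (1 - rho)).
  move=> t; case: (boolP (t \in D `\` N)) => [/[!inE] Dt|/negP nD].
    by have [l hl hb] := lim t Dt; exists l.
  exists 0; split; first exact: cvg_cst.
  by move=> Dt; exfalso; apply: nD; rewrite inE.
have mG : vmeas G.
  apply: (@vmeas_cvg _ _ (fun n t => if t \in D `\` N then f n t else 0)).
    by move=> n; apply: vmeas_restrict => //; exact: measurableD.
  by move=> t; case: (hG t).
have aeN : {ae mu, forall t, D t -> (D `\` N) t}.
  exists N; split=> // t /= ht; apply: contrapT => Nt; apply: ht => Dt.
  by split.
pose C n := (2^-1) ^+ n / (1 - rho) ^+ 2.
have C0 n : 0 <= C n by rewrite divr_ge0 ?sqr_ge0// exprn_ge0// invr_ge0.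
have bound n : {ae mu, forall t, D t -> hnorm (G t - F n t) ^+ 2 <= C n * w t}.
  apply: (ae_imp2 aeN Ff) => t Dt e D_t; rewrite e//; have {}Dt := Dt D_t.
  have w0 : 0 <= w t.
    by apply: le_trans (hw t Dt 0%N); rewrite /h mulr_ge0// ?sqr_ge0.
  have := (hG t).2 Dt n; rewrite -ler_sqr ?nnegrE ?hnorm_ge0//; last first.
    by apply: le_trans ((hG t).2 Dt n); exact: hnorm_ge0.
  move=> /le_trans; apply; rewrite !exprMn sqr_sqrtr// -exprM mulnC exprM rho2 /C.
  by rewrite le_eqVlt; apply/orP; left; apply/eqP; rewrite -(exprVn (1 - rho)); ring.
have mGF n : ae_vmeas D (fun t => G t - F n t).
  by apply: ae_vmeasB; [exists G; [|exact: aeW]|case: (Fi n)].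
have GFi n : sq_integrable D (fun t => G t - F n t).
  by apply: (sq_integrable_le mD (mGF n) (ae_integrableZ (C n) mD wi)); exact: bound.
exists G.
  apply: sq_integrable_ext (sq_integrableD mD (GFi 0%N) (Fi 0%N)).
  by apply: aeW => t _; rewrite subrK.
pose kap := (\int[mu]_(t in D) w t) / (1 - rho) ^+ 2.
have up n : l2 D (fun t => G t - F n t) <= Num.sqrt kap * rho ^+ n.
  rewrite /l2 (_ : Num.sqrt kap * rho ^+ n = Num.sqrt (C n * \int[mu]_(t in D) w t)).
    apply: ler_wsqrtr; rewrite -Rint_Z//; apply: Rint_le => //.
    - by case: (GFi n).
    - exact: ae_integrableZ.
  rewrite (_ : C n * _ = kap * (rho ^+ n) ^+ 2); last first.
    by rewrite -exprM mulnC exprM rho2 /C /kap mulrC mulrA mulrAC.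
  move: (kap) => k; rewrite [in RHS]mulrC sqrtrM ?sqr_ge0// sqrtr_sqr ger0_norm 1?mulrC//.
  by rewrite exprn_ge0// ltW.
have tend : Num.sqrt kap * rho ^+ n @[n --> \oo] --> (0 : R).
  by apply: cvg_geometric; rewrite ger0_norm// ltW.
apply/cvgrPdist_lt => e e0; move/cvgrPdist_lt: tend => /(_ _ e0); apply: filterS => n.
rewrite !sub0r !normrN (ger0_norm (l2_ge0 _ _)) => /(le_lt_trans (ler_norm _)).
exact: le_lt_trans.
Qed.

End RieszFischer.

(** * Measurability of the perturbation along a function *)

Section OperatorMeasurability.
Context {R : realType} {H : completeNormedModType R[i]}.
Local Notation mu := (@lebesgue_measure R).
Implicit Types (A : operator H) (S : \bar R).

Lemma operatorB A x y : linear_operator A -> op_dom A x -> op_dom A y ->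
  op_dom A (x - y) /\ A (x - y) = A x - A y.
Proof.
move=> [_ lA] Dx Dy; have [D e] := lA (-1) y x Dy Dx.
by move: D e; rewrite !scaleN1r !(addrC (- _)).
Qed.

Lemma operator0 A : linear_operator A -> A 0 = 0.
Proof.
move=> lA; have [D0 _] := lA; have [_] := operatorB lA D0 D0.
by rewrite !subrr.
Qed.

Lemma ae_vmeas_continuous S (V : R -> H) :
  (forall t, time_itv S t -> {for t, continuous V}) -> ae_vmeas (time_itv S) V.
Proof.
move=> cV; exists (fun t => if t \in time_itv S then V t else 0).
  by apply: vmeas_continuous => //; exact: open_time_itv.
by apply: aeW => t Dt; rewrite mem_set.
Qed.

Lemma near_inf_graph A (x y : H) (d : R) : op_dom A 0 -> 0 < d ->
  exists2 z, op_dom A z & forall z', op_dom A z' ->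
    hnorm (z - x) + hnorm (A z - y) <= hnorm (z' - x) + hnorm (A z' - y) + d.
Proof.
move=> D0 d0; pose X := [set hnorm (z - x) + hnorm (A z - y) | z in op_dom A].
have X0 : X !=set0 by exists (hnorm (0 - x) + hnorm (A 0 - y)), 0.
have Xl : lbound X 0 by move=> _ [z _ <-]; rewrite addr_ge0 ?hnorm_ge0.
have hX : has_inf X by split=> //; exists 0.
have [_ [z Dz <-] hz] := inf_adherent d0 hX.
exists z => // z' Dz'; apply: le_trans (ltW hz) _; rewrite lerD2r.
by apply: ge_inf; [exists 0|exists z'].
Qed.

(** Approximate the pair (V, A V) by countably-valued functions and replace their
    values by nearly closest points (z, A z) of the graph of A. The resulting
    z_n are countably-valued in the domain of A and converge almost everywhere
    to V in the graph norm. Then B t (z_n t) is glued from the continuous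
    functions B t z, and tends to B t (V t) by relative boundedness. *)
Lemma ae_vmeas_operator A (B : R -> operator H) S (C1 C2 : R) (V : R -> H) :
  linear_operator A -> 0 <= C1 -> 0 <= C2 ->
  (forall t, time_itv S t -> linear_operator (B t) /\ op_dom A `<=` op_dom (B t)) ->
  (forall t z, time_itv S t -> op_dom A z ->
     hnorm (B t z) <= C1 * hnorm (A z) + C2 * hnorm z) ->
  (forall z, op_dom A z -> forall t, time_itv S t -> {for t, continuous (fun s => B s z)}) ->
  ae_vmeas (time_itv S) V -> ae_vmeas (time_itv S) (fun t => A (V t)) ->
  {ae mu, forall t, time_itv S t -> op_dom A (V t)} ->
  ae_vmeas (time_itv S) (fun t => B t (V t)).
Proof.
move=> lA C10 C20 lB bB cB [v mv Vv] [a ma AVa] DV.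
have mD := measurable_time_itv S; set D := time_itv S in mD *.
have D0 : op_dom A 0 by case: lA.
have [N [mN N0 hN]] : {ae mu, forall t, D t -> [/\ V t = v t, A (V t) = a t & op_dom A (V t)]}.
  by apply: (ae_imp3 Vv AVa DV) => t h1 h2 h3 Dt; split; [exact: h1|exact: h2|exact: h3].
pose D' := D `\` N; have mD' : measurable D' by exact: measurableD.
have good t : D' t -> [/\ V t = v t, A (V t) = a t & op_dom A (V t)].
  move=> [Dt Nt]; apply: contrapT => h; apply: Nt; apply: hN => /= h2.
  by apply: h; exact: h2.
have /choice[c hc] : forall n : nat, exists ck : (nat -> H) * (R -> nat),
    index_measurable ck.2 /\ forall t, hnorm (v t - ck.1 (ck.2 t)) < n.+1%:R^-1.
  move=> n; have [|c [l h]] := mv n.+1%:R^-1; last by exists (c, l).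
  by rewrite invr_gt0.
have /choice[d hd] : forall n : nat, exists ck : (nat -> H) * (R -> nat),
    index_measurable ck.2 /\ forall t, hnorm (a t - ck.1 (ck.2 t)) < n.+1%:R^-1.
  move=> n; have [|d [l h]] := ma n.+1%:R^-1; last by exists (d, l).
  by rewrite invr_gt0.
have /choice[zz hzz] : forall nxy : nat * (H * H), exists z, op_dom A z /\ forall z', op_dom A z' ->
    hnorm (z - nxy.2.1) + hnorm (A z - nxy.2.2) <=
    hnorm (z' - nxy.2.1) + hnorm (A z' - nxy.2.2) + nxy.1.+1%:R^-1.
  move=> [n [x y]] /=; have [|z Dz hz] := @near_inf_graph A x y n.+1%:R^-1 D0.
    by rewrite invr_gt0.
  by exists z.
pose Z n t := zz (n, ((c n).1 ((c n).2 t), (d n).1 ((d n).2 t))).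
have DZ n t : op_dom A (Z n t) by case: (hzz (n, ((c n).1 ((c n).2 t), (d n).1 ((d n).2 t)))).
(* The approximations of V and A V contribute 1/(n+1) each, twice, and the choice of Z once. *)
have Zb n t : D' t -> hnorm (Z n t - V t) + hnorm (A (Z n t) - A (V t)) <= 5 * n.+1%:R^-1.
  move=> /good[Vt At Dt]; have [_ /(_ _ Dt)] := hzz (n, ((c n).1 ((c n).2 t), (d n).1 ((d n).2 t))).
  rewrite /= -/(Z n t); set x := (c n).1 _; set y := (d n).1 _.
  have [_ /(_ t)] := hc n; have [_ /(_ t)] := hd n; rewrite -/x -/y -Vt -At.
  have := hnorm_tri (Z n t) x (V t); have := hnorm_tri (A (Z n t)) y (A (V t)).
  rewrite (hdistC x) (hdistC y); move: (n.+1%:R^-1 : R) => q; lra.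
exists (fun t => if t \in D' then B t (V t) else 0); last first.
  exists N; split=> // t /= ht; apply: contrapT => Nt; apply: ht => Dt.
  by rewrite mem_set.
have := @vmeas_cvg _ _ (fun n (t : R) => if t \in D' then B t (Z n t) else 0)
  (fun t => if t \in D' then B t (V t) else 0); apply.
  move=> n; have [[mc _] [md _]] := (hc n, hd n).
  pose G m t := let xy := odflt (0, 0) (unpickle m : option (nat * nat)) in
    let z := zz (n, ((c n).1 xy.1, (d n).1 xy.2)) in
    if t \in D' then (if t \in D then B t z else 0) else 0.
  have mG m : vmeas (G m).
    apply: vmeas_restrict => //; apply: vmeas_continuous; first exact: open_time_itv.
    by apply: cB; case: (hzz (n, ((c n).1 (odflt (0, 0) (unpickle m : option (nat * nat))).1,
         (d n).1 (odflt (0, 0) (unpickle m : option (nat * nat))).2))).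
  have mk := index_measurable_pair mc (fun _ => md).
  apply: vmeas_ext (vmeas_glue mk mG) => t; rewrite /G pickleK /=.
  by case: ifPn => // /[!inE] -[Dt _]; rewrite mem_set.
move=> t; case: ifPn => [/[!inE] D't|_]; last exact: cvg_cst.
have [Dt _] := D't; have [lBt sB] := lB t Dt; have [_ _ DVt] := good t D't.
apply/hcvgP => e e0.
have p : 0 < 5 * (C1 + C2) + 1 by lra.
have := near_infty_natSinv_lt (PosNum (divr_gt0 e0 p)); apply: filterS => n /=.
rewrite ltr_pdivlMr// => hn.
have [_ <-] := operatorB lBt (sB _ (DZ n t)) (sB _ DVt).
have [Dd Ad] := operatorB lA (DZ n t) DVt.
apply: le_lt_trans (bB _ _ Dt Dd) _; rewrite Ad.
have := Zb n t D't; have := hnorm_ge0 (Z n t - V t); have := hnorm_ge0 (A (Z n t) - A (V t)).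
move: hn; set u := hnorm _; set w := hnorm _; set q := _^-1 => hn u0 w0 uw.
have h1 : C1 * u <= C1 * (5 * q) by apply: ler_wpM2l => //; lra.
have h2 : C2 * w <= C2 * (5 * q) by apply: ler_wpM2l => //; lra.
have q0 : 0 < q by rewrite invr_gt0.
nra.
Qed.

End OperatorMeasurability.

(** * Strong solutions and maximal regularity *)

Section Solves.
Context {R : realType} {H : completeNormedModType R[i]}.
Local Notation mu := (@lebesgue_measure R).
Variables (ip : {dot H for Num.Def.conjC}) (A : operator H) (S : \bar R).
Hypothesis ipH : hilbert_norm ip.
Local Notation D := (time_itv S).

(** A strong solution with an explicit representative g of its derivative, the
    equation stated almost everywhere, and the weighted supremum bounded by a
    real number. In this form solutions can be subtracted, while
    time_derivative is a choice that need not respect differences. *)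
Record solves (N : R -> operator H) (F : R -> H) (v0 : H) (v g : R -> H) : Prop := Solves {
  solves_cont : forall t, D t -> {for t, continuous v} ;
  solves_deriv : is_time_derivative S v g ;
  solves_deriv_sq : sq_integrable D g ;
  solves_dom : {ae mu, forall t, D t -> op_dom A (v t)} ;
  solves_op_sq : sq_integrable D (fun t => A (v t)) ;
  solves_eq : {ae mu, forall t, D t -> g t + N t (v t) = F t} ;
  solves_init : v t @[t --> 0^'+] --> v0 ;
  solves_bound : exists M : R, forall t, D t -> expR (- t) * hnorm (v t) <= M }.

Lemma time_derivative_spec (v g : R -> H) : is_time_derivative S v g ->
  is_time_derivative S v (time_derivative S v).
Proof. by move=> h; rewrite /time_derivative; apply: (@xgetPex _ _ (is_time_derivative S v)); exists g. Qed.

Lemma time_derivative_ae (v g : R -> H) : is_time_derivative S v g ->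
  {ae mu, forall t, D t -> g t = time_derivative S v t}.
Proof. by move=> h; apply: (time_derivative_unique ipH h); exact: time_derivative_spec h. Qed.

Lemma time_derivative_congr (v w : R -> H) : (forall t, D t -> v t = w t) ->
  time_derivative S v = time_derivative S w.
Proof.
move=> vw; rewrite /time_derivative; congr xget; apply/seteqP.
have key (u u' g : R -> H) : (forall t, D t -> u t = u' t) ->
    is_time_derivative S u g -> is_time_derivative S u' g.
  move=> uu' h s t s0 st tS; rewrite -!uu'; first exact: h.
    by split=> //; apply: lt_trans tS; rewrite lte_fin.
  by split=> //; exact: lt_trans st.
by split=> g /=; apply: key => // t Dt; rewrite vw.
Qed.

Lemma Ynorm_le (v g : R -> H) (M : R) :
  is_time_derivative S v g -> sq_integrable D g -> sq_integrable D (fun t => A (v t)) ->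
  (forall t, D t -> expR (- t) * hnorm (v t) <= M) ->
  (Ynorm A S v <= (M + l2 D g + l2 D (fun t => A (v t)))%:E)%E.
Proof.
move=> dg gi Ai hM; have gae := time_derivative_ae dg.
have mD := measurable_time_itv S.
rewrite /Ynorm L2normE; last exact: sq_integrable_ext gi.
rewrite L2normE// -(l2_ext mD gae) !EFinD leeD2r// leeD2r//.
by apply: ub_ereal_sup => _ [t Dt <-]; rewrite lee_fin hM.
Qed.

Lemma solves_strong N F v0 v g : solves N F v0 v g -> strong_solution A S N F v0 v.
Proof.
case=> cv dg gi dv Ai eqv lim [M hM]; have gae := time_derivative_ae dg.
have mD := measurable_time_itv S.
have r0 : {ae mu, forall t, D t -> 0 = time_derivative S v t + N t (v t) - F t}.
  by apply: (ae_imp2 gae eqv) => t e1 e2 Dt; rewrite -e1// e2// subrr.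
have z2 : sq_integrable D (fun=> 0 : H).
  split; first exact: ae_vmeas_cst.
  exists (fun=> 0); first exact: integrable0.
  by apply: aeW => t _; rewrite hnorm0 expr0n.
have r2 := sq_integrable_ext r0 z2.
split => //.
- split=> //.
  + by exists g.
  + by apply/inL2P; exact: sq_integrable_ext gi.
  + by split=> //; apply/inL2P.
  + by apply: le_lt_trans (Ynorm_le dg gi Ai hM) _; exact: ltry.
- exact/inL2P.
- rewrite L2normE// -(l2_ext mD r0) /l2; congr _%:E.
  under eq_Rintegral do rewrite hnorm0 expr0n.
  by rewrite Rintegral_cst// mul0r sqrtr0.
Qed.

Lemma strong_solves N F v0 v : strong_solution A S N F v0 v ->
  solves N F v0 v (time_derivative S v).
Proof.
have mD := measurable_time_itv S.
case=> -[cv [g dg] /inL2P gi [dv /inL2P Ai] Yfin] /inL2P ri r0 lim.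
split=> //.
- exact: time_derivative_spec dg.
- have : l2 D (fun t => time_derivative S v t + N t (v t) - F t) = 0.
    by have := r0; rewrite L2normE// => -[].
  move=> /(l2_eq0 mD ri) h0; apply: (ae_imp h0) => t h /h /eqP.
  by rewrite subr_eq0 => /eqP.
- move: Yfin; rewrite /Ynorm !L2normE//.
  set X := ereal_sup _ => Xfin.
  have Xub t : D t -> ((expR (- t) * hnorm (v t))%:E <= X)%E.
    by move=> Dt; apply: ereal_sup_ubound; exists t.
  case: X Xfin Xub => [r _ h| |_ h].
  + by exists r => t Dt; rewrite -lee_fin h.
  + by [].
  + by exists 0 => t Dt; have := h t Dt; rewrite leeNy_eq.
Qed.

Lemma solves_sub F F' v0 v0' v v' g g' : linear_operator A ->
  solves (fun=> A) F v0 v g -> solves (fun=> A) F' v0' v' g' ->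
  solves (fun=> A) (fun t => F t - F' t) (v0 - v0')
    (fun t => v t - v' t) (fun t => g t - g' t).
Proof.
have mD := measurable_time_itv S.
move=> lA [cv dg gi dv Ai eqv lim [M hM]] [cv' dg' gi' dv' Ai' eqv' lim' [M' hM']].
split.
- by move=> t Dt; apply: cvgB; [exact: cv|exact: cv'].
- move=> s t s0 st tS; rewrite (_ : _ - _ = (v t - v s) - (v' t - v' s)); last first.
    by rewrite !opprD !addrA; congr (_ + _); rewrite addrAC.
  by apply: (bochnerB ipH); [exact: measurable_itv|exact: dg|exact: dg'].
- exact: sq_integrableB.
- apply: (ae_imp2 dv dv') => t h h' Dt; exact: (operatorB lA (h Dt) (h' Dt)).1.
- apply: sq_integrable_ext (sq_integrableB mD Ai Ai').
  by apply: (ae_imp2 dv dv') => t h h' Dt; rewrite (operatorB lA (h Dt) (h' Dt)).2.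
- have dd := ae_imp2 dv dv' (fun t a b => conj a b).
  apply: (ae_imp3 eqv eqv' dd) => t h h' [d d'] Dt.
  by rewrite (operatorB lA (d Dt) (d' Dt)).2 addrACA -opprD h// h'.
- exact: cvgB.
- exists (M + M') => t Dt; apply: le_trans (lerD (hM t Dt) (hM' t Dt)).
  rewrite -mulrDr ler_wpM2l ?expR_ge0//.
  by have := hnorm_add (v t) (- v' t); rewrite hnorm_opp.
Qed.

End Solves.

Section MaximalRegularity.
Context {R : realType} {H : completeNormedModType R[i]}.
Local Notation mu := (@lebesgue_measure R).
Variables (ip : {dot H for Num.Def.conjC}) (A sqrtA : operator H) (E : R -> H -> H) (CA : R).
Hypothesis ipH : hilbert_norm ip.
Hypothesis cE : contraction_C0_semigroup E.
Hypothesis gE : generates (opp_operator A) E.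
Hypothesis saA : selfadjoint ip A.
Hypothesis lA : linear_operator A.
Hypothesis mr : maximal_L2_regularity A sqrtA CA.
Variable S : \bar R.
Hypothesis S0 : (0 < S)%E.
Local Notation D := (time_itv S).
Local Notation solvesA := (solves A S (fun=> A)).

Lemma maxreg_exists F v0 : sq_integrable D F -> op_dom sqrtA v0 ->
  exists v, strong_solution A S (fun=> A) F v0 v.
Proof. by move=> /inL2P Fi d0; have [v [? _ _]] := mr S0 Fi d0; exists v. Qed.

(** Maximal regularity provides some solution satisfying the estimate; by
    uniqueness it coincides with v on the interval, hence has the same
    chosen derivative. *)
Lemma maxreg_estimate F v0 v g : sq_integrable D F -> op_dom sqrtA v0 ->
  solvesA F v0 v g ->
  l2 D g + l2 D (fun t => A (v t)) <=
    Num.sqrt 2 * hnorm (sqrtA v0) + CA * l2 D F.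
Proof.
move=> Fi d0 sv; have mD := measurable_time_itv S.
have [V [sV uV est]] := mr S0 ((inL2P S F).2 Fi) d0.
have vV := uV _ (solves_strong ipH sv).
have gae := time_derivative_ae ipH (solves_deriv sv).
have Ag t : D t -> A (v t) = A (V t) by move=> Dt; rewrite vV.
have Vg := time_derivative_congr vV.
have AV : L2norm S (fun t => A (V t)) = (l2 D (fun t => A (v t)))%:E.
  have e : {ae mu, forall t, D t -> A (v t) = A (V t)} by apply: aeW.
  rewrite L2normE; last exact: sq_integrable_ext e (solves_op_sq sv).
  by rewrite -(l2_ext mD e).
have GV : L2norm S (time_derivative S V) = (l2 D g)%:E.
  rewrite -Vg L2normE; last exact: sq_integrable_ext gae (solves_deriv_sq sv).
  by rewrite -(l2_ext mD gae).
by move: est; rewrite AV GV L2normE// -!EFinD -EFinM lee_fin.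
Qed.

Lemma solves_duhamel F v0 v g t : sq_integrable D F -> solvesA F v0 v g -> D t ->
  exists I : H,
  [/\ is_bochner_integral `]0, t[%classic (fun r => E (t - r) (F r)) I,
      v t = E t v0 + I &
      hnorm (v t) <= hnorm v0 + Num.sqrt t * l2 D F].
Proof.
move=> Fi [cv dg gi dv Ai eqv lim _] Dt.
apply: (duhamel ipH cE gE saA dg gi Fi _ lim Dt).
by apply: (ae_imp2 dv eqv) => r h h' Dr; split; [exact: h|exact: h'].
Qed.

(** The Duhamel formula gives |v t| <= |v0| + sqrt t ||F||, and the weight
    absorbs the growth since sqrt t <= exp t. *)
Lemma solves_weighted_sup F v0 v g t : sq_integrable D F -> solvesA F v0 v g -> D t ->
  expR (- t) * hnorm (v t) <= hnorm v0 + l2 D F.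
Proof.
move=> Fi sv Dt; have [I [_ _ h]] := solves_duhamel Fi sv Dt; have [t0 _] := Dt.
have l0 := l2_ge0 D F; have v0p := hnorm_ge0 v0.
have et : 1 + t <= expR t by exact: expR_ge1Dx.
have st : Num.sqrt t <= expR t.
  rewrite -[leRHS](ger0_norm (expR_ge0 t)) -sqrtr_sqr ler_wsqrtr//.
  apply: (@le_trans _ _ (1 + t)); first lra.
  by apply: (le_trans et); rewrite expr2 ler_peMr ?expR_ge0// (le_trans _ et)// lerDl ltW.
rewrite expRN mulrC ler_pdivrMr ?expR_gt0//; apply: le_trans h _.
have h1 : hnorm v0 <= hnorm v0 * expR t by rewrite ler_peMr// (le_trans _ et)// lerDl ltW.
have h2 : Num.sqrt t * l2 D F <= l2 D F * expR t by rewrite mulrC ler_wpM2l.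
by rewrite mulrDl lerD.
Qed.

End MaximalRegularity.

(** * The perturbed problem as a fixed-point equation for the right-hand side *)

Section Perturbation.
Context {R : realType} {H : completeNormedModType R[i]}.
Local Notation mu := (@lebesgue_measure R).
Variables (ip : {dot H for Num.Def.conjC}) (A sqrtA : operator H) (E : R -> H -> H).
Variables (B : R -> operator H) (C1 C2 CA kap : R).
Hypothesis ipH : hilbert_norm ip.
Hypothesis cE : contraction_C0_semigroup E.
Hypothesis gE : generates (opp_operator A) E.
Hypothesis saA : selfadjoint ip A.
Hypothesis lA : linear_operator A.
Hypothesis lsqrtA : linear_operator sqrtA.
Hypothesis mr : maximal_L2_regularity A sqrtA CA.
Hypotheses (CA0 : 0 <= CA) (C10 : 0 <= C1) (C20 : 0 <= C2) (kap0 : 0 <= kap).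
Variable S : \bar R.
Hypothesis S0 : (0 < S)%E.
Local Notation D := (time_itv S).
Local Notation solvesA := (solves A S (fun=> A)).
Local Notation AB := (fun t => perturb A (B t)).
Hypothesis lB : forall t, D t -> linear_operator (B t) /\ op_dom A `<=` op_dom (B t).
Hypothesis bB : forall t z, D t -> op_dom A z ->
  hnorm (B t z) <= C1 * hnorm (A z) + C2 * hnorm z.
Hypothesis cB : forall z, op_dom A z ->
  forall t, D t -> {for t, continuous (fun s => B s z)}.
Hypothesis kapi : ae_integrable D (fun t => (C2 * expR t) ^+ 2).
Hypothesis kaple : \int[mu]_(t in D) (C2 * expR t) ^+ 2 <= kap ^+ 2.
Local Notation q := ((CA + 1) * (C1 + kap)).
Hypothesis qhalf : q < 2^-1.

(** Relative boundedness with |v t| <= M exp t; kap bounds the L2-norm of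
    C2 exp, so that kap M bounds the one of C2 v. *)
Lemma perturbation_l2 (v : R -> H) (M : R) : 0 <= M ->
  (forall t, D t -> {for t, continuous v}) ->
  {ae mu, forall t, D t -> op_dom A (v t)} ->
  sq_integrable D (fun t => A (v t)) ->
  (forall t, D t -> expR (- t) * hnorm (v t) <= M) ->
  sq_integrable D (fun t => B t (v t)) /\
  l2 D (fun t => B t (v t)) <= C1 * l2 D (fun t => A (v t)) + kap * M.
Proof.
move=> M0 cv dv Ai hM; have mD := measurable_time_itv S.
have mv := ae_vmeas_continuous cv.
have mB := ae_vmeas_operator lA C10 C20 lB bB cB mv Ai.1 dv.
have [Ai1 Al1] := l2Z C1 mD Ai.
have vb t : D t -> hnorm (C2%:C *: v t) ^+ 2 <= M ^+ 2 * (C2 * expR t) ^+ 2.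
  move=> Dt; rewrite hnormZ ger0_norm// -exprMn.
  have h : hnorm (v t) <= M * expR t by rewrite -ler_pdivrMr ?expR_gt0// mulrC -expRN hM.
  rewrite ler_sqr ?nnegrE ?mulr_ge0 ?hnorm_ge0 ?expR_ge0//.
  by rewrite mulrCA ler_wpM2l.
have mv2 : ae_vmeas D (fun t => C2%:C *: v t).
  have [g mg fg] := mv; exists (fun t => C2%:C *: g t); first exact: vmeasZ.
  by apply: (ae_imp fg) => t h Dt; rewrite h.
have Mi := ae_integrableZ (M ^+ 2) mD kapi.
have vae : {ae mu, forall t, D t -> hnorm (C2%:C *: v t) ^+ 2 <= M ^+ 2 * (C2 * expR t) ^+ 2}.
  by apply: aeW.
have v2 := sq_integrable_le mD mv2 Mi vae.
have lv : l2 D (fun t => C2%:C *: v t) <= kap * M.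
  rewrite -ler_sqr ?nnegrE ?l2_ge0 ?mulr_ge0// sqr_l2.
  apply: le_trans (Rint_le mD v2.2 Mi vae) _; rewrite Rint_Z// mulrC exprMn.
  by rewrite ler_wpM2r// sqr_ge0.
have Bae : {ae mu, forall t, D t -> hnorm (B t (v t)) <= hnorm (C1%:C *: A (v t)) + hnorm (C2%:C *: v t)}.
  apply: (ae_imp dv) => t h Dt; rewrite !hnormZ !ger0_norm//.
  exact: bB (h Dt).
have [Bi Bl] := l2_le_sum mD mB Ai1 v2 Bae.
by split=> //; apply: le_trans Bl _; rewrite Al1 ger0_norm// lerD.
Qed.

Lemma solves_perturbation_sq F v0 v g : sq_integrable D F -> solvesA F v0 v g ->
  sq_integrable D (fun t => B t (v t)).
Proof.
move=> Fi sv; have [cv _ _ dv Ai _ _ _] := sv.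
have M0 : 0 <= hnorm v0 + l2 D F by rewrite addr_ge0 ?hnorm_ge0 ?l2_ge0.
apply: (perturbation_l2 M0 cv dv Ai _).1 => t Dt.
exact: (solves_weighted_sup ipH cE gE saA Fi sv Dt).
Qed.

(** The difference of the two solutions has zero initial datum, so both A of it
    and its weighted supremum are controlled by the L2-distance of F and F'
    alone, with constants CA and 1. *)
Lemma perturbation_contraction F F' v0 v v' g g' : sq_integrable D F -> sq_integrable D F' ->
  solvesA F v0 v g -> solvesA F' v0 v' g' ->
  l2 D (fun t => B t (v t) - B t (v' t)) <= q * l2 D (fun t => F t - F' t).
Proof.
move=> Fi Fi' sv sv'; have mD := measurable_time_itv S.
have Fd := sq_integrableB mD Fi Fi'.
have := solves_sub ipH lA sv sv'; rewrite subrr => sd.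
have d0 : op_dom sqrtA 0 by case: lsqrtA.
have est := maxreg_estimate ipH mr S0 Fd d0 sd.
rewrite operator0// hnorm0 mulr0 add0r in est.
have sup t : D t -> expR (- t) * hnorm (v t - v' t) <= l2 D (fun t => F t - F' t).
  by move=> Dt; have := solves_weighted_sup ipH cE gE saA Fd sd Dt; rewrite hnorm0 add0r.
have [cd _ _ dd Ad _ _ _] := sd.
have [_ bd] := perturbation_l2 (l2_ge0 _ _) cd dd Ad sup.
have e : {ae mu, forall t, D t -> B t (v t - v' t) = B t (v t) - B t (v' t)}.
  apply: (ae_imp2 (solves_dom sv) (solves_dom sv')) => t h h' Dt.
  by have [lBt sB] := lB Dt; rewrite (operatorB lBt (sB _ (h Dt)) (sB _ (h' Dt))).2.
rewrite -(l2_ext mD e); apply: le_trans bd _.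
move: est; have := l2_ge0 D (fun t => g t - g' t).
have := l2_ge0 D (fun t => F t - F' t).
move: (l2 D (fun t => F t - F' t)) (l2 D (fun t => g t - g' t))
  (l2 D (fun t => A (v t - v' t))) => a b c a0 b0 bc.
have cb : c <= CA * a by lra.
have : C1 * c <= C1 * (CA * a) by rewrite ler_wpM2l.
have : 0 <= C1 * a by rewrite mulr_ge0.
have : 0 <= kap * CA * a by rewrite !mulr_ge0.
lra.
Qed.

Lemma contraction_factor_ge0 : 0 <= q.
Proof. by rewrite mulr_ge0// addr_ge0. Qed.

(** Iterate F |-> - B V_F from F = 0, where V_F solves the unperturbed problem.
    The contraction factor is below 1/2, so the iterates converge in L2 to
    some G with G = - B V_G almost everywhere. *)
Lemma perturbed_exists v0 : op_dom sqrtA v0 -> exists v g,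
  [/\ sq_integrable D (fun t => - B t (v t)),
      solvesA (fun t => - B t (v t)) v0 v g & solves A S AB (fun=> 0) v0 v g].
Proof.
move=> d0; have mD := measurable_time_itv S.
have /choice[Phi hPhi] : forall F : R -> H, exists v, sq_integrable D F ->
    strong_solution A S (fun=> A) F v0 v.
  move=> F; have [Fi|nF] := pselect (sq_integrable D F); last by exists (fun=> 0).
  by have [v sv] := maxreg_exists mr S0 Fi d0; exists v.
have sol F : sq_integrable D F -> solvesA F v0 (Phi F) (time_derivative S (Phi F)).
  by move=> Fi; apply: strong_solves; exact: hPhi.
pose next F t := - B t (Phi F t).
have nexti F : sq_integrable D F -> sq_integrable D (next F).
  by move=> Fi; apply: sq_integrableN; exact: solves_perturbation_sq Fi (sol F Fi).
have contr F F' : sq_integrable D F -> sq_integrable D F' ->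
    l2 D (fun t => next F t - next F' t) <= q * l2 D (fun t => F t - F' t).
  move=> Fi Fi'; rewrite -l2N.
  have := perturbation_contraction Fi Fi' (sol F Fi) (sol F' Fi').
  congr (_ <= _); congr l2; apply/funext => t.
  by rewrite /next opprB opprK addrC.
pose F n := iter n next (fun=> 0).
have Fi n : sq_integrable D (F n).
  elim: n => [|n IH]; last exact: nexti.
  split; first exact: ae_vmeas_cst.
  exists (fun=> 0); first exact: integrable0.
  by apply: aeW => t _; rewrite hnorm0 expr0n.
have Fd n : l2 D (fun t => F n.+1 t - F n t) <= l2 D (fun t => F 1%N t - F 0%N t) * 2^-1 ^+ n.
  elim: n => [|n IH]; first by rewrite expr0 mulr1.
  apply: le_trans (contr _ _ (Fi n.+1) (Fi n)) _.
  rewrite exprS mulrCA; apply: ler_pM => //; [exact: contraction_factor_ge0|exact: l2_ge0|exact: ltW].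
have [G Gi cG] := l2_complete mD Fi Fd.
have Gfix : {ae mu, forall t, D t -> next G t = G t}.
  have dfi := sq_integrableB mD (nexti G Gi) Gi.
  suff : l2 D (fun t => next G t - G t) = 0.
    by move=> /(l2_eq0 mD dfi) h; apply: (ae_imp h) => t e /e /eqP; rewrite subr_eq0 => /eqP.
  apply/eqP; rewrite eq_le l2_ge0 andbT; apply/ler_addgt0Pr => e e0; rewrite add0r.
  have e2 : 0 < e / 2 by lra.
  move/cvgrPdist_lt: cG => /(_ _ e2)[N _ hN].
  have hNn n : (N <= n)%N -> l2 D (fun t => G t - F n t) < e / 2.
    by move=> /hN /=; rewrite sub0r normrN ger0_norm ?l2_ge0.
  have h1 := hNn N (leqnn N); have h2 := hNn N.+1 (leqnSn N).
  have h3 := contr _ _ Gi (Fi N).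
  have GN := sq_integrableB mD Gi (Fi N.+1).
  have tri := l2_triangle mD (sq_integrableB mD (nexti G Gi) (Fi N.+1)) (sq_integrableN GN).
  rewrite l2N in tri.
  rewrite (_ : (fun t => next G t - G t) =
     fun t => next G t - F N.+1 t + - (G t - F N.+1 t)); last first.
    by apply/funext => t; rewrite opprB subrKA.
  apply: le_trans tri _; have := contraction_factor_ge0; have := l2_ge0 D (fun t => G t - F N t) => g0 qq0.
  have h4 : q * l2 D (fun t => G t - F N t) <= 1 * l2 D (fun t => G t - F N t).
    by apply: ler_wpM2r => //; apply: (le_trans (ltW qhalf)); rewrite invf_le1 ?ler1n.
  rewrite mul1r in h4; have := le_trans h3 h4; rewrite -/(F N.+1) => h5.
  rewrite [leRHS](splitr e); exact: lerD (le_trans h5 (ltW h1)) (ltW h2).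
have sG := sol G Gi.
exists (Phi G), (time_derivative S (Phi G)); case: (sG) => cv dg gi dv Ai eqv lim bd.
split.
- exact: nexti.
- by split=> //; apply: (ae_imp2 eqv Gfix) => t e1 e2 Dt; rewrite e1// -e2.
- split=> //; apply: (ae_imp2 eqv Gfix) => t e1 e2 Dt.
  by rewrite /perturb /= addrA e1// -e2// /next addNr.
Qed.

Lemma perturbed_to_A v0 v g : solves A S AB (fun=> 0) v0 v g ->
  sq_integrable D (fun t => - B t (v t)) /\ solvesA (fun t => - B t (v t)) v0 v g.
Proof.
case=> cv dg gi dv Ai eqv lim [M hM].
have hM' t : D t -> expR (- t) * hnorm (v t) <= `|M|.
  by move=> /hM /le_trans; apply; exact: ler_norm.
have [Bi _] := perturbation_l2 (normr_ge0 M) cv dv Ai hM'.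
split; first exact: sq_integrableN.
split=> //; last by exists M.
apply: (ae_imp eqv) => t e Dt; apply/eqP; rewrite -subr_eq0 opprK -addrA; apply/eqP.
exact: e.
Qed.

(** The right-hand sides - B v and - B w are both fixed points of the
    contraction, hence at distance 0; the weighted supremum of v - w is bounded
    by this distance. *)
Lemma perturbed_unique v0 v w g h : solves A S AB (fun=> 0) v0 v g ->
  solves A S AB (fun=> 0) v0 w h -> forall t, D t -> w t = v t.
Proof.
move=> /perturbed_to_A[Fi sv] /perturbed_to_A[Gi sw] t Dt.
have mD := measurable_time_itv S.
set F := fun t => - B t (v t) in Fi sv; set G := fun t => - B t (w t) in Gi sw.
have dFi := sq_integrableB mD Gi Fi.
have := perturbation_contraction Gi Fi sw sv.
rewrite -(l2N D (fun t => B t (w t) - B t (v t))).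
rewrite (_ : (fun t => - (B t (w t) - B t (v t))) = fun t => G t - F t); last first.
  by apply/funext => r; rewrite /G /F opprB opprK addrC.
set l := l2 D _ => hl; have l0 : 0 <= l by exact: l2_ge0.
have l00 : l = 0.
  apply/eqP; rewrite eq_le l0 andbT; have := ler_wpM2r l0 (ltW qhalf); lra.
have := solves_sub ipH lA sw sv; rewrite subrr => sd.
have := solves_weighted_sup ipH cE gE saA dFi sd Dt.
rewrite -/l l00 hnorm0 addr0 => h0.
apply/eqP; rewrite -subr_eq0; apply/eqP/hnorm_eq0/eqP.
by rewrite eq_le hnorm_ge0 andbT -(pmulr_rle0 _ (expR_gt0 (- t))).
Qed.

(** With Y the Y-norm of v and F = - B v, the unperturbed estimates give
    Y <= |v0| + sqrt 2 |sqrtA v0| + (CA + 1) ||F||, and the last term is at most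
    (CA + 1) (C1 + kap) Y <= Y / 2. *)
Lemma perturbed_estimate v0 v g : op_dom sqrtA v0 -> solves A S AB (fun=> 0) v0 v g ->
  (Ynorm A S v <= (2 * hnorm v0 + 2 * Num.sqrt 2 * hnorm (sqrtA v0))%:E)%E.
Proof.
move=> d0 sv; have [Fi sA] := perturbed_to_A sv.
have [cv dg gi dv Ai _ _ [M hM]] := sv.
have est := maxreg_estimate ipH mr S0 Fi d0 sA.
have wsup t := @solves_weighted_sup _ _ _ _ _ ipH cE gE saA _ _ _ _ _ t Fi sA.
pose X := [set expR (- t) * hnorm (v t) | t in D].
have X0 : X !=set0.
  have [t Dt] : exists t, D t.
    case: S S0 => [r||]//; rewrite ?lte_fin => r0.
      by exists (r / 2); split; rewrite ?lte_fin; lra.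
    by exists 1; split=> //; rewrite ltry.
  by exists (expR (- t) * hnorm (v t)), t.
have sX : has_sup X by split=> //; exists M => _ [t Dt <-]; exact: hM.
have hs t : D t -> expR (- t) * hnorm (v t) <= sup X.
  by move=> Dt; apply: ub_le_sup; [by case: sX|exists t].
have s0 : 0 <= sup X.
  case: X0 => _ [t Dt _]; apply: le_trans (hs t Dt).
  by rewrite mulr_ge0 ?expR_ge0 ?hnorm_ge0.
have [_ Bl] := perturbation_l2 s0 cv dv Ai hs; rewrite -l2N in Bl.
have sle : sup X <= hnorm v0 + l2 D (fun t => - B t (v t)).
  by apply: ge_sup => // _ [t Dt <-]; exact: wsup.
apply: le_trans (Ynorm_le ipH dg gi Ai hs) _; rewrite lee_fin.
have gl := l2_ge0 D g; have al := l2_ge0 D (fun t => A (v t)).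
have v0p := hnorm_ge0 v0; have sv0 := hnorm_ge0 (sqrtA v0).
move: est Bl sle s0 gl al; rewrite (mulrC 2 (Num.sqrt 2)) -(mulrA _ 2).
have r2 : 0 <= Num.sqrt (2 : R) * hnorm (sqrtA v0) by rewrite mulr_ge0 ?sqrtr_ge0.
rewrite (mulrCA _ 2); move: (Num.sqrt 2 * hnorm (sqrtA v0)) r2 => n n0.
move: (sup X) (l2 D g) (l2 D (fun t => A (v t))) (l2 D (fun t => - B t (v t))) => s a b l est Bl sle s0 gl al.
have h1 : C1 * b <= C1 * (s + a + b) by rewrite ler_wpM2l//; lra.
have h2 : kap * s <= kap * (s + a + b) by rewrite ler_wpM2l//; lra.
have h3 : (CA + 1) * l <= (CA + 1) * ((C1 + kap) * (s + a + b)).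
  apply: ler_wpM2l; first by rewrite addr_ge0.
  by rewrite mulrDl; apply: le_trans Bl (lerD h1 h2).
have h4 : q * (s + a + b) <= 2^-1 * (s + a + b) by apply: ler_wpM2r; [lra|exact: ltW].
lra.
Qed.

Lemma perturbed_mild v0 v g t : solves A S AB (fun=> 0) v0 v g -> D t ->
  mild_formula E B v0 v t.
Proof.
move=> /perturbed_to_A[Fi sA] Dt.
have [I [hI vE _]] := solves_duhamel ipH cE gE saA Fi sA Dt.
have mI : measurable (`]0, t[%classic : set R) by exact: measurable_itv.
exists (- I); split; last by rewrite opprK.
apply: (bochner_ext ipH mI _ (bochnerN ipH mI hI)).
apply: aeW => r /=; rewrite in_itv /= => /andP[_ rt].
have tr0 : 0 <= t - r by rewrite subr_ge0 ltW.
by rewrite -[- B r (v r)]sub0r (semigroupB cE)// (semigroup0 cE)// sub0r opprK.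
Qed.

Lemma perturbed_well_posed v0 : op_dom sqrtA v0 -> exists v : R -> H,
  [/\ strong_solution A S AB (fun=> 0) v0 v,
      forall w, strong_solution A S AB (fun=> 0) v0 w -> forall t, D t -> w t = v t,
      (Ynorm A S v <= (2 * hnorm v0 + 2 * Num.sqrt 2 * hnorm (sqrtA v0))%:E)%E &
      forall t, D t -> mild_formula E B v0 v t].
Proof.
move=> d0; have [v [g [_ _ sv]]] := perturbed_exists d0; exists v; split.
- exact: (solves_strong ipH sv).
- by move=> w /strong_solves sw t Dt; exact: (perturbed_unique sv sw).
- exact: perturbed_estimate sv.
- by move=> t Dt; exact: (perturbed_mild sv).
Qed.

End Perturbation.

(** * The admissible length of the time interval *)

Section ExponentialWeight.
Context {R : realType}.
Local Notation mu := (@lebesgue_measure R).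

Lemma Rint_expR_sq (k r : R) : 0 < r ->
  ae_integrable `]0, r[%classic (fun t => (k * expR t) ^+ 2) /\
  \int[mu]_(t in `]0, r[) (k * expR t) ^+ 2 <= k ^+ 2 * ((expR r ^+ 2 - 1) / 2).
Proof.
move=> r0; have mI : measurable (`]0, r[%classic : set R) by exact: measurable_itv.
have ce : continuous (fun t : R => 2 * expR t ^+ 2).
  move=> t; apply: cvgM; first exact: cvg_cst.
  under [X in X @ _]eq_fun do rewrite expr2; rewrite expr2.
  by apply: cvgM; exact: continuous_expR.
have de (t : R) : is_derive t (1 : R) ((expR : R -> R) ^+ 2) (2 * expR t ^+ 2).
  have := @is_deriveX _ _ _ 2 t 1 _ (is_derive_expR t).
  by rewrite /GRing.scale /= expr1 -mulrA -expr2.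
have ftc : (\int[mu]_(t in `[0%R, r]) (2 * expR t ^+ 2)%:E = (expR r ^+ 2 - 1)%:E)%E.
  rewrite (@continuous_FTC2 _ _ ((expR : R -> R) ^+ 2) 0 r r0).
  - by rewrite -EFinB /= !fctE expR0 expr1n.
  - exact: continuous_subspaceT.
  - split=> [t _||].
    + by have [] := de t.
    + apply: cvg_at_right_filter; apply/differentiable_continuous/derivable1_diffP.
      by have [] := de 0.
    + apply: cvg_at_left_filter; apply/differentiable_continuous/derivable1_diffP.
      by have [] := de r.
  - by move=> t _; rewrite derive1E; have [_ ->] := de t.
have ei : ae_integrable `]0, r[%classic (fun t => 2 * expR t ^+ 2).
  apply: (ae_integrable_le mI _ (ae_integrable_cst 0 r (2 * expR r ^+ 2))).
    exists (fun t => 2 * expR t ^+ 2); last exact: aeW.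
    exact: continuous_measurable_fun.
  apply: aeW => t /=; rewrite in_itv /= => /andP[_ tr].
  rewrite ger0_norm ?mulr_ge0 ?sqr_ge0// ler_pM2l// ler_sqr ?nnegrE ?expR_ge0//.
  by rewrite ler_expR ltW.
have eE (t : R) : (k * expR t) ^+ 2 = k ^+ 2 / 2 * (2 * expR t ^+ 2) by rewrite exprMn; field.
split.
  apply: (ae_integrable_ext _ (ae_integrableZ (k ^+ 2 / 2) mI ei)).
  by apply: aeW => t _; rewrite eE.
under eq_Rintegral do rewrite eE.
rewrite Rint_Z//.
have -> : k ^+ 2 * ((expR r ^+ 2 - 1) / 2) = k ^+ 2 / 2 * (expR r ^+ 2 - 1) by field.
apply: ler_wpM2l; first by rewrite divr_ge0// sqr_ge0.
rewrite -lee_fin -ge0_Rint_EFin//.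
rewrite -ftc; apply: ge0_subset_integral => //.
- by apply/measurable_EFinP; apply: measurable_funTS; exact: continuous_measurable_fun.
- by move=> t /=; rewrite !in_itv /= => /andP[/ltW -> /ltW ->].
Qed.

End ExponentialWeight.
Unset Implicit Arguments.
Set Strict Implicit.
Set Printing Implicit Defensive.

Theorem theorem6p3 (R : realType) (H : completeNormedModType R[i])
    (ip : {dot H for Num.Def.conjC}) (T : \bar R)
    (A : operator H) (B : R -> operator H)
    (sqrtA : operator H) (expA : R -> H -> H) (C1 C2 CA : R) :
  hilbert_norm ip ->
  (0 < T)%E ->
  linear_operator A ->
  (forall t, 0 <= t -> (t%:E < T)%E ->
     linear_operator (B t) /\ op_dom A `<=` op_dom (B t)) ->
  (* (a) *)
  generates_bounded_analytic_semigroup (opp_operator A) ->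
  (* (b), with expA t = e^{-tA} *)
  contraction_C0_semigroup expA -> generates (opp_operator A) expA ->
  (* (c), with sqrtA = A^{1/2} *)
  nonneg_selfadjoint ip A -> is_sqrt_operator ip A sqrtA ->
  (* (d) *)
  0 < C1 ->
  (forall t f, 0 <= t -> (t%:E < T)%E -> op_dom A f ->
     hnorm (B t f) <= C1 * hnorm (A f) + C2 * hnorm f) ->
  (* (e) *)
  (exists2 C : R, 0 < C & time_lipschitz A B T C) ->
  (* (f) *)
  (forall t0, 0 <= t0 -> (t0%:E < T)%E ->
     generates_analytic_semigroup (opp_operator (perturb A (B t0)))) ->
  0 < CA -> maximal_L2_regularity A sqrtA CA ->
  (* ( * ) *)
  C1 * (CA + 1) < (4 * Num.sqrt 2)^-1 ->
  ((* (i) *)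
   (T < +oo)%E -> 0 < C2 ->
   let Tstar : \bar R :=
     Order.min T
       (2^-1 * ln (1 + (16 * C2 ^+ 2 * (CA + 1) ^+ 2)^-1))%:E in
   forall v0 : H, op_dom sqrtA v0 ->
   exists v : R -> H,
     [/\ strong_solution A Tstar (fun t => perturb A (B t)) (fun=> 0) v0 v,
         forall w : R -> H,
           strong_solution A Tstar (fun t => perturb A (B t)) (fun=> 0) v0 w ->
           forall t, time_itv Tstar t -> w t = v t,
         (Ynorm A Tstar v
            <= (2 * hnorm v0 + 2 * Num.sqrt 2 * hnorm (sqrtA v0))%:E)%E &
         forall t, time_itv Tstar t -> mild_formula expA B v0 v t])
  /\
  ((* (ii) *)
   T = +oo%E -> C2 = 0 ->
   forall v0 : H, op_dom sqrtA v0 ->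
   exists v : R -> H,
     [/\ strong_solution A +oo%E (fun t => perturb A (B t)) (fun=> 0) v0 v,
         forall w : R -> H,
           strong_solution A +oo%E (fun t => perturb A (B t)) (fun=> 0) v0 w ->
           forall t, time_itv +oo%E t -> w t = v t,
         (Ynorm A +oo%E v
            <= (2 * hnorm v0 + 2 * Num.sqrt 2 * hnorm (sqrtA v0))%:E)%E &
         forall t, time_itv +oo%E t -> mild_formula expA B v0 v t]).
Proof.
move=> ipH T0 lA lB _ cE gE nsA sqA C10 bB [C C0 tl] _ CA0 mr cond.
have saA := nsA.1; have lsqrtA : linear_operator sqrtA by case: sqA => -[[]].
have main S kap : (0 < S)%E -> (S <= T)%E -> 0 <= C2 -> 0 <= kap ->
    ae_integrable (time_itv S) (fun t => (C2 * expR t) ^+ 2) ->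
    \int[lebesgue_measure]_(t in time_itv S) (C2 * expR t) ^+ 2 <= kap ^+ 2 ->
    (CA + 1) * (C1 + kap) < 2^-1 -> forall v0 : H, op_dom sqrtA v0 ->
    exists v : R -> H,
     [/\ strong_solution A S (fun t => perturb A (B t)) (fun=> 0) v0 v,
         forall w : R -> H,
           strong_solution A S (fun t => perturb A (B t)) (fun=> 0) v0 w ->
           forall t, time_itv S t -> w t = v t,
         (Ynorm A S v
            <= (2 * hnorm v0 + 2 * Num.sqrt 2 * hnorm (sqrtA v0))%:E)%E &
         forall t, time_itv S t -> mild_formula expA B v0 v t].
  move=> S0 ST C20 kap0 ki kle qh v0 d0.
  have DT t : time_itv S t -> 0 <= t /\ (t%:E < T)%E.
    by move=> [t0 tS]; split; [exact: ltW|exact: lt_le_trans ST].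
  apply: (perturbed_well_posed ipH cE gE saA lA lsqrtA mr (ltW CA0) (ltW C10) C20 kap0 S0
     _ _ _ ki kle qh d0).
  - by move=> t /DT[t0 tT]; exact: lB.
  - by move=> t z /DT[t0 tT]; exact: bB.
  move=> z Dz t Dt; have [t0 tS] := Dt.
  have lip s r : 0 < s -> s <= r -> (r%:E < T)%E ->
      hnorm (B r z - B s z) <= C * (r - s) * (hnorm (A z) + hnorm z).
    move=> s0 sr rT; have := tl (fun=> z) _ s r s0 sr rT.
    rewrite !subrr !hnorm0 addr0 mulr0 addr0; apply => x _.
    by split=> //; exact: cvg_cst.
  apply/hcvgP => e e0.
  pose K := C * (hnorm (A z) + hnorm z) + 1.
  have K0 : 0 < K.
    by rewrite ltr_wpDl// mulr_ge0 ?addr_ge0 ?hnorm_ge0// ltW.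
  have nD : \forall s \near t, time_itv S s.
    by apply: open_nbhs_nbhs; split=> //; exact: open_time_itv.
  have nK : \forall s \near t, `|s - t| < e / K.
    apply/nbhs_ballP; exists (e / K); first by rewrite /= divr_gt0.
    by move=> s; rewrite /ball /= distrC.
  near=> s; have Ds : time_itv S s by near: s.
  have : `|s - t| < e / K by near: s.
  rewrite ltr_pdivlMr// => /(le_lt_trans _); apply.
  have bd x : C * x * (hnorm (A z) + hnorm z) <= `|x| * K.
    have N0 : 0 <= hnorm (A z) + hnorm z by rewrite addr_ge0 ?hnorm_ge0.
    rewrite /K; move: (hnorm (A z) + hnorm z) N0 => N N0.
    have : C * N * x <= C * N * `|x| by rewrite ler_wpM2l ?ler_norm// mulr_ge0// ltW.
    by have := normr_ge0 x; lra.
  have [s0 sS] := Ds; have [st|ts] := leP s t.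
    rewrite hdistC distrC; apply: le_trans (bd (t - s)).
    by apply: lip => //; exact: lt_le_trans ST.
  apply: le_trans (bd (s - t)); apply: lip => //; first exact: ltW.
  exact: lt_le_trans ST.
have s20 : 0 < Num.sqrt (2 : R) by rewrite sqrtr_gt0.
have s21 : 1 < Num.sqrt (2 : R) by rewrite -[ltLHS]sqrtr1 ltr_sqrt// ltr1n.
have s22 : Num.sqrt (2 : R) ^+ 2 = 2 by rewrite sqr_sqrtr.
(* Both halves C1 (CA + 1) and kap (CA + 1) of the contraction factor are at most w < 1/4. *)
pose w : R := (4 * Num.sqrt 2)^-1.
have w4 : w < 4^-1.
  by rewrite ltf_pV2 ?posrE ?mulr_gt0// ltr_pMr.
have w0 : 0 < w by rewrite invr_gt0 mulr_gt0.
have CA1 : 0 < CA + 1 by rewrite addr_gt0.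
split=> [Ty C20 Tstar|Ty C20].
  pose x : R := (16 * C2 ^+ 2 * (CA + 1) ^+ 2)^-1.
  have x0 : 0 < x by rewrite invr_gt0 !mulr_gt0 ?exprn_gt0.
  (* With this r, C2^2 (exp (2 r) - 1) / 2 = (w / (CA + 1))^2, so kap = w / (CA + 1). *)
  pose r : R := 2^-1 * ln (1 + x).
  have r0 : 0 < r by rewrite mulr_gt0 ?invr_gt0// ln_gt0// ltrDl.
  have er : expR r ^+ 2 = 1 + x.
    rewrite -expRM_natl /r mulrA mulfV// mul1r lnK// posrE; lra.
  have [rho [rho0 rhor Te TT]] : exists rho : R,
      [/\ 0 < rho, rho <= r, Tstar = rho%:E & (Tstar <= T)%E].
    have TE : T = (fine T)%:E by rewrite fineK// ge0_fin_numE// ltW.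
    rewrite /Tstar -/x -/r TE; set tau := fine T in TE *.
    exists (Num.min tau r); split.
    - by rewrite lt_min -lte_fin -TE T0.
    - by rewrite ge_min lexx orbT.
    - by rewrite -EFin_min.
    - by rewrite ge_min lexx.
  have Di : time_itv Tstar = `]0, rho[%classic.
    by rewrite Te time_itv_fin.
  have [ki kle] := Rint_expR_sq C2 rho0.
  have kap0 : 0 <= w / (CA + 1) by rewrite divr_ge0 ?ltW.
  apply: (main _ (w / (CA + 1))) => //.
  - by rewrite Te lte_fin.
  - exact: ltW.
  - by rewrite Di.
  - rewrite Di; apply: le_trans kle _.
    apply: (@le_trans _ _ (C2 ^+ 2 * (x / 2))).
      apply: ler_wpM2l; first exact: sqr_ge0.
      rewrite ler_pM2r ?invr_gt0// lerBlDl -er ler_sqr ?nnegrE ?expR_ge0//.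
      by rewrite ler_expR.
    rewrite le_eqVlt; apply/orP; left; apply/eqP.
    rewrite exprMn /w exprVn exprMn s22 exprVn /x.
    by field; rewrite (gt_eqF CA1) (gt_eqF C20).
  - rewrite mulrDr (mulrC _ (w / _)) divfK ?gt_eqF// mulrC.
    move: cond; rewrite -/w => h; apply: lt_trans (ltrD h w4) _ => //.
    lra.
apply: (main _ 0) => //.
- by rewrite Ty.
- by rewrite C20.
- rewrite C20; exists (fun=> 0); first exact: integrable0.
  by apply: aeW => t _; rewrite mul0r expr0n.
- rewrite C20; under eq_Rintegral do rewrite mul0r expr0n.
  by rewrite Rintegral_cst ?mul0r ?expr0n//; exact: measurable_time_itv.
- rewrite addr0 mulrC; apply: lt_trans cond _; rewrite -/w; apply: lt_trans w4 _; lra.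
Unshelve. all: by end_near. Qed.
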